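(* Let $\mathcal{H}=\bigoplus_{n\ge0}\mathcal{H}_n$ be a graded connected Hopf algebra with state space basis $\mathcal{B}$, and let $\Psi=\sum_D\alpha_D\,\mathrm{Proj}_{d_1}*\dots*\mathrm{Proj}_{d_a}$ be a non-negative convolution of projections on $\mathcal{H}_n$, with $\beta_n:=\sum_{d_1+\dots+d_a=n}\alpha_D\binom{n}{d_1\,\dots\,d_a}$. For a partition $\lambda=(\lambda_1,\dots,\lambda_l)$ of $n$ and a weak composition $D=(d_1,\dots,d_a)$, let $\langle\lambda,D\rangle$ be the number of set partitions $B_1|\dots|B_a$ of $\{1,\dots,l\}$ into $a$ (possibly empty) blocks such that $\sum_{j\in B_i}\lambda_j=d_i$ for each $i\in\{1,\dots,a\}$. Then the eigenvalues of $\frac{1}{\beta_n}\Psi:\mathcal{H}_n\to\mathcal{H}_n$ are \[\left\{\frac{\beta_\lambda}{\beta_n}:=\frac{1}{\beta_n}\sum_{D}\alpha_D\langle\lambda,D\rangle\ \middle|\ \lambda\vdash n\right\}\] (sum over weak compositions $D$ of $n$ with $a$ parts), and the multiplicity of the eigenvalue $\frac{\beta_\lambda}{\beta_n}$ is the coefficient of $x_\lambda:=x_{\lambda_1}\cdots x_{\lambda_l}$ in the generating function $\prod_i(1-x_i)^{-b_i}$, where the integers $b_i$ are defined by $\sum_n\dim\mathcal{H}_n\,t^n=\prod_i(1-t^i)^{-b_i}$. Furthermore, $\Psi$ is diagonalisable if $\mathcal{H}$ is commutative or cocommutative.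
   Context: The ground field is $\mathbb{Q}$ or $\mathbb{R}$. A graded Hopf algebra $\mathcal{H}=\bigoplus_{n\ge0}\mathcal{H}_n$ is connected if $\dim\mathcal{H}_0=1$; each $\mathcal{H}_n$ is finite-dimensional. A basis $\mathcal{B}=\coprod_n\mathcal{B}_n$ ($\mathcal{B}_n$ a basis of $\mathcal{H}_n$) is a state space basis if: (i) for all $w,z\in\mathcal{B}$, $m(w\otimes z)$ has non-negative coefficients in $\mathcal{B}$; (ii) for all $x\in\mathcal{B}$, $\Delta(x)$ has non-negative coefficients in $\mathcal{B}\otimes\mathcal{B}$; (iii) for $n>1$, no $x\in\mathcal{B}_n$ is primitive, i.e. $\Delta(x)\ne1\otimes x+x\otimes1$. For linear maps $f,g:\mathcal{H}\to\mathcal{H}$, the convolution is $f*g:=m(f\otimes g)\Delta$. $\mathrm{Proj}_d$ is the projection onto $\mathcal{H}_d$ (identity on $\mathcal{H}_d$, zero on $\mathcal{H}_i$, $i\ne d$; $d=0$ allowed). Fix $a\ge2$. A non-negative convolution of projections on $\mathcal{H}_n$ is $\Psi=\sum_D\alpha_D\,\mathrm{Proj}_{d_1}*\dots*\mathrm{Proj}_{d_a}$, sum over weak compositions $D=(d_1,\dots,d_a)$ ($d_i\ge0$), with $\alpha_D\ge0$ for all weak compositions $D$ of $n$ and $\alpha_D>0$ for some weak composition $D$ of $n$ with every $d_i\ne n$. *)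

(* Defs.v *)
From HB Require Import structures.
From mathcomp Require Import all_boot all_order all_algebra.
From mathcomp Require Import sesquilinear.
From mathcomp.classical Require Import boolp.
From mathcomp Require Import mpoly.

Set Implicit Arguments.
Unset Strict Implicit.
Unset Printing Implicit Defensive.

Import Order.TTheory GRing.Theory Num.Theory.
Local Open Scope ring_scope.
Local Open Scope quotient_scope.

Notation bilin := (bilinear_for *:%R *:%R).

(* The tensor product U (x) V over F: a list s stands for the formal sum of   *)
(* the pure tensors in it, and two such sums are identified when no bilinear  *)
(* map separates them. The universal property is tlift_tens, tlift_linear     *)
(* and tensor_ext below.                                                      *)
Section Tensor.
Variables (F : fieldType) (U V : lmodType F).

Definition psum (W : lmodType F) (f : U -> V -> W) (s : seq (U * V)) : W :=
  \sum_(p <- s) f p.1 p.2.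

Definition tensor_rel (s s' : seq (U * V)) : bool :=
  `[< forall (W : lmodType F) (f : U -> V -> W), bilin f ->
      psum f s = psum f s' >].

Lemma tensor_rel_refl : reflexive tensor_rel.
Proof. by move=> s; apply/asboolP. Qed.

Lemma tensor_rel_sym s s' : tensor_rel s s' = tensor_rel s' s.
Proof.
by apply/asboolP/asboolP => h W f /(h W f) ->.
Qed.

Lemma tensor_rel_trans : transitive tensor_rel.
Proof.
move=> s s' s'' /asboolP h /asboolP h'; apply/asboolP => W f hf.
by rewrite (h W f hf) (h' W f hf).
Qed.

Canonical tensor_equiv :=
  EquivRel tensor_rel tensor_rel_refl tensor_rel_sym tensor_rel_trans.

Definition tensor := {eq_quot tensor_equiv}.
HB.instance Definition _ := Choice.on tensor.

Definition tpi (s : seq (U * V)) : tensor := \pi_({eq_quot tensor_equiv}) s.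
Definition trepr (t : tensor) : seq (U * V) :=
  @repr _ {eq_quot tensor_equiv} t.

Definition tens (u : U) (v : V) : tensor := tpi [:: (u, v)].

(* On bilinear f, the linear map U (x) V -> W determined by f. *)
Definition tlift (W : lmodType F) (f : U -> V -> W) (t : tensor) : W :=
  psum f (trepr t).

Definition tadd (t t' : tensor) : tensor := tpi (trepr t ++ trepr t').
Definition tscale (c : F) (t : tensor) : tensor :=
  tpi [seq (c *: p.1, p.2) | p <- trepr t].
Definition topp (t : tensor) : tensor := tscale (-1) t.

Lemma treprK t : tpi (trepr t) = t.
Proof. exact: reprK. Qed.

Lemma tpiP s s' : tpi s = tpi s' <->
  forall (W : lmodType F) (f : U -> V -> W), bilin f -> psum f s = psum f s'.
Proof.
split=> [/eqmodP/asboolP //|h]; apply/eqmodP; exact/asboolP.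
Qed.

Lemma tlift_tpi (W : lmodType F) (f : U -> V -> W) s :
  bilin f -> tlift f (tpi s) = psum f s.
Proof. by move=> hf; apply: (tpiP _ _).1 => //; apply: treprK. Qed.

Lemma tensor_sep t t' :
  (forall (W : lmodType F) (f : U -> V -> W), bilin f ->
     tlift f t = tlift f t') -> t = t'.
Proof. by move=> h; rewrite -(treprK t) -(treprK t'); apply/tpiP => W f; apply: h. Qed.

Lemma tliftD_subproof (W : lmodType F) (f : U -> V -> W) t t' :
  bilin f -> tlift f (tadd t t') = tlift f t + tlift f t'.
Proof. by move=> hf; rewrite tlift_tpi // /psum big_cat. Qed.

Lemma tliftZ_subproof (W : lmodType F) (f : U -> V -> W) c t :
  bilin f -> tlift f (tscale c t) = c *: tlift f t.
Proof.
move=> hf; rewrite tlift_tpi // /tlift /psum big_map scaler_sumr.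
apply: eq_bigr => p _ /=.
have f0 : f 0 p.2 = 0.
  have /= := hf.1 p.2 1 0 0; rewrite !scale1r addr0 => /eqP.
  by rewrite -subr_eq0 opprD addrA subrr sub0r oppr_eq0 => /eqP.
by have /= := hf.1 p.2 c p.1 0; rewrite addr0 f0 addr0.
Qed.

Lemma tlift0_subproof (W : lmodType F) (f : U -> V -> W) :
  bilin f -> tlift f (tpi [::]) = 0.
Proof. by move=> hf; rewrite tlift_tpi // /psum big_nil. Qed.

Let tE := (tliftD_subproof, tliftZ_subproof, tlift0_subproof).

Lemma taddA : associative tadd.
Proof. by move=> x y z; apply: tensor_sep => W f hf; rewrite !tE // addrA. Qed.
Lemma taddC : commutative tadd.
Proof. by move=> x y; apply: tensor_sep => W f hf; rewrite !tE // addrC. Qed.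
Lemma tadd0 : left_id (tpi [::]) tadd.
Proof. by move=> x; apply: tensor_sep => W f hf; rewrite !tE // add0r. Qed.
Lemma taddN : left_inverse (tpi [::]) topp tadd.
Proof.
by move=> x; apply: tensor_sep => W f hf; rewrite !tE // scaleN1r addNr.
Qed.

HB.instance Definition _ := GRing.isZmodule.Build tensor taddA taddC tadd0 taddN.

Lemma tscaleA c d x : tscale c (tscale d x) = tscale (c * d) x.
Proof. by apply: tensor_sep => W f hf; rewrite !tE // scalerA. Qed.
Lemma tscale1 : left_id 1 tscale.
Proof. by move=> x; apply: tensor_sep => W f hf; rewrite !tE // scale1r. Qed.
Lemma tscaleDr : right_distributive tscale +%R.
Proof.
by move=> c x y; apply: tensor_sep => W f hf; rewrite !tE // scalerDr.
Qed.
Lemma tscaleDl x : {morph tscale^~ x : c d / c + d}.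
Proof.
by move=> c d; apply: tensor_sep => W f hf; rewrite !tE // scalerDl.
Qed.

HB.instance Definition _ := GRing.Zmodule_isLmodule.Build F tensor
  tscaleA tscale1 tscaleDr tscaleDl.

Lemma tlift_linear (W : lmodType F) (f : U -> V -> W) :
  bilin f -> linear (tlift f).
Proof.
move=> hf c x y; rewrite -(tliftZ_subproof _ _ hf) -(tliftD_subproof _ _ hf).
by [].
Qed.

Lemma tlift_tens (W : lmodType F) (f : U -> V -> W) u v :
  bilin f -> tlift f (tens u v) = f u v.
Proof. by move=> hf; rewrite tlift_tpi // /psum big_seq1. Qed.

Lemma tens_bilin : bilin tens.
Proof.
split=> [v|u] c x y; apply: tensor_sep => W f hf.
  by rewrite (tlift_linear hf) !tlift_tens //; apply: hf.1.
by rewrite (tlift_linear hf) !tlift_tens //; apply: hf.2.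
Qed.

Lemma tensorE t : t = \sum_(p <- trepr t) tens p.1 p.2.
Proof.
apply: tensor_sep => W f hf.
pose g : {linear tensor -> W} := HB.pack (tlift f)
  (GRing.isLinear.Build F tensor W *:%R (tlift f) (tlift_linear hf)).
rewrite -[RHS]/(g _) linear_sum; apply: eq_bigr => p _.
by rewrite /= tlift_tens.
Qed.

Lemma tensor_ext (W : lmodType F) (g h : {linear tensor -> W}) :
  (forall u v, g (tens u v) = h (tens u v)) -> g =1 h.
Proof.
by move=> gh t; rewrite (tensorE t) !linear_sum; apply: eq_bigr => p _.
Qed.

End Tensor.

Notation "u \ox v" := (tens u v) (at level 40, left associativity).

Section TensorMaps.
Variable F : fieldType.

Definition tmap (U V U' V' : lmodType F) (f : U -> U') (g : V -> V') :
  tensor U V -> tensor U' V' := tlift (fun u v => f u \ox g v).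

Definition tswap (U V : lmodType F) : tensor U V -> tensor V U :=
  tlift (fun u v => v \ox u).

Definition tassoc (U V W : lmodType F) :
  tensor (tensor U V) W -> tensor U (tensor V W) :=
  tlift (fun t w => tlift (fun u v => u \ox (v \ox w)) t).

Variable A : algType F.

Definition tmult : tensor A A -> A := tlift (fun x y => x * y).

(* (x (x) y) (x' (x) y') = x x' (x) y y', without signs. *)
Definition tmul (s t : tensor A A) : tensor A A :=
  tlift (fun x y => tlift (fun x' y' => (x * x') \ox (y * y')) t) s.

End TensorMaps.

Section Hopf.
Variables (F : fieldType) (H : algType F).

Record hopf_structure := HopfStructure {
  comult : {linear H -> tensor H H};
  counit : {linear H -> F^o};
  antipode : {linear H -> H};
  comultA : forall x,
    tassoc (tmap comult idfun (comult x)) = tmap idfun comult (comult x);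
  counitl : forall x, tlift (fun u v => counit u *: v) (comult x) = x;
  counitr : forall x, tlift (fun u v => counit v *: u) (comult x) = x;
  comultM : forall x y, comult (x * y) = tmul (comult x) (comult y);
  comult1 : comult 1 = 1 \ox 1;
  counitM : forall x y, counit (x * y) = counit x * counit y;
  counit1 : counit 1 = 1;
  antipodel : forall x, tmult (tmap antipode idfun (comult x)) = counit x *: 1;
  antipoder : forall x, tmult (tmap idfun antipode (comult x)) = counit x *: 1
}.

(* H = (+)_n H_n, given by the inclusions H_n -> H and the projections        *)
(* H -> H_n. The field grade_sum says that every x is a finite sum of         *)
(* homogeneous elements.                                                      *)
Record grading := Grading {
  grade :> nat -> vectType F;
  grade_in : forall n, {linear grade n -> H};
  grade_pr : forall n, {linear H -> grade n};
  grade_inK : forall n, cancel (grade_in n) (grade_pr n);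
  grade_pr0 : forall m n x, m != n -> grade_pr m (grade_in n x) = 0;
  grade_sum : forall x, exists N, x = \sum_(n < N) grade_in n (grade_pr n x)
}.

Definition cocommutative (C : hopf_structure) : Prop :=
  forall x, tswap (comult C x) = comult C x.

Section Graded.
Variables (C : hopf_structure) (G : grading).

Definition Proj (d : nat) : {linear H -> H} := grade_in G d \o grade_pr G d.

Definition homogeneous (n : nat) (x : H) : Prop := Proj n x = x.

(* (Proj_i (x) Proj_(n-i)) is the projection of H (x) H onto                  *)
(* H_i (x) H_(n-i).                                                           *)
Definition graded_hopf : Prop :=
  [/\ homogeneous 0 1,
      forall i j x y, homogeneous i x -> homogeneous j y -> homogeneous (i + j) (x * y),
      forall n x, homogeneous n x ->
        comult C x = \sum_(i < n.+1) tmap (Proj i) (Proj (n - i)) (comult C x)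
    & forall n x, homogeneous n x -> n != 0%N -> counit C x = 0].

Definition connected : Prop := \dim {: G 0} = 1%N.

Lemma conv_bilin (f g : {linear H -> H}) : bilin (fun u v => f u \ox g v).
Proof.
split=> [v|u] c x y /=; rewrite linearP.
  exact: (@tens_bilin F H H).1.
exact: (@tens_bilin F H H).2.
Qed.

Lemma mult_bilin : bilin (fun x y : H => x * y).
Proof.
split=> [v|u] c x y /=; first by rewrite mulrDl scalerAl.
by rewrite mulrDr scalerAr.
Qed.

Lemma conv_linear (f g : {linear H -> H}) :
  linear (fun x => tmult (tmap f g (comult C x))).
Proof.
move=> c x y; rewrite linearP /tmap (tlift_linear (conv_bilin f g)).
by rewrite /tmult (tlift_linear mult_bilin).
Qed.

Definition conv_fun (f g : {linear H -> H}) (x : H) : H :=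
  tmult (tmap f g (comult C x)).

HB.instance Definition _ (f g : {linear H -> H}) :=
  GRing.isLinear.Build F H H *:%R (conv_fun f g) (conv_linear f g).

Definition conv (f g : {linear H -> H}) : {linear H -> H} := conv_fun f g.

Lemma conv_unit_linear : linear (fun x => counit C x *: (1 : H)).
Proof. by move=> c x y; rewrite linearP scalerDl scalerA. Qed.

Definition conv_unit_fun (x : H) : H := counit C x *: 1.

HB.instance Definition _ :=
  GRing.isLinear.Build F H H *:%R conv_unit_fun conv_unit_linear.

Definition conv_unit : {linear H -> H} := conv_unit_fun.

(* Convolution is associative with neutral element conv_unit (the unit after  *)
(* the counit), so the nesting and the final conv_unit do not matter.         *)
Definition conv_Proj (a : nat) (d : 'I_a -> nat) : {linear H -> H} :=
  \big[conv/conv_unit]_(i < a) Proj (d i).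

End Graded.

End Hopf.

Section Combinatorics.

Record wcomp (a n : nat) := WComp {
  wcomp_val :> {ffun 'I_a -> 'I_n.+1};
  _ : (\sum_i wcomp_val i == n)%N
}.
HB.instance Definition _ a n := [isSub for @wcomp_val a n].
HB.instance Definition _ a n := [Finite of wcomp a n by <:].

Definition is_intpart (n : nat) (s : seq nat) : bool :=
  [&& sorted geq s, 0%N \notin s & sumn s == n].

(* Partitions of n; the bounds on the length and on the parts hold for every  *)
(* partition of n and make the type finite.                                   *)
Record intpart (n : nat) := IntPart {
  intpart_val : n.-bseq 'I_n.+1;
  _ : is_intpart n (map val intpart_val)
}.
HB.instance Definition _ n := [isSub for @intpart_val n].
HB.instance Definition _ n := [Finite of intpart n by <:].

Definition parts (n : nat) (lam : intpart n) : seq nat :=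
  map val (intpart_val lam).
Coercion parts : intpart >-> seq.

Definition multinomial (a n : nat) (D : wcomp a n) : nat :=
  (n`! %/ \prod_i (D i)`!)%N.

(* The number <lam, D>: the blocks B_1 | ... | B_a carry labels. *)
Definition bracket (a n : nat) (lam : intpart n) (D : wcomp a n) : nat :=
  let l := size lam in
  #|[set P : {ffun 'I_a -> {set 'I_l}} |
      [&& [forall i, forall j, (i != j) ==> [disjoint P i & P j]],
          \bigcup_i P i == [set: 'I_l]
        & [forall i, (\sum_(j in P i) nth 0 lam j == D i)%N]]]|.

(* (1 - x)^(-b) modulo x^(N+1). *)
Definition geom_pow (R : comNzRingType) (N : nat) (x : R) (b : int) : R :=
  match b with
  | Posz m => (\sum_(k < N.+1) x ^+ k) ^+ m
  | Negz m => (1 - x) ^+ m.+1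
  end.

(* sum_n dims(n) t^n = prod_(i >= 1) (1 - t^i)^(-b_i): the coefficient of t^n *)
(* only involves the factors with i <= n, modulo t^(n+1). The value b 0 is    *)
(* not used.                                                                  *)
Definition product_expansion (dims : nat -> nat) (b : nat -> int) : Prop :=
  forall n, (dims n)%:Z =
    (\prod_(1 <= i < n.+1) geom_pow n ('X^i : {poly int}) (b i))`_n.

(* The monomial x_lam, where x_i is the variable of index i - 1. *)
Definition part_monom (n : nat) (lam : intpart n) : 'X_{1..n} :=
  [multinom count_mem i.+1 (lam : seq nat) | i < n].

(* The coefficient of x_lam in prod_i (1 - x_i)^(-b_i). *)
Definition part_mult (b : nat -> int) (n : nat) (lam : intpart n) : int :=
  (\prod_(i < n) geom_pow n ('X_i : {mpoly int[n]}) (b i.+1))@_(part_monom lam).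

End Combinatorics.

Section StateSpace.
Variables (F : realFieldType) (H : algType F).
Variables (C : hopf_structure H) (G : grading H).

Variable B : forall n, (\dim {: G n}).-tuple (G n).

Definition bas (n : nat) (k : 'I_(\dim {: G n})) : H :=
  grade_in G n (tnth (B n) k).

(* The coefficient of x on bas k, and of t on bas k (x) bas l. *)
Definition bcoef (n : nat) (k : 'I_(\dim {: G n})) (x : H) : F :=
  coord (B n) k (grade_pr G n x).
Definition bcoef2 (m n : nat) (k : 'I_(\dim {: G m})) (l : 'I_(\dim {: G n}))
    (t : tensor H H) : F :=
  tlift (fun x y => bcoef k x * bcoef l y : F^o) t.

Definition state_space_basis : Prop :=
  [/\ forall n, basis_of {: G n} (B n),
      forall (i j n : nat) k l m, 0 <= @bcoef n m (@bas i k * @bas j l),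
      forall (n i j : nat) m k l, 0 <= @bcoef2 i j k l (comult C (@bas n m))
    & forall (n : nat) k, (1 < n)%N ->
        comult C (@bas n k) <> 1 \ox bas k + bas k \ox 1].

Variables (a n : nat) (alpha : wcomp a n -> F).

Definition nonneg_weights : Prop :=
  (forall D, 0 <= alpha D) /\
  exists D : wcomp a n, (forall i, D i != n :> nat) /\ 0 < alpha D.

(* Only the weak compositions of n contribute to Psi on H_n. *)
Definition Psi_fun (x : H) : H :=
  \sum_(D : wcomp a n) alpha D *: conv_Proj C G (fun i => D i) x.

Lemma Psi_linear : linear Psi_fun.
Proof.
move=> c x y; rewrite /Psi_fun scaler_sumr -big_split /=.
by apply: eq_bigr => D _; rewrite linearP scalerDr !scalerA mulrC.
Qed.

HB.instance Definition _ := GRing.isLinear.Build F H H *:%R Psi_fun Psi_linear.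

Definition Psi : {linear H -> H} := Psi_fun.

Definition Psi_n : 'End(G n) := linfun (grade_pr G n \o Psi \o grade_in G n).

Definition beta_n : F := \sum_(D : wcomp a n) alpha D * (multinomial D)%:R.

Definition beta_part (lam : intpart n) : F :=
  \sum_(D : wcomp a n) alpha D * (bracket lam D)%:R.

End StateSpace.

(* Main.v *)
(* Write I for the augmentation ideal. Lift to H a homogeneous basis of the    *)
(* primitives of the graded Hopf algebra gr H = (+)_k I^k / I^(k+1), each lift *)
(* being homogeneous with a weight k. Since gr H is generated by primitives    *)
(* and commutators of primitives are primitive, the ordered monomials in the   *)
(* lifts span H; applying the coproduct and separating off the first letter    *)
(* shows, by induction on the degree, that they are independent. On a monomial *)
(* whose letters have degrees lam, the convolution of projections along D is   *)
(* <lam, D> times that monomial, up to monomials that have larger weight or    *)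
(* equal weight and fewer letters. Hence Psi is triangular with diagonal       *)
(* entries beta_lam, and counting monomials identifies both b_i (the number of *)
(* letters of degree i) and the multiplicities.                                *)
(*                                                                             *)
(* If H is commutative or cocommutative, composing the projections along D and *)
(* E gives the sum, over the matrices with row sums E and column sums D, of    *)
(* the convolutions of projections along the entries. The matrices with one    *)
(* nonzero entry in each row contribute beta_E; any other matrix of nonzero    *)
(* weight gives a strict refinement E' of E with beta_E' > beta_E, because     *)
(* alpha >= 0. By induction on refinement, the product of Psi - beta over the  *)
(* distinct values of beta vanishes on H_n.                                    *)

From HB Require Import structures.
Require Import Defs.
From mathcomp Require Import all_boot all_order all_algebra.
From mathcomp Require Import mpoly zify.
From mathcomp.classical Require Import boolp.
Import Order.TTheory GRing.Theory Num.Theory.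
Local Open Scope ring_scope.

Set Implicit Arguments.
Unset Strict Implicit.
Unset Printing Implicit Defensive.

(** * Tensors and Sweedler sums *)

(** Everything rests on the filtration of H by the powers of the augmentation ideal I ([augpow]). An
    element of positive degree is primitive modulo I^2 ([hom_prim]), so the associated graded Hopf
    algebra is generated by primitives, and commutators of primitives are primitive ([prim_comm]).
    For letters lifting a homogeneous basis of these primitives, a Poincare-Birkhoff-Witt argument
    makes the sorted words a basis of each H_n ([words_basis]): straightening gives spanning
    ([lfil_perm], [augpow_lspan]), and pairing the coproduct of a relation with dual functionals
    gives independence ([word_free_sub], [words_free]).

    Modulo higher weight, the coproduct of a word sends each letter left or right. Hence convolution
    along D multiplies a word with letter degrees lambda by the number of distributions of lambda
    over D, up to words of larger weight, or of equal weight with fewer letters ([convProjs_word]).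
    So Psi is triangular with diagonal entries beta_lambda ([char_poly_Psi]). Counting sorted words
    by degree identifies b_i with the number of letters of degree i ([pbw_product_expansion],
    [product_expansion_unique]); counting them by the multiset of letter degrees gives the
    multiplicities ([part_mult_pbw], [prod_words_intpart]).

    Diagonalisability comes from an annihilating product of distinct linear factors
    ([diagonalizable_of_roots]). By [convProjs_comm] or [convProjs_cocomm], composing Psi with the
    convolution along E gives beta_E times the latter plus convolutions along strict refinements of
    E, whose beta is larger ([beta_seq_refine_lt]); the resulting induction is
    [Psi_subs_convProjs]. *)

Definition to_linear (F : fieldType) (U V : lmodType F) (f : U -> V)
    (hf : linear f) : {linear U -> V} :=
  HB.pack f (GRing.isLinear.Build F U V *:%R f hf).

Section TensorLift.
Variables (F : fieldType) (U V : lmodType F).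
Implicit Types (t : tensor U V).

(** [tlift f t] is a sum over a chosen representative of t. Linearity in f is read off that list;
    linearity in t relies on f being bilinear. *)
Lemma eq_tlift (W : lmodType F) (f g : U -> V -> W) t :
  (forall u v, f u v = g u v) -> tlift f t = tlift g t.
Proof. by move=> fg; apply: eq_bigr => p _; apply: fg. Qed.

Lemma tlift_linear_comp (W W' : lmodType F) (h : {linear W -> W'})
    (f : U -> V -> W) t :
  h (tlift f t) = tlift (fun u v => h (f u v)) t.
Proof. exact: linear_sum. Qed.

Lemma tlift_fct_sum (I : Type) (r : seq I) (P : pred I) (W : lmodType F)
    (f : I -> U -> V -> W) t :
  tlift (fun u v => \sum_(i <- r | P i) f i u v) t
    = \sum_(i <- r | P i) tlift (f i) t.
Proof. exact: exchange_big. Qed.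

Lemma tlift_fctD (W : lmodType F) (f g : U -> V -> W) t :
  tlift (fun u v => f u v + g u v) t = tlift f t + tlift g t.
Proof. exact: big_split. Qed.

Lemma tlift_fctZ (W : lmodType F) c (f : U -> V -> W) t :
  tlift (fun u v => c *: f u v) t = c *: tlift f t.
Proof. by rewrite /tlift /psum scaler_sumr. Qed.

Lemma tlift_fct0 (W : lmodType F) t : tlift (fun u v => 0 : W) t = 0.
Proof. exact: big1. Qed.

Section Bilinear.
Variables (W : lmodType F) (f : U -> V -> W).
Hypothesis hf : bilin f.

Lemma tliftP c t t' : tlift f (c *: t + t') = c *: tlift f t + tlift f t'.
Proof. exact: (tlift_linear hf). Qed.
Lemma tliftD t t' : tlift f (t + t') = tlift f t + tlift f t'.
Proof. by have := tliftP 1 t t'; rewrite !scale1r. Qed.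
Lemma tlift0 : tlift f 0 = 0.
Proof. by apply: (addrI (tlift f 0)); rewrite -tliftD !addr0. Qed.
Lemma tliftZ c t : tlift f (c *: t) = c *: tlift f t.
Proof. by have := tliftP c t 0; rewrite tlift0 !addr0. Qed.
Lemma tliftN t : tlift f (- t) = - tlift f t.
Proof. by rewrite -scaleN1r tliftZ scaleN1r. Qed.
Lemma tliftB t t' : tlift f (t - t') = tlift f t - tlift f t'.
Proof. by rewrite tliftD tliftN. Qed.
Lemma tlift_sum (I : Type) (r : seq I) (P : pred I) (t : I -> tensor U V) :
  tlift f (\sum_(i <- r | P i) t i) = \sum_(i <- r | P i) tlift f (t i).
Proof.
by elim/big_rec2: _ => [|i x y _ <-]; rewrite ?tlift0 ?tliftD.
Qed.
End Bilinear.

Lemma tlift_tens_id t : tlift (@tens F U V) t = t.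
Proof. by rewrite [RHS]tensorE. Qed.

Lemma bilin0l (W : lmodType F) (f : U -> V -> W) v : bilin f -> f 0 v = 0.
Proof.
move=> [hl _]; have /= := hl v (-1) 0 0.
by rewrite scaler0 addr0 scaleN1r addNr.
Qed.
Lemma bilin0r (W : lmodType F) (f : U -> V -> W) u : bilin f -> f u 0 = 0.
Proof.
move=> [_ hr]; have /= := hr u (-1) 0 0.
by rewrite scaler0 addr0 scaleN1r addNr.
Qed.
Lemma bilinZl (W : lmodType F) (f : U -> V -> W) c u v :
  bilin f -> f (c *: u) v = c *: f u v.
Proof. by move=> hf; have /= := hf.1 v c u 0; rewrite !addr0 bilin0l // addr0. Qed.
Lemma bilinZr (W : lmodType F) (f : U -> V -> W) c u v :
  bilin f -> f u (c *: v) = c *: f u v.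
Proof. by move=> hf; have /= := hf.2 u c v 0; rewrite !addr0 bilin0r // addr0. Qed.

End TensorLift.

Lemma comp_bilin (F : fieldType) (U V U' V' W W' : lmodType F)
    (f : U -> V -> W) (g : {linear U' -> U}) (h : {linear V' -> V})
    (k : {linear W -> W'}) :
  bilin f -> bilin (fun u v => k (f (g u) (h v))).
Proof.
move=> [hl hr]; split=> [v|u] c x y /=; rewrite !linearP.
  by rewrite (hl (h v)) linearP.
by rewrite (hr (g u)) linearP.
Qed.

Section Sweedler.
Variables (F : fieldType) (H : algType F) (C : hopf_structure H).

(* [sweedler f x] is [\sum f x1 x2] in Sweedler's notation. *)
Definition sweedler (W : lmodType F) (f : H -> H -> W) (x : H) : W :=
  tlift f (comult C x).

Lemma eq_sweedler (W : lmodType F) (f g : H -> H -> W) x :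
  (forall u v, f u v = g u v) -> sweedler f x = sweedler g x.
Proof. exact: eq_tlift. Qed.

Lemma sweedler_fct0 (W : lmodType F) (f : H -> H -> W) x :
  (forall u v, f u v = 0) -> sweedler f x = 0.
Proof. by move=> f0; rewrite (eq_sweedler _ f0); apply: tlift_fct0. Qed.

Lemma sweedler_fct_sum (I : Type) (r : seq I) (P : pred I) (W : lmodType F)
    (f : I -> H -> H -> W) x :
  sweedler (fun u v => \sum_(i <- r | P i) f i u v) x
    = \sum_(i <- r | P i) sweedler (f i) x.
Proof. exact: tlift_fct_sum. Qed.

Lemma sweedlerP (W : lmodType F) (f : H -> H -> W) c x y : bilin f ->
  sweedler f (c *: x + y) = c *: sweedler f x + sweedler f y.
Proof. by move=> hf; rewrite /sweedler linearP tliftP. Qed.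

Lemma sweedler_linear_comp (W W' : lmodType F) (h : {linear W -> W'})
    (f : H -> H -> W) x :
  h (sweedler f x) = sweedler (fun u v => h (f u v)) x.
Proof. exact: tlift_linear_comp. Qed.

Lemma sweedler_sum (W : lmodType F) (f : H -> H -> W)
    (I : Type) (r : seq I) (P : pred I) (x : I -> H) : bilin f ->
  sweedler f (\sum_(i <- r | P i) x i) = \sum_(i <- r | P i) sweedler f (x i).
Proof. by move=> hf; rewrite /sweedler linear_sum tlift_sum. Qed.

Lemma sweedlerM (W : lmodType F) (f : H -> H -> W) x y : bilin f ->
  sweedler f (x * y) = sweedler (fun u v =>
    sweedler (fun u' v' => f (u * u') (v * v')) y) x.
Proof.
move=> hf; rewrite /sweedler comultM /tmul.
pose g := to_linear (tlift_linear hf); rewrite -[LHS]/(g _) tlift_linear_comp.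
apply: eq_tlift => u v; rewrite tlift_linear_comp.
by apply: eq_tlift => u' v' /=; rewrite tlift_tens.
Qed.

Lemma sweedler_fct_linear (V W : lmodType F) (f : V -> H -> H -> W) x :
  (forall u w, linear (fun v => f v u w)) -> linear (fun v => sweedler (f v) x).
Proof.
move=> hl c v w; rewrite -tlift_fctZ -tlift_fctD.
by apply: eq_tlift => u u'; apply: hl.
Qed.

Definition trilin (W : lmodType F) (T : H -> H -> H -> W) : Prop :=
  [/\ forall v w, linear (fun u => T u v w),
      forall u w, linear (fun v => T u v w)
    & forall u v, linear (fun w => T u v w)].

Lemma sweedlerA (W : lmodType F) (T : H -> H -> H -> W) x : trilin T ->
  sweedler (fun u v => sweedler (T u) v) x
    = sweedler (fun u v => sweedler (fun u1 u2 => T u1 u2 v) u) x.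
Proof.
move=> hT; have [h1 h2 h3] := hT.
have hTu u : bilin (T u) by split=> [v|v]; [apply: h2|apply: h3].
have hTw w : bilin (fun u v => T u v w) by split=> [v|v]; [apply: h1|apply: h2].
have hb : bilin (fun u (t : tensor H H) => tlift (T u) t).
  split=> [t|u] c y z /=; last by rewrite tliftP.
  by rewrite -tlift_fctZ -tlift_fctD; apply: eq_tlift => v w; apply: h1.
have hid : bilin (fun u v : H => u \ox comult C v).
  split=> [v|u] c y z /=; rewrite ?linearP.
    by rewrite (@tens_bilin F _ _).1.
  by rewrite (@tens_bilin F _ _).2.
have hid' : bilin (fun u v : H => comult C u \ox v).
  split=> [v|u] c y z /=; rewrite ?linearP.
    by rewrite (@tens_bilin F _ _).1.
  by rewrite (@tens_bilin F _ _).2.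
(* K is the map that T induces on H tensored with H tensor H; the two sides of the goal are K
   applied to the two sides of [comultA]. *)
pose K := to_linear (tlift_linear hb).
transitivity (K (tmap idfun (comult C) (comult C x))).
  rewrite /tmap tlift_linear_comp.
  by apply: eq_tlift => u v /=; rewrite tlift_tens.
rewrite -comultA /tassoc.
have hs (w : H) : bilin (fun u v : H => u \ox (v \ox w)).
  split=> [v|u] c y z /=; first by rewrite (@tens_bilin F _ _).1.
  by rewrite (@tens_bilin F _ _).1 (@tens_bilin F _ _).2.
have hbt : bilin (fun (t : tensor H H) (w : H) => tlift (fun u v => u \ox (v \ox w)) t).
  split=> [w|t] c y z /=; first by rewrite tliftP.
  rewrite -tlift_fctZ -tlift_fctD; apply: eq_tlift => u v.
  by rewrite (@tens_bilin F _ _).2 (@tens_bilin F _ _).2.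
rewrite /tmap.
pose A := to_linear (tlift_linear hbt).
rewrite -[X in K X]/(A _) (tlift_linear_comp A) tlift_linear_comp.
apply: eq_tlift => u v /=; rewrite tlift_tens //.
rewrite -[LHS]/(K _) tlift_linear_comp; apply: eq_tlift => u1 u2 /=.
by rewrite !tlift_tens.
Qed.

Lemma sweedlerC (W : lmodType F) (f : H -> H -> W) x :
  cocommutative C -> bilin f -> sweedler f x = sweedler (fun u v => f v u) x.
Proof.
move=> hC hf; rewrite /sweedler -[in LHS]hC /tswap.
pose g := to_linear (tlift_linear hf).
rewrite -[LHS]/(g _) tlift_linear_comp.
by apply: eq_tlift => u v /=; rewrite tlift_tens.
Qed.

(** Of the four Sweedler factors the middle two are exchanged: coassociativity groups them as the
    coproduct of one factor, which cocommutativity flips. *)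
Lemma sweedlerACA (W : lmodType F) (Q : H -> H -> H -> H -> W) x :
  cocommutative C ->
  (forall a, trilin (Q a)) -> (forall b c d, linear (fun a => Q a b c d)) ->
  sweedler (fun u v => sweedler (fun p q => sweedler (Q p q) v) u) x =
  sweedler (fun u v =>
    sweedler (fun p p' => sweedler (fun q => Q p q p') v) u) x.
Proof.
move=> hC hQ h1.
have hb a b : bilin (Q a b).
  by have [_ h3 h4] := hQ a; split=> [v|v]; [apply: h3|apply: h4].
have hb' a d : bilin (fun b c => Q a b c d).
  by have [h2 h3 h4] := hQ a; split=> [v|v]; [apply: h2|apply: h3].
have hQs a : trilin (fun p' q => Q a q p').
  by have [h2 h3 h4] := hQ a.
have hT1 : trilin (fun p q => sweedler (Q p q)).
  split=> [q z|p z|p q].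
  - by apply: (sweedler_fct_linear (f := fun p => Q p q)).
  - by apply: (sweedler_fct_linear (f := Q p)) => u w; have [] := hQ p.
  - by move=> c y z; rewrite sweedlerP.
have hT2 : trilin (fun p p' => sweedler (fun q => Q p q p')).
  split=> [q z|p z|p q].
  - by apply: (sweedler_fct_linear (f := fun p b c => Q p b q c)).
  - by apply: (sweedler_fct_linear (f := fun v b c => Q p b v c)) => u w; have [] := hQ p.
  - move=> c y z; rewrite sweedlerP //; have [? ? ?] := hQ p.
    by split.
rewrite -(sweedlerA _ hT1) -(sweedlerA _ hT2).
apply: eq_tlift => p r; rewrite (sweedlerA _ (hQ p)) (sweedlerA _ (hQs p)).
by apply: eq_tlift => s q'; rewrite sweedlerC.
Qed.

End Sweedler.

(** * Convolution and the grading *)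

Section Convolution.
Variables (F : fieldType) (H : algType F) (C : hopf_structure H).

Lemma convE (f g : {linear H -> H}) x :
  conv C f g x = sweedler C (fun u v => f u * g v) x.
Proof.
rewrite /conv /= /conv_fun /tmult /tmap.
rewrite -[LHS]/(to_linear (tlift_linear (mult_bilin H)) _) tlift_linear_comp.
by apply: eq_tlift => u v /=; rewrite tlift_tens //; apply: mult_bilin.
Qed.

Lemma conv_linr (f g : {linear H -> H}) : bilin (fun u v => f u * g v).
Proof. exact: (comp_bilin f g (idfun : {linear H -> H}) (mult_bilin H)). Qed.

Lemma sweedler_conv (W : lmodType F) (h : H -> H -> W) (f g : {linear H -> H}) x :
  bilin h ->
  sweedler C h (conv C f g x) =
  sweedler C (fun u v => sweedler C h (f u * g v)) x.
Proof.
move=> hh; rewrite convE.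
have hl : linear (sweedler C h) by move=> c y z; rewrite sweedlerP.
by rewrite -[LHS]/(to_linear hl _) sweedler_linear_comp.
Qed.

Lemma counitlE x : sweedler C (fun u v => counit C u *: v) x = x.
Proof. exact: counitl. Qed.
Lemma counitrE x : sweedler C (fun u v => counit C v *: u) x = x.
Proof. exact: counitr. Qed.

Lemma conv_unitE x : conv_unit C x = counit C x *: 1.
Proof. by []. Qed.

Lemma conv1l f x : conv C (conv_unit C) f x = f x.
Proof.
rewrite convE -[in RHS](counitlE x) sweedler_linear_comp.
by apply: eq_tlift => u v; rewrite conv_unitE linearZ -scalerAl mul1r.
Qed.

Lemma eq_conv (f f' g g' : {linear H -> H}) : f =1 f' -> g =1 g' ->
  conv C f g =1 conv C f' g'.
Proof. by move=> ff gg x; rewrite !convE; apply: eq_sweedler => u v; rewrite ff gg. Qed.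

Lemma convA (f g h : {linear H -> H}) x :
  conv C (conv C f g) h x = conv C f (conv C g h) x.
Proof.
pose T u v w := f u * g v * h w.
have hT : trilin T.
  split=> [v w|u w|u v] c y z; rewrite /T linearP.
  - by rewrite mulrDl mulrDl !scalerAl.
  - by rewrite mulrDr mulrDl -scalerAr -scalerAl.
  - by rewrite mulrDr -scalerAr.
rewrite !convE.
transitivity (sweedler C (fun u v => sweedler C (fun u1 u2 => T u1 u2 v) u) x).
  apply: eq_tlift => u v; rewrite convE.
  have hl : linear (fun z => z * h v) by move=> c y z; rewrite mulrDl scalerAl.
  by rewrite -[LHS]/(to_linear hl _) sweedler_linear_comp.
rewrite -sweedlerA //; apply: eq_tlift => u v; rewrite convE.
have hl : linear (fun z => f u * z) by move=> c y z; rewrite mulrDr scalerAr.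
rewrite -[RHS]/(to_linear hl _) sweedler_linear_comp.
by apply: eq_tlift => v1 v2; rewrite /T /= mulrA.
Qed.

Variable G : grading H.

(** The list form of [conv_Proj], which allows induction on the parts of D. *)
Definition convProjs (D : seq nat) : {linear H -> H} :=
  foldr (fun d f => conv C (Proj G d) f) (conv_unit C) D.

Lemma convProjs_nil x : convProjs [::] x = counit C x *: 1.
Proof. by []. Qed.

Lemma convProjs_cons d D x :
  convProjs (d :: D) x = sweedler C (fun u v => Proj G d u * convProjs D v) x.
Proof. exact: convE. Qed.

Lemma conv_ProjE a (d : 'I_a -> nat) :
  conv_Proj C G d = convProjs [seq d i | i <- enum 'I_a].
Proof.
rewrite /conv_Proj /convProjs enumT -[Finite.enum _]/(index_enum _).
by elim: (index_enum _) => [|i r IH]; rewrite ?big_nil ?big_cons //= IH.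
Qed.

Lemma convProjs_cat D E x :
  convProjs (D ++ E) x = conv C (convProjs D) (convProjs E) x.
Proof.
elim: D x => [|d D IH] x; first by rewrite conv1l.
by rewrite [RHS]convA; apply: eq_conv.
Qed.

End Convolution.

(** * Degrees, and what connectedness says about degree zero *)

Section Graded.
Variables (F : fieldType) (H : algType F) (C : hopf_structure H) (G : grading H).
Hypotheses (hG : graded_hopf C G) (hC : connected G).
Notation P := (Proj G).
Notation hom := (homogeneous G).

Lemma ProjE d x : P d x = grade_in G d (grade_pr G d x). Proof. by []. Qed.

Lemma Proj_Proj i j x : P i (P j x) = if i == j then P j x else 0.
Proof.
rewrite !ProjE; have [->|ij] := eqVneq i j; first by rewrite grade_inK.
by rewrite grade_pr0 // linear0.
Qed.

Lemma hom_in n v : hom n (grade_in G n v).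
Proof. by rewrite /homogeneous ProjE grade_inK. Qed.

Lemma hom_Proj n x : hom n (P n x). Proof. exact: hom_in. Qed.

Lemma Proj_hom i n x : hom n x -> P i x = if i == n then x else 0.
Proof.
move=> hx; rewrite -[in LHS]hx Proj_Proj.
by case: eqP => // _; apply: hx.
Qed.

Lemma homP n c x y : hom n x -> hom n y -> hom n (c *: x + y).
Proof. by move=> hx hy; rewrite /homogeneous linearP hx hy. Qed.

Lemma hom0 n : hom n 0. Proof. exact: linear0. Qed.

Lemma homZ n c x : hom n x -> hom n (c *: x).
Proof. by move=> hx; have := homP c hx (hom0 n); rewrite addr0. Qed.

Lemma hom1 : hom 0 1. Proof. by case: hG. Qed.

Lemma homM i j x y : hom i x -> hom j y -> hom (i + j) (x * y).
Proof. by case: hG => _ h _ _; apply: h. Qed.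

Lemma hom0P x : hom 0 x -> exists c, x = c *: 1.
Proof.
move=> hx.
have n1 : grade_pr G 0 1 != 0.
  apply/eqP => e; have := hom1; rewrite /homogeneous ProjE e linear0.
  by move/esym/eqP; rewrite oner_eq0.
have : (grade_pr G 0 x \in <[grade_pr G 0 1]>)%VS.
  have -> : (<[grade_pr G 0 1]> = fullv)%VS.
    by apply/eqP; rewrite eqEdim subvf /= dim_vline n1 hC.
  exact: memvf.
case/vlineP => c ec; exists c.
by rewrite -[x in LHS]hx ProjE ec linearZ /= -ProjE [P 0 1]hom1.
Qed.

Lemma counit_hom n x : hom n x -> n != 0%N -> counit C x = 0.
Proof. by case: hG => _ _ _; apply. Qed.

Lemma Proj0E x : P 0 x = counit C x *: 1.
Proof.
have [c ec] := hom0P (hom_Proj 0 x).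
suff -> : counit C x = counit C (P 0 x).
  rewrite ec linearZ /= counit1; congr (_ *: _); exact: esym (mulr1 c).
have [N eN] := grade_sum G x; rewrite {1}eN linear_sum.
case: N eN => [|N] eN; first by rewrite big_ord0 eN big_ord0 linear0 linear0.
rewrite big_ord_recl /= big1 ?addr0 // => i _.
by rewrite (counit_hom (hom_in _)).
Qed.

Lemma convProjs_cons0 D x : convProjs C G (0%N :: D) x = convProjs C G D x.
Proof.
rewrite /= -[RHS](conv1l C); apply: eq_conv => // u.
by rewrite Proj0E conv_unitE.
Qed.

Lemma comult_hom n x : hom n x ->
  comult C x = \sum_(i < n.+1) tmap (P i) (P (n - i)) (comult C x).
Proof. by case: hG => _ _ h _; apply: h. Qed.

Lemma sweedler_hom (W : lmodType F) (f : H -> H -> W) n x :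
  bilin f -> hom n x ->
  sweedler C f x = \sum_(i < n.+1) sweedler C (fun u v => f (P i u) (P (n - i) v)) x.
Proof.
move=> hf hx; rewrite {1}/sweedler (comult_hom hx) tlift_sum //.
apply: eq_bigr => i _; rewrite /tmap -[LHS]/(to_linear (tlift_linear hf) _).
by rewrite tlift_linear_comp; apply: eq_tlift => u v /=; rewrite tlift_tens.
Qed.

Lemma sweedler_hom_off (W : lmodType F) (f : H -> H -> W) n i j x :
  bilin f -> hom n x -> (i + j)%N != n ->
  sweedler C (fun u v => f (P i u) (P j v)) x = 0.
Proof.
move=> hf hx ij.
have hf' : bilin (fun u v => f (P i u) (P j v)).
  exact: (comp_bilin (P i) (P j) (idfun : {linear W -> W}) hf).
rewrite (sweedler_hom hf' hx) big1 // => k _.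
apply: sweedler_fct0 => u v.
rewrite !Proj_Proj; case: eqP => [ik|_]; last by rewrite bilin0l.
case: eqP => [jk|_]; last by rewrite bilin0r.
by case/eqP: ij; rewrite ik jk subnKC // -ltnS.
Qed.

(** The coproduct respects degrees. Writing x as a finite sum of homogeneous components, only the
    one of degree d contributes to the right-hand side. *)
Lemma sweedler_Proj (W : lmodType F) (f : H -> H -> W) d x : bilin f ->
  sweedler C f (P d x) =
  \sum_(i < d.+1) sweedler C (fun u v => f (P i u) (P (d - i) v)) x.
Proof.
move=> hf; rewrite (sweedler_hom hf (hom_Proj d x)); apply: eq_bigr => i _.
have hf' : bilin (fun u v => f (P i u) (P (d - i) v)).
  exact: (comp_bilin (P i) (P (d - i)) (idfun : {linear W -> W}) hf).
have [N eN] := grade_sum G x.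
have eN' : x = \sum_(k < N) P k x by [].
case: (ltnP d N) => dN.
  rewrite [in RHS]eN' sweedler_sum // (bigD1 (Ordinal dN)) //= [X in _ + X]big1 ?addr0 //.
  move=> k kd; apply: (sweedler_hom_off hf (hom_Proj k x)).
  rewrite subnKC; last by rewrite -ltnS.
  by apply: contraNneq kd => dk; apply/eqP/val_inj.
have -> : P d x = 0.
  rewrite eN' linear_sum big1 // => k _; rewrite Proj_Proj ifN //.
  by rewrite gtn_eqF // (leq_trans _ dN).
rewrite {1}/sweedler linear0 tlift0 // {1}eN' sweedler_sum // big1 // => k _.
apply: (sweedler_hom_off hf (hom_Proj k x)).
rewrite subnKC; last by rewrite -ltnS.
by rewrite gtn_eqF // (leq_trans _ dN).
Qed.

End Graded.

(** * Composition of convolutions of projections *)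

(* The pairs of vectors with (pointwise) sum [D]. *)
Fixpoint splits (D : seq nat) : seq (seq nat * seq nat) :=
  if D is d :: D' then
    flatten [seq [seq (i :: p.1, (d - i)%N :: p.2) | p <- splits D'] | i <- iota 0 d.+1]
  else [:: ([::], [::])].

(* The matrices with row sums [E] and sum of rows [D]. *)
Fixpoint mats (D E : seq nat) : seq (seq (seq nat)) :=
  if E is e :: E' then
    flatten [seq [seq p.1 :: M | M <- mats p.2 E'] | p <- splits D & sumn p.1 == e]
  else if all (pred1 0%N) D then [:: [::]] else [::].

Lemma splits_cons d D :
  splits (d :: D) =
  flatten [seq [seq (i :: p.1, (d - i)%N :: p.2) | p <- splits D] | i <- iota 0 d.+1].
Proof. by []. Qed.

Lemma mats_cons D e E :
  mats D (e :: E) =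
  flatten [seq [seq p.1 :: M | M <- mats p.2 E] | p <- splits D & sumn p.1 == e].
Proof. by []. Qed.

Lemma big_splits_cons (V : Type) (idx : V) (op : Monoid.law idx) d D
    (f : seq nat * seq nat -> V) :
  \big[op/idx]_(p <- splits (d :: D)) f p =
  \big[op/idx]_(i < d.+1)
    \big[op/idx]_(p <- splits D) f (val i :: p.1, (d - i)%N :: p.2).
Proof.
rewrite splits_cons big_flatten big_map -[in iota 0 _](subn0 d.+1) -/(index_iota 0 d.+1).
by rewrite big_mkord; apply: eq_bigr => i _; rewrite big_map.
Qed.

Lemma big_mats_cons (V : Type) (idx : V) (op : Monoid.law idx) D e E
    (f : seq (seq nat) -> V) :
  \big[op/idx]_(M <- mats D (e :: E)) f M =
  \big[op/idx]_(p <- splits D | sumn p.1 == e)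
    \big[op/idx]_(M <- mats p.2 E) f (p.1 :: M).
Proof.
rewrite mats_cons big_flatten big_map big_filter.
by apply: eq_bigr => p _; rewrite big_map.
Qed.

(* Keeps [/=] from unfolding the composition. *)
Opaque Proj.

Section Mackey.
Variables (F : fieldType) (H : algType F) (C : hopf_structure H) (G : grading H).
Hypotheses (hG : graded_hopf C G) (hC : connected G).
Notation P := (Proj G).
Notation hom := (homogeneous G).
Notation PD := (convProjs C G).

Lemma hom_sum n (I : Type) (r : seq I) (Q : pred I) (f : I -> H) :
  (forall i, Q i -> hom n (f i)) -> hom n (\sum_(i <- r | Q i) f i).
Proof.
by move=> h; rewrite /homogeneous linear_sum; apply: eq_bigr => i /h.
Qed.

Lemma hom_sweedler n (f : H -> H -> H) x :
  (forall u v, hom n (f u v)) -> hom n (sweedler C f x).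
Proof. by move=> h; apply: hom_sum. Qed.

Lemma hom_convProjs D x : hom (sumn D) (PD D x).
Proof.
elim: D x => [|d D IH] x.
  by apply: homZ; apply: (hom1 hG).
rewrite convProjs_cons; apply: hom_sweedler => u v.
by apply: (homM hG) => //; apply: hom_Proj.
Qed.

Lemma convProjs_Proj D e x : PD D (P e x) = if sumn D == e then PD D x else 0.
Proof.
elim: D e x => [|d D IH] e x.
  rewrite !convProjs_nil; case: (eqVneq (sumn [::]) e) => [<-|e0].
    by rewrite (Proj0E hG hC) linearZ /= (counit1 C); congr (_ *: _); exact: mulr1.
  by rewrite (counit_hom hG (hom_Proj G e x)) ?scale0r // eq_sym.
rewrite !convProjs_cons (sweedler_Proj hG); last exact: conv_linr.
have hk (i : 'I_e.+1) u v : P d (P i u) * PD D (P (e - i) v) =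
    if (d == i) && (sumn D == e - i)%N then P d u * PD D v else 0.
  rewrite Proj_Proj IH; case: eqP => [->|] /=; last by rewrite mul0r.
  by case: eqP => _ //; rewrite mulr0.
under eq_bigr => i _ do rewrite (eq_sweedler C x (hk i)).
rewrite /=; have [<-|ne] := eqVneq (d + sumn D)%N e.
  have dl : (d < (d + sumn D).+1)%N by rewrite ltnS leq_addr.
  rewrite (bigD1 (Ordinal dl)) //= big1 ?addr0.
    by apply: eq_sweedler => u v; rewrite eqxx addKn eqxx.
  move=> i; rewrite -val_eqE /= eq_sym => /negPf ->.
  exact: sweedler_fct0.
rewrite big1 // => i _; apply: sweedler_fct0 => u v.
case: eqP => //= di; case: eqP => // si; case/eqP: ne.
by rewrite si di subnKC // -ltnS.
Qed.

Lemma Proj_convProjs D e x : P e (PD D x) = if sumn D == e then PD D x else 0.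
Proof. by rewrite (Proj_hom e (hom_convProjs D x)) eq_sym. Qed.

Lemma ProjM d x y : P d (x * y) = \sum_(i < d.+1) P i x * P (d - i) y.
Proof.
have hxy k l u v : hom k u -> hom l v ->
    P d (u * v) = \sum_(i < d.+1) P i u * P (d - i) v.
  move=> hu hv; rewrite (Proj_hom d (homM hG hu hv)).
  have [->|ne] := eqVneq d (k + l)%N.
    have kl : (k < (k + l).+1)%N by rewrite ltnS leq_addr.
    rewrite (bigD1 (Ordinal kl)) //= addKn (Proj_hom k hu) (Proj_hom l hv) !eqxx.
    rewrite big1 ?addr0 // => i.
    by rewrite -val_eqE /= => /negPf ik; rewrite (Proj_hom i hu) ik mul0r.
  rewrite big1 // => i _; rewrite (Proj_hom i hu) (Proj_hom (d - i) hv).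
  case: eqP => [ik|]; last by rewrite mul0r.
  case: eqP => [il|]; last by rewrite mulr0.
  by case/eqP: ne; rewrite -ik -il subnKC // -ltnS.
have [N eN] := grade_sum G x; have [K eK] := grade_sum G y.
have {eN} eN : x = \sum_(k < N) P k x by [].
have {eK} eK : y = \sum_(l < K) P l y by [].
rewrite [in LHS]eN [in LHS]eK mulr_suml linear_sum.
under eq_bigr => k _ do rewrite mulr_sumr linear_sum.
under eq_bigr => k _ do under eq_bigr => l _ do
  rewrite (hxy _ _ _ _ (hom_Proj G k x) (hom_Proj G l y)).
rewrite [in RHS]eN [in RHS]eK.
under [RHS]eq_bigr => i _ do rewrite !linear_sum mulr_suml;
  under [RHS]eq_bigr => i _ do under eq_bigr => k _ do rewrite mulr_sumr.
rewrite [RHS]exchange_big /=; apply: eq_bigr => k _.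
by rewrite [RHS]exchange_big.
Qed.

(** In a commutative H the factors coming from x can be collected before those coming from y; each
    part of D is split into the degree taken from x and the degree taken from y. *)
Lemma convProjsM (comm : commutative (@GRing.mul H)) D x y :
  PD D (x * y) = \sum_(p <- splits D) PD p.1 x * PD p.2 y.
Proof.
elim: D x y => [|d D IH] x y.
  by rewrite big_seq1 !convProjs_nil counitM -scalerAl mul1r scalerA.
rewrite big_splits_cons convProjs_cons sweedlerM; last exact: conv_linr.
pose T i (p : seq nat * seq nat) u v u' v' := (P i u * PD p.1 v) * (P (d - i) u' * PD p.2 v').
transitivity (\sum_(i < d.+1) \sum_(p <- splits D)
    sweedler C (fun u v => sweedler C (T i p u v) y) x).
  under [RHS]eq_bigr => i _ do rewrite -sweedler_fct_sum.
  rewrite -sweedler_fct_sum; apply: eq_sweedler => u v.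
  under [RHS]eq_bigr => i _ do rewrite -sweedler_fct_sum.
  rewrite -sweedler_fct_sum; apply: eq_sweedler => u' v'.
  rewrite ProjM IH mulr_suml; apply: eq_bigr => i _.
  rewrite mulr_sumr; apply: eq_bigr => p _; rewrite /T.
  by rewrite -!mulrA; congr (_ * _); rewrite !mulrA; congr (_ * _); apply: comm.
apply: eq_bigr => i _; apply: eq_bigr => p _; rewrite !convProjs_cons.
have hl : linear (fun z => z * sweedler C (fun u v => P (d - i) u * PD p.2 v) y).
  by move=> c a b; rewrite mulrDl scalerAl.
rewrite -[RHS]/(to_linear hl _) sweedler_linear_comp; apply: eq_sweedler => u v /=.
have hr : linear (fun z => P i u * PD p.1 v * z).
  by move=> c a b; rewrite mulrDr scalerAr.
by rewrite -[RHS]/(to_linear hr _) sweedler_linear_comp.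
Qed.

(** The dual of [convProjsM]: cocommutativity enters through [sweedlerACA], which collects the left
    tensor factors before the right ones. *)
Lemma sweedler_convProjs (coco : cocommutative C) (W : lmodType F)
    (f : H -> H -> W) D x : bilin f ->
  sweedler C f (PD D x) =
  \sum_(p <- splits D) sweedler C (fun u v => f (PD p.1 u) (PD p.2 v)) x.
Proof.
elim: D W f x => [|d D IH] W f x hf.
  rewrite big_seq1 convProjs_nil.
  have -> : sweedler C f (counit C x *: 1) = counit C x *: f 1 1.
    by rewrite /sweedler linearZ /= comult1 tliftZ // tlift_tens.
  rewrite -[in LHS](counitlE C x) sweedler_linear_comp /=.
  have hl : linear (fun z : F^o => (z : F) *: f 1 1).
    by move=> c a b; rewrite scalerDl scalerA.
  rewrite -[LHS]/(to_linear hl _) sweedler_linear_comp.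
  apply: eq_sweedler => u v /=; rewrite linearZ /= !(convProjs_nil C G).
  by rewrite (bilinZl _ _ _ hf) (bilinZr _ _ _ hf) scalerA.
rewrite big_splits_cons [LHS]sweedler_conv //.
pose Q i (p : seq nat * seq nat) a b c e :=
  f (P i a * PD p.1 c) (P (d - i) b * PD p.2 e).
transitivity (\sum_(i < d.+1) \sum_(p <- splits D)
    sweedler C (fun u v => sweedler C (fun a b => sweedler C (Q i p a b) v) u) x).
  under [RHS]eq_bigr => i _ do rewrite -sweedler_fct_sum.
  rewrite -sweedler_fct_sum; apply: eq_sweedler => u v.
  rewrite sweedlerM //.
  rewrite (sweedler_Proj hG); last first.
    split=> [b|a] c y z /=.
      apply: (@sweedler_fct_linear _ _ C H W (fun a u' v' => f (a * u') (b * v'))).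
      by move=> u' v' c' y' z'; rewrite mulrDl -scalerAl hf.1.
    apply: (@sweedler_fct_linear _ _ C H W (fun b u' v' => f (a * u') (b * v'))).
    by move=> u' v' c' y' z'; rewrite mulrDl -scalerAl hf.2.
  apply: eq_bigr => i _.
  rewrite -sweedler_fct_sum; apply: eq_sweedler => a b.
  rewrite IH; last first.
    by split=> [v'|u'] c y z /=; rewrite mulrDr -scalerAr (hf.1, hf.2).
  by rewrite -sweedler_fct_sum.
apply: eq_bigr => i _; apply: eq_bigr => p _.
rewrite sweedlerACA //; last 2 first.
- move=> a; split=> [c e|b e|b c] k y z; rewrite /Q linearP.
  + by rewrite mulrDl -scalerAl hf.2.
  + by rewrite mulrDr -scalerAr hf.1.
  + by rewrite mulrDr -scalerAr hf.2.
- by move=> b c e k y z; rewrite /Q linearP mulrDl -scalerAl hf.1.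
apply: eq_sweedler => u v; rewrite !convProjs_cons.
have hl w : linear (fun z => f z w) by move=> c a b; rewrite hf.1.
rewrite -[RHS]/(to_linear (hl _) _) sweedler_linear_comp; apply: eq_sweedler => a b /=.
have hr w : linear (f w) by move=> c e e'; rewrite hf.2.
by rewrite -[RHS]/(to_linear (hr _) _) sweedler_linear_comp.
Qed.

Definition nz := filter (predC1 0%N).

Lemma convProjs_nz D x : PD (nz D) x = PD D x.
Proof.
elim: D x => [//|[|d] D IH] x /=; first by rewrite IH -(convProjs_cons0 hG hC).
exact: eq_conv.
Qed.

Lemma convProjs_1 D : PD D 1 = (all (pred1 0%N) D)%:R.
Proof.
elim: D => [|d D IH]; first by rewrite convProjs_nil (counit1 C) scale1r.
rewrite [all _ _]/= [PD _]/=.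
rewrite convE /sweedler comult1 tlift_tens; last exact: conv_linr.
rewrite IH (Proj_hom d (hom1 hG)).
by case: eqP => _ /=; rewrite ?mul1r ?mul0r.
Qed.

(** This is the product rule of the descent algebra. The inner convolution is a product with one
    factor per part of E; applying the outer one with [convProjsM] spreads each factor over D, which
    produces one matrix row at a time. *)
Lemma convProjs_comm (comm : commutative (@GRing.mul H)) D E x :
  PD D (PD E x) = \sum_(M <- mats D E) PD (flatten M) x.
Proof.
elim: E D x => [|e E IH] D x.
  rewrite convProjs_nil linearZ /= convProjs_1.
  case: (all _ _); last by rewrite big_nil scaler0.
  by rewrite big_seq1.
rewrite big_mats_cons convProjs_cons sweedler_linear_comp.
transitivity (\sum_(p <- splits D | sumn p.1 == e)
    \sum_(M <- mats p.2 E) sweedler C (fun u v => PD p.1 u * PD (flatten M) v) x).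
  under [RHS]eq_bigr => p _ do rewrite -sweedler_fct_sum.
  rewrite -sweedler_fct_sum; apply: eq_sweedler => u v.
  rewrite convProjsM // [RHS]big_mkcond; apply: eq_bigr => p _.
  rewrite convProjs_Proj; case: eqP => _; last by rewrite mul0r.
  by rewrite IH mulr_sumr.
apply: eq_bigr => p _; apply: eq_bigr => M _.
by rewrite /= convProjs_cat convE.
Qed.

(** The same matrices, read by rows, appear for the opposite order of composition: here the
    coproduct of the inner convolution is split, so the rows still belong to E. *)
Lemma convProjs_cocomm (coco : cocommutative C) D E x :
  PD E (PD D x) = \sum_(M <- mats D E) PD (flatten M) x.
Proof.
elim: E D x => [|e E IH] D x.
  rewrite convProjs_nil -(Proj0E hG hC) Proj_convProjs.
  have -> : (sumn D == 0)%N = all (pred1 0%N) D.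
    by elim: D => //= d D <-; rewrite addn_eq0.
  rewrite [mats _ _]/=; case e0: (all _ _); last by rewrite big_nil.
  rewrite big_seq1 convProjs_nil; elim: D e0 x => //= d D IHD /andP[/eqP-> D0] x.
  by rewrite -IHD // -[RHS](convProjs_cons0 hG hC).
rewrite big_mats_cons convProjs_cons sweedler_convProjs //; last exact: conv_linr.
rewrite [RHS]big_mkcond; apply: eq_bigr => p _.
have [pe|pe] := eqVneq; last first.
  by apply: sweedler_fct0 => u v; rewrite Proj_convProjs (negPf pe) mul0r.
under [RHS]eq_bigr => M _ do rewrite /= convProjs_cat convE.
rewrite -sweedler_fct_sum; apply: eq_sweedler => u v.
by rewrite Proj_convProjs pe eqxx IH mulr_sumr.
Qed.

End Mackey.

(** * Distributing parts over blocks *)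

Section Distributions.
Local Open Scope nat_scope.

(** The ways to put a part e into one block with enough room; what is returned are the sums the
    blocks still have to reach. *)
Fixpoint picks (e : nat) (D : seq nat) : seq (seq nat) :=
  if D is d :: D' then
    (if e <= d then [:: d - e :: D'] else [::]) ++ map (cons d) (picks e D')
  else [::].

(* The number of ways to distribute the parts [E] over blocks with sums [D]. *)
Fixpoint distrib (D E : seq nat) : nat :=
  if E is e :: E' then \sum_(D' <- picks e D) distrib D' E'
  else all (pred1 0) D.

Definition single (r : seq nat) := size (nz r) == 1.

Lemma sumn_eq0 r : (sumn r == 0) = (nz r == [::]).
Proof. by elim: r => [|[|x] r IH] //=; rewrite add0n. Qed.

Lemma nz_cat r s : nz (r ++ s) = nz r ++ nz s. Proof. exact: filter_cat. Qed.

Lemma sumn_nz r : sumn (nz r) = sumn r.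
Proof. by elim: r => [|[|x] r IH] //=; rewrite IH. Qed.

Lemma splits_zero D (f : seq nat -> nat) :
  \sum_(p <- splits D | sumn p.1 == 0) f p.2 = f D.
Proof.
elim: D f => [|d D IH] f; first by rewrite big_mkcond big_seq1.
rewrite big_mkcond big_splits_cons big_ord_recl /= [X in _ + X]big1 ?addn0.
  rewrite -big_mkcond -(IH (fun D' => f (d :: D'))) subn0.
  by rewrite [LHS]big_mkcond [RHS]big_mkcond; apply: eq_bigr => p _; rewrite add0n.
by move=> i _; apply: big1.
Qed.

(** A row of sum e with one nonzero entry amounts to the choice of the column holding e. *)
Lemma big_splits_single D e (f : seq nat -> nat) : 0 < e ->
  \sum_(p <- splits D | (sumn p.1 == e) && single p.1) f p.2
    = \sum_(D' <- picks e D) f D'.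
Proof.
move=> e0; elim: D f => [|d D IH] f.
  by rewrite big_nil big_mkcond big_seq1 /single /= andbF.
rewrite big_mkcond big_splits_cons big_ord_recl /= big_cat big_map /= addnC.
congr (_ + _).
  have h (i : 'I_d) : \sum_(p <- splits D)
      (if (bump 0 i + sumn p.1 == e) && single (bump 0 i :: p.1)
       then f ((d - bump 0 i) :: p.2) else 0) =
      if i.+1 == e then f (d - i.+1 :: D) else 0.
    rewrite -(splits_zero D (fun D' => if i.+1 == e then f (d - i.+1 :: D') else 0)).
    rewrite [RHS]big_mkcond; apply: eq_bigr => p _; rewrite /bump /= add1n.
    rewrite /single /= eqSS size_eq0 -sumn_eq0.
    by case: (sumn p.1) => [|k]; rewrite ?addn0 ?andbT ?andbF.
  rewrite (eq_bigr _ (fun i _ => h i)); case: leqP => ed.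
    rewrite big_seq1; case: e e0 ed {IH h} => // e _ ed.
    rewrite (bigD1 (Ordinal ed)) //= eqxx big1 ?addn0 // => i.
    by rewrite -val_eqE eqSS => /negPf /= ->.
  rewrite big_nil big1 // => i _; case: eqP => // ie.
  by move: ed; rewrite -ie ltnS leqNgt ltn_ord.
rewrite -(IH (fun D' => f (d :: D'))) subn0 -big_mkcond.
by apply: eq_bigl => p; rewrite /single /= add0n.
Qed.

(** When every row has a single nonzero entry, that entry is the whole part, so the matrix records
    into which block each part goes. *)
Lemma count_mats_single D E : all (predC1 0) E ->
  \sum_(M <- mats D E | all single M) 1 = distrib D E.
Proof.
elim: E D => [|e E IH] D /=; first by case: all => _; rewrite big_mkcond ?big_seq1 ?big_nil.
case/andP=> e0 E0; rewrite big_mkcond big_mats_cons.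
rewrite -big_splits_single ?lt0n // big_mkcondr /=.
apply: eq_bigr => p _; rewrite -IH //; case: (single _) => /=; last by rewrite big1.
by rewrite -big_mkcond.
Qed.

Lemma mem_splits D p : p \in splits D ->
  [/\ size p.1 = size D, size p.2 = size D
    & forall i, nth 0 p.1 i + nth 0 p.2 i = nth 0 D i].
Proof.
elim: D p => [|d D IH] p; first by rewrite inE => /eqP-> /=; split=> // i; rewrite nth_nil.
rewrite splits_cons => /flatten_mapP[i]; rewrite mem_iota add0n => /andP[_ id].
case/mapP=> q /IH[s1 s2 sq] -> /=; split; rewrite ?s1 ?s2 //.
by case=> [|k] /=; [rewrite subnKC|apply: sq].
Qed.

Lemma mem_mats D E M : M \in mats D E ->
  [/\ all [pred r | size r == size D] M, map sumn M = E
    & forall i, \sum_(r <- M) nth 0 r i = nth 0 D i].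
Proof.
elim: E D M => [|e E IH] D M.
  rewrite /=; case: ifP => // D0; rewrite inE => /eqP-> /=; split=> // i.
  rewrite big_nil; case: (ltnP i (size D)) => iD; last by rewrite nth_default.
  by apply/esym/eqP; apply: (allP D0); apply: mem_nth.
rewrite mats_cons => /flatten_mapP[p]; rewrite mem_filter => /andP[/eqP pe pD].
case/mapP=> M' /IH[s1 s2 s3] ->; have [q1 q2 q3] := mem_splits pD.
rewrite /= q1 eqxx pe s2 -q2 s1; split=> // i.
by rewrite big_cons s3 q3.
Qed.

Lemma single_nz r : single r -> nz r = [:: sumn r].
Proof.
rewrite /single -(sumn_nz r); case: (nz r) => [|x []] //= _.
by rewrite addn0.
Qed.

Lemma all_single_nz M : all single M -> nz (flatten M) = map sumn M.
Proof.
by elim: M => //= r M IH /andP[/single_nz r1 /IH <-]; rewrite nz_cat r1.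
Qed.

Section FfunRec.
Variables (A : finType) (l : nat).

Definition ffcons (x : A) (f : {ffun 'I_l -> A}) : {ffun 'I_l.+1 -> A} :=
  [ffun j => if unlift ord0 j is Some k then f k else x].

Lemma ffcons0 x f : ffcons x f ord0 = x.
Proof. by rewrite ffunE unlift_none. Qed.

Lemma ffconsS x f j : ffcons x f (lift ord0 j) = f j.
Proof. by rewrite ffunE liftK. Qed.

Lemma big_ffun_recl (V : Type) (idx : V) (op : Monoid.com_law idx)
    (h : {ffun 'I_l.+1 -> A} -> V) :
  \big[op/idx]_f h f = \big[op/idx]_x \big[op/idx]_f h (ffcons x f).
Proof.
rewrite pair_bigA /= (reindex (fun p : A * _ => ffcons p.1 p.2)) //.
exists (fun f : {ffun 'I_l.+1 -> A} =>
  (f ord0, [ffun j : 'I_l => f (lift ord0 j)])) => [[x f] _|f _] /=.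
  by rewrite ffcons0; congr (_, _); apply/ffunP => j; rewrite ffunE ffconsS.
apply/ffunP => j; case: (unliftP ord0 j) => [k|] ->.
  by rewrite ffconsS ffunE.
by rewrite ffcons0.
Qed.
End FfunRec.

(** The distributions counted by [distrib], as functions from positions of parts to blocks; in this
    form refinements are compared by an injection. *)
Definition assign (a : nat) (D E : seq nat) : {set {ffun 'I_(size E) -> 'I_a}} :=
  [set f : {ffun 'I_(size E) -> 'I_a} |
    [forall i, \sum_(j | f j == i) nth 0 E j == nth 0 D i]].

Lemma big_picks (f : seq nat -> nat) e D :
  \sum_(D' <- picks e D) f D' =
  \sum_(i < size D | e <= nth 0 D i) f (set_nth 0 D i (nth 0 D i - e)).
Proof.
elim: D f => [|d D IH] f; first by rewrite big_nil big_ord0.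
rewrite /= big_cat big_map IH big_mkcond [in RHS]big_mkcond big_ord_recl /=.
rewrite -[in RHS]big_mkcond; congr (_ + _).
by case: ifP; rewrite ?big_seq1 ?big_nil.
Qed.

Lemma assign_cons a D e E (x : 'I_a) (f : {ffun 'I_(size E) -> 'I_a}) :
  (ffcons x f \in assign a D (e :: E)) =
  (e <= nth 0 D x) && (f \in assign a (set_nth 0 D x (nth 0 D x - e)) E).
Proof.
have sumE (i : 'I_a) :
    \sum_(j | ffcons x f j == i) nth 0 (e :: E) j =
    (if x == i then e else 0) + \sum_(j | f j == i) nth 0 E j.
  rewrite big_mkcond big_ord_recl ffcons0 /=; congr (_ + _).
  by rewrite [RHS]big_mkcond; apply: eq_bigr => j _; rewrite ffconsS.
rewrite !inE; apply/forallP/andP => [h|[ex /forallP h] i].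
  have ex : e <= nth 0 D x.
    by have /eqP := h x; rewrite sumE eqxx => <-; apply: leq_addr.
  split=> //; apply/forallP => i; have /eqP := h i.
  rewrite sumE nth_set_nth /= eq_sym.
  by rewrite val_eqE; case: eqP => [->|_] <-; rewrite ?addKn.
have /eqP := h i; rewrite sumE nth_set_nth /= eq_sym val_eqE.
by case: eqP => [xi|_] ->; rewrite ?add0n ?xi ?subnKC -?xi.
Qed.

Lemma distribE D E : distrib D E = #|assign (size D) D E|.
Proof.
have [a Da] : exists a, a = size D by exists (size D).
rewrite -Da; elim: E D Da => [|e E IH] D Da.
  have -> : assign a D [::] = if all (pred1 0) D then setT else set0.
    apply/setP => f; rewrite inE; apply/forallP/idP => [h|].
      case: ifP => // /negP[]; apply/(all_nthP 0) => i; rewrite -Da => ia.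
      by have /eqP := h (Ordinal ia); rewrite big_ord0 /= => <-.
    case: ifP => [/(all_nthP 0) h _ i|]; last by rewrite inE.
    by rewrite big_ord0 eq_sym; apply: h; rewrite -Da.
  by rewrite /=; case: all; rewrite ?cards0 // cardsT card_ffun !card_ord.
rewrite /= big_picks -Da -sum1_card [RHS]big_mkcond big_ffun_recl [LHS]big_mkcond.
apply: eq_bigr => x _; under [RHS]eq_bigr => f _ do rewrite assign_cons.
case: leqP => ex; last by rewrite big1.
rewrite IH; first by rewrite -big_mkcond sum1_card.
by rewrite size_set_nth -Da; apply/esym; apply/maxn_idPr.
Qed.

(* An assignment of the parts [E] induces one of the entries of [M], constant *)
(* on rows, whereas assigning every entry of [M] to its column gives the sums *)
(* [D0]; when [M] has a row with two nonzero entries the latter is not        *)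
(* constant on rows.                                                          *)
Section Refine.
Variables (D0 E : seq nat) (M : seq (seq nat)).
Hypotheses (E0 : all (predC1 0) E) (MD : M \in mats D0 E).
Let a := size D0.
Let l := size E.
Let m (x : 'I_l * 'I_a) := nth 0 (nth [::] M x.1) x.2.
Let cells := [seq x <- [seq (p, i) | p <- enum 'I_l, i <- enum 'I_a] | m x != 0].

Let sM : size M = l.
Proof. by have [_ eE _] := mem_mats MD; rewrite /l -[in RHS]eE size_map. Qed.

Let srow p : p < l -> size (nth [::] M p) = a.
Proof.
move=> pl; have [/allP h _ _] := mem_mats MD; apply/eqP/h; apply: mem_nth.
by rewrite sM.
Qed.

(** The parts of the refinement are the nonzero matrix entries in row order, so they can be indexed
    by their cells. *)
Let nz_flatten : nz (flatten M) = [seq m x | x <- cells].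
Proof.
rewrite /cells -(filter_map m (predC1 0)) map_allpairs /nz; congr filter.
have {1}-> : M = [seq nth [::] M (val p) | p <- enum 'I_l].
  rewrite (map_comp (nth [::] M) val) val_enum_ord -sM.
  exact/esym/mkseq_nth.
congr flatten; apply/eq_in_map => p _ /=.
have sr := srow (ltn_ord p).
rewrite (map_comp (nth 0 (nth [::] M p)) val) val_enum_ord -sr.
exact/esym/mkseq_nth.
Qed.

Let rowsum (p : 'I_l) : \sum_i m (p, i) = nth 0 E p.
Proof.
have [_ eE _] := mem_mats MD; rewrite -[in RHS]eE.
rewrite (nth_map [::]) ?sM // sumnE (big_nth 0) big_mkord srow //.
Qed.

Let colsum (i : 'I_a) : \sum_p m (p, i) = nth 0 D0 i.
Proof.
have [_ _ eD] := mem_mats MD; by rewrite -eD [RHS](big_nth [::]) sM big_mkord.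
Qed.

Let sE : size (nz (flatten M)) = size cells.
Proof. by rewrite nz_flatten size_map. Qed.

Let cell (j : 'I_(size (nz (flatten M)))) : 'I_l * 'I_a :=
  tnth (in_tuple cells) (cast_ord sE j).

Let sum_cells (Q : pred ('I_l * 'I_a)) :
  \sum_(j | Q (cell j)) nth 0 (nz (flatten M)) j
    = \sum_p \sum_(i | Q (p, i)) m (p, i).
Proof.
transitivity (\sum_(j | Q (cell j)) m (cell j)).
  have nthE k : nth 0 (nz (flatten M)) k = nth 0 [seq m x | x <- cells] k.
    by rewrite nz_flatten.
  apply: eq_bigr => j _; rewrite nthE (nth_map (cell j)) -?sE //.
  by congr m; apply/esym; apply: tnth_nth.
rewrite (reindex_onto (cast_ord (esym sE)) (cast_ord sE)) /=; last first.
  by move=> j _; apply: val_inj.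
rewrite (eq_bigl (fun j => Q (tnth (in_tuple cells) j))); last first.
  move=> j; rewrite /cell cast_ordKV.
  by rewrite (introT eqP) ?andbT //; apply: val_inj.
under eq_bigr => j _ do rewrite /cell cast_ordKV.
rewrite -(big_tnth _ _ cells Q m) big_filter_cond.
rewrite big_mkcond big_allpairs /= big_enum; apply: eq_bigr => p _.
rewrite big_enum /= [RHS]big_mkcond; apply: eq_bigr => i _.
by case: (Q _); case: eqP => //= ->.
Qed.

Let cell_onto x : m x != 0 -> exists j, cell j = x.
Proof.
move=> mx; have : x \in in_tuple cells.
  rewrite mem_filter mx; case: x mx => p i _; apply/allpairsP.
  by exists (p, i); rewrite !mem_enum.
by case/tnthP => j ->; exists (cast_ord (esym sE) j); rewrite /cell cast_ordKV.
Qed.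

Let pull (f : {ffun 'I_l -> 'I_a}) : {ffun 'I_(size (nz (flatten M))) -> 'I_a} :=
  [ffun j => f (cell j).1].

(** No part of E is zero, so every row has a nonzero cell, at which the pulled-back assignment still
    shows the value of f on that row. *)
Let pull_inj : injective pull.
Proof.
move=> f g fg; apply/ffunP => p.
have [i mi] : exists i, m (p, i) != 0.
  apply/existsP; rewrite -negb_forall; apply/negP => /forallP h.
  have := allP E0 _ (mem_nth 0 (ltn_ord p)); rewrite -rowsum /= big1 // => i _.
  exact/eqP.
have [j ej] := cell_onto mi.
by move/ffunP/(_ j): fg; rewrite !ffunE ej.
Qed.

Let pull_assign D f : f \in assign a D E -> pull f \in assign a D (nz (flatten M)).
Proof.
rewrite !inE => /forallP h; apply/forallP => i; rewrite -(eqP (h i)); apply/eqP.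
under eq_bigl => j do rewrite ffunE.
rewrite (sum_cells (fun x => f x.1 == i)) [RHS]big_mkcond; apply: eq_bigr => p _ /=.
by case: eqP => _; [apply: rowsum | rewrite big_pred0_eq].
Qed.

Lemma distrib_refine D : size D = a -> distrib D E <= distrib D (nz (flatten M)).
Proof.
move=> Da; rewrite !distribE Da -(card_imset _ pull_inj); apply: subset_leq_card.
by apply/subsetP => _ /imsetP[f /pull_assign h ->].
Qed.

Lemma distrib_refine_lt : ~~ all single M -> distrib D0 E < distrib D0 (nz (flatten M)).
Proof.
case/allPn => r rM nr; rewrite !distribE -(card_imset _ pull_inj).
(* The witness for strictness: each nonzero entry is assigned to its own column. *)
pose k : {ffun 'I_(size (nz (flatten M))) -> 'I_a} := [ffun j => (cell j).2].
apply: proper_card; apply/properP; split.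
  by apply/subsetP => _ /imsetP[f /pull_assign h ->].
exists k.
  rewrite !inE; apply/forallP => i; apply/eqP; rewrite -colsum.
  under eq_bigl => j do rewrite ffunE.
  rewrite (sum_cells (fun x => x.2 == i)); apply: eq_bigr => p _ /=.
  by rewrite big_pred1_eq.
apply/imsetP => -[f _ /ffunP kf]; case/negP: nr.
have pl : index r M < l by rewrite -sM index_mem.
have sr : size r = a by rewrite -(srow pl) nth_index.
pose p := Ordinal pl.
have mp i : m (p, i) = nth 0 r i by rewrite /m /= nth_index.
have Ep : sumn r = nth 0 E p.
  rewrite -rowsum sumnE (big_nth 0) sr big_mkord.
  by apply: eq_bigr => i _; rewrite mp.
(* If k came from f, all nonzero entries of the row r would lie in column [f p], making r
   [single]. *)
have fi (i : 'I_a) : nth 0 r i != 0 -> i = f p.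
  rewrite -mp => /cell_onto[j ej]; have := kf j.
  by rewrite !ffunE ej.
have : 0 < size (nz r).
  rewrite lt0n size_eq0 -sumn_eq0 Ep.
  exact: (allP E0 _ (mem_nth 0 (ltn_ord p))).
rewrite /single eqn_leq => ->; rewrite andbT size_filter.
rewrite -sum1_count (big_nth 0) sr big_mkord sum1_card.
rewrite -(card1 (f p)); apply: subset_leq_card.
by apply/subsetP => i; rewrite !inE => /fi ->.
Qed.

End Refine.

(** Each row has at least one nonzero entry and some row has two or more. The growth in the number
    of parts drives the induction on refinement. *)
Lemma size_nz_flatten M : all (predC1 0) (map sumn M) -> ~~ all single M ->
  size M < size (nz (flatten M)).
Proof.
have ge1 r : sumn r != 0 -> 0 < size (nz r) by rewrite sumn_eq0 lt0n size_eq0.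
have ge M' : all (predC1 0) (map sumn M') -> size M' <= size (nz (flatten M')).
  elim: M' => //= r M' IH /andP[/ge1 r1 /IH]; rewrite nz_cat size_cat.
  by move=> h; rewrite -add1n; apply: leq_add.
elim: M => //= r M IH /andP[/ge1 r1 M0]; rewrite nz_cat size_cat negb_and.
case/orP=> [nr|/(IH M0) h]; last by rewrite -addn1 addnC leq_add.
rewrite -addn2 addnC leq_add ?ge //.
by move: nr; rewrite /single; case: (size _) r1 => [|[]].
Qed.

Lemma big_picks_cons e d D (g : seq nat -> nat) :
  \sum_(D' <- picks e (d :: D)) g D' =
  (if e <= d then g (d - e :: D) else 0) + \sum_(D' <- picks e D) g (d :: D').
Proof.
rewrite /= big_cat big_map /=; congr (_ + _).
by case: ifP; rewrite ?big_seq1 ?big_nil.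
Qed.

(** Both parts enter the first block, or exactly one does, or neither does; the room required in
    each case is symmetric in e and f. *)
Lemma big_picks_swap e f D (g : seq nat -> nat) :
  \sum_(D1 <- picks e D) \sum_(D2 <- picks f D1) g D2 =
  \sum_(D1 <- picks f D) \sum_(D2 <- picks e D1) g D2.
Proof.
elim: D g => [|d D IH] g; first by rewrite !big_nil.
have key e' f' : \sum_(D1 <- picks e' (d :: D)) \sum_(D2 <- picks f' D1) g D2 =
    (if e' + f' <= d then g (d - (e' + f') :: D) else 0)
    + ((if e' <= d then \sum_(D2 <- picks f' D) g (d - e' :: D2) else 0)
    + (if f' <= d then \sum_(D1 <- picks e' D) g (d - f' :: D1) else 0)
    + \sum_(D1 <- picks e' D) \sum_(D2 <- picks f' D1) g (d :: D2)).
  rewrite big_picks_cons; under [X in _ + X = _]eq_bigr => D1 _ do rewrite big_picks_cons.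
  rewrite big_split /= !addnA; congr (_ + _ + _).
    rewrite big_picks_cons subnDA; case: (leqP e' d) => ed.
      by rewrite leq_subRL.
    by rewrite leqNgt (leq_trans ed) // leq_addr.
  by case: ifP => _ //; apply: big1.
by rewrite !key [e + f]addnC IH; congr (_ + (_ + _)); apply: addnC.
Qed.

Lemma distrib_catCA D s1 s2 x : distrib D (s1 ++ x :: s2) = distrib D (x :: s1 ++ s2).
Proof.
elim: s1 D => [//|y s1 IH] D /=.
under eq_bigr => D' _ do rewrite IH.
exact: big_picks_swap.
Qed.

Lemma distrib_perm D E E' : perm_eq E E' -> distrib D E = distrib D E'.
Proof.
elim: E E' D => [|e E IH] E' D; first by rewrite perm_sym => /perm_nilP ->.
move=> pE; have eE' : e \in E' by rewrite -(perm_mem pE) mem_head.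
case/splitPr: eE' pE => s1 s2 pE; rewrite distrib_catCA /=.
apply: eq_bigr => D' _; apply: IH.
by rewrite -(perm_cons e) (permPl pE) perm_catC /= perm_cons perm_catC.
Qed.

Definition wcomp_seq a n (D : wcomp a n) : seq nat := [seq (D i : nat) | i <- enum 'I_a].

Lemma size_wcomp_seq a n (D : wcomp a n) : size (wcomp_seq D) = a.
Proof. by rewrite size_map size_enum_ord. Qed.

Lemma nth_wcomp_seq a n (D : wcomp a n) (i : 'I_a) : nth 0 (wcomp_seq D) i = D i.
Proof. by rewrite (nth_map i) ?size_enum_ord // nth_ord_enum. Qed.

Lemma sumn_wcomp_seq a n (D : wcomp a n) : sumn (wcomp_seq D) = n.
Proof. by rewrite sumnE big_map big_enum /=; case: D => D /= /eqP. Qed.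

(** A labelled set partition is the family of fibres of the function sending an index to the label
    of its block. *)
Lemma bracketE a n (lam : intpart n) (D : wcomp a n) :
  bracket lam D = distrib (wcomp_seq D) lam.
Proof.
rewrite distribE size_wcomp_seq /bracket.
pose h (f : {ffun 'I_(size lam) -> 'I_a}) : {ffun 'I_a -> {set 'I_(size lam)}} :=
  [ffun i => [set j | f j == i]].
have h_inj : injective h.
  move=> f g /ffunP fg; apply/ffunP => j; have := fg (f j); rewrite !ffunE.
  by move/setP/(_ j); rewrite !inE eqxx => /esym/eqP.
rewrite -(card_imset _ h_inj); apply: eq_card => Q; rewrite inE.
apply/and3P/imsetP => [[dis cov sums]|[f]].
  have ex j : exists i, j \in Q i.
    have : j \in \bigcup_i Q i by rewrite (eqP cov) inE.
    by case/bigcupP => i _; exists i.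
  have [f hf] := fin_all_exists ex; exists [ffun j => f j]; last first.
    apply/ffunP => i; apply/setP => j; rewrite !ffunE !inE ffunE.
    apply/idP/eqP => [ji|<- //]; apply/eqP; apply: contraT => ne.
    have /forallP/(_ (f j))/forallP/(_ i)/implyP/(_ ne) := dis.
    by rewrite disjoint_subset => /subsetP/(_ j (hf j)); rewrite inE ji.
  rewrite inE; apply/forallP => i; rewrite nth_wcomp_seq.
  have /forallP/(_ i)/eqP <- := sums; apply/eqP.
  apply: eq_bigl => j; rewrite ffunE; apply/eqP/idP => [<- //|ji].
  apply/eqP; apply: contraT => ne.
  have /forallP/(_ (f j))/forallP/(_ i)/implyP/(_ ne) := dis.
  by rewrite disjoint_subset => /subsetP/(_ j (hf j)); rewrite inE ji.
rewrite inE => /forallP hf ->; split.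
- apply/forallP => i; apply/forallP => j; apply/implyP => ij.
  rewrite disjoint_subset; apply/subsetP => k; rewrite !ffunE !inE => /eqP->.
  by [].
- by apply/eqP/setP => j; rewrite inE; apply/bigcupP; exists (f j); rewrite // ffunE inE.
- apply/forallP => i; have := hf i; rewrite nth_wcomp_seq => /eqP <-.
  by apply/eqP/eq_bigl => j; rewrite ffunE inE.
Qed.

Lemma size_le_sumn E : all (predC1 0) E -> size E <= sumn E.
Proof.
elim: E => //= x r IH /andP[x0 /IH h].
by rewrite -add1n leq_add // lt0n.
Qed.

Lemma intpart_exists n E : all (predC1 0) E -> sumn E = n ->
  exists lam : intpart n, perm_eq lam E.
Proof.
move=> E0 sE; pose s := sort geq E.
have pS : perm_eq s E by rewrite perm_sort.
have sS : sumn s = n by rewrite (perm_sumn pS).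
have s0 : all (predC1 0) s by rewrite (perm_all _ pS).
have size_s : size [seq inord x : 'I_n.+1 | x <- s] <= n.
  by rewrite size_map -sS; apply: size_le_sumn.
have sE' : map val [seq inord x : 'I_n.+1 | x <- s] = s.
  rewrite -map_comp -[RHS]map_id; apply/eq_in_map => x xs /=.
  rewrite inordK // ltnS -sS; elim: (s) xs => //= y r IH.
  rewrite inE => /orP[/eqP->|/IH h]; first exact: leq_addr.
  exact: leq_trans h (leq_addl _ _).
have ip : is_intpart n (map val (Bseq size_s)).
  rewrite /= sE' /is_intpart sS eqxx andbT; apply/andP; split.
    by apply: sort_sorted => x y; apply: leq_total.
  by apply/negP => h; have := allP s0 _ h.
by exists (IntPart ip); rewrite /parts /= sE'.
Qed.

Lemma intpartP n (lam : intpart n) : all (predC1 0) lam /\ sumn lam = n.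
Proof.
case: lam => lam hl; rewrite /parts /=; case/and3P: (hl) => _ l0 /eqP sl; split=> //.
by apply/allP => x xl /=; apply: contraNneq l0 => <-.
Qed.

Lemma perm_intpart_eq n (lam mu : intpart n) : perm_eq lam mu -> lam = mu.
Proof.
case: lam mu => [l hl] [m hm] pe; apply/val_inj/val_inj/(inj_map val_inj) => /=.
case/and3P: (hl) => sl _ _; case/and3P: (hm) => sm _ _.
apply: (sorted_eq (leT := geq)) pe => //.
- by move=> i j k ji ik; apply: leq_trans ik ji.
- by move=> i j; rewrite andbC -eqn_leq => /eqP.
Qed.

End Distributions.

(** * Diagonalizability *)

(** The product of the factors X - c, for c in [rs], kills the matrix, so it is divisible by the
    minimal polynomial, which then has distinct roots in F. *)
Lemma diagonalizable_of_roots (F : fieldType) d (A : 'M[F]_d) (rs : seq F) :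
  uniq rs ->
  (forall u : 'rV_d, foldr (fun c v => v *m (A - c%:M)) u rs = 0) ->
  diagonalizable A.
Proof.
case: d A => [|d] A urs h; first by rewrite [A]flatmx0; apply: diagonalizable0.
apply/diagonalizableP; exists rs => //; apply: mxminpoly_min.
apply/row_matrixP => i; rewrite row0 rowE -(h (delta_mx 0 i)).
elim: rs (delta_mx _ _) {urs h} => [|c rs IH] u.
  by rewrite big_nil rmorph1 mulmx1.
rewrite big_cons mulrC rmorphM /= -mulmxE mulmxA IH.
by rewrite rmorphB /= horner_mx_X horner_mx_C.
Qed.

Section Diagonalizable.
Import passmx.
Variables (F : realFieldType) (H : algType F).
Variables (C : hopf_structure H) (G : grading H).
Hypotheses (hG : graded_hopf C G) (hC : connected G).
Variables (a n : nat) (alpha : wcomp a n -> F).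
Hypothesis alpha_ge0 : forall D, 0 <= alpha D.
Notation PD := (convProjs C G).
Notation Psi := (Psi C G alpha).

(** The number beta for an arbitrary list of parts, because the refinements read off matrices are
    not sorted. *)
Definition beta_seq (E : seq nat) : F :=
  \sum_(D : wcomp a n) alpha D * (distrib (wcomp_seq D) E)%:R.

Lemma beta_seq_part (lam : intpart n) : beta_seq lam = beta_part alpha lam.
Proof. by apply: eq_bigr => D _; rewrite bracketE. Qed.

Lemma beta_seq_perm E E' : perm_eq E E' -> beta_seq E = beta_seq E'.
Proof. by move=> h; apply: eq_bigr => D _; rewrite (distrib_perm _ h). Qed.

Lemma PsiE x : Psi x = \sum_D alpha D *: PD (wcomp_seq D) x.
Proof. by apply: eq_bigr => D _; rewrite conv_ProjE. Qed.

(** The term of D grows strictly since alpha is positive there and M is a matrix for D; the other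
    terms do not decrease since alpha is non-negative. *)
Lemma beta_seq_refine_lt D E M : all (predC1 0%N) E -> 0 < alpha D ->
  M \in mats (wcomp_seq D) E -> ~~ all single M ->
  beta_seq E < beta_seq (nz (flatten M)).
Proof.
move=> E0 aD MD nM; rewrite /beta_seq (bigD1 D) //= [ltRHS](bigD1 D) //=.
apply: ltr_leD; first by rewrite ltr_pM2l // ltr_nat (distrib_refine_lt E0 MD nM).
apply: ler_sum => D' _; apply: ler_wpM2l => //; rewrite ler_nat.
by apply: (distrib_refine E0 MD); rewrite !size_wcomp_seq.
Qed.

(* The left-hand side is [Psi] composed with [PD E] minus [beta_seq E *: PD E], *)
(* in the order of composition allowed by (co)commutativity. *)
Lemma sum_mats_triangular E x : all (predC1 0%N) E ->
  \sum_D alpha D *: (\sum_(M <- mats (wcomp_seq D) E) PD (flatten M) x) -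
    beta_seq E *: PD E x =
  \sum_D alpha D *: (\sum_(M <- mats (wcomp_seq D) E | ~~ all single M)
     PD (nz (flatten M)) x).
Proof.
move=> E0; rewrite /beta_seq scaler_suml -sumrB; apply: eq_bigr => D _.
rewrite -scalerA -scalerBr; congr (_ *: _).
rewrite (bigID (fun M => all single M)) /= addrAC.
rewrite -[RHS]add0r; congr (_ + _); last first.
  by apply: eq_bigr => M _; rewrite (convProjs_nz hG hC).
apply/eqP; rewrite subr_eq0 -count_mats_single // natr_sum scaler_suml; apply/eqP.
rewrite big_seq_cond [RHS]big_seq_cond; apply: eq_bigr => M /andP[MD sM].
rewrite scale1r -(convProjs_nz hG hC) all_single_nz //.
by have [_ -> _] := mem_mats MD.
Qed.

(** [Psi_subs rs] is the composite of the commuting maps Psi - c for c in [rs], with repetitions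
    allowed. *)
Definition Psi_sub (c : F) (x : H) : H := Psi x - c *: x.
Definition Psi_subs (rs : seq F) (x : H) : H := foldr Psi_sub x rs.

Lemma Psi_subs_cons c rs x : Psi_subs (c :: rs) x = Psi_sub c (Psi_subs rs x).
Proof. by []. Qed.

Lemma Psi_subs_cat r1 r2 x : Psi_subs (r1 ++ r2) x = Psi_subs r1 (Psi_subs r2 x).
Proof. exact: foldr_cat. Qed.

Lemma Psi_sub_linear c : linear (Psi_sub c).
Proof.
move=> k x y; rewrite /Psi_sub linearP scalerBr scalerDr !scalerA mulrC.
by rewrite opprD addrACA.
Qed.

Lemma Psi_subs_linear rs : linear (Psi_subs rs).
Proof.
elim: rs => // c rs IH k x y.
by rewrite !Psi_subs_cons IH Psi_sub_linear.
Qed.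

Lemma Psi_subC c c' x : Psi_sub c (Psi_sub c' x) = Psi_sub c' (Psi_sub c x).
Proof.
have lin k u v : Psi (u - k *: v) = Psi u - k *: Psi v.
  by rewrite -!scaleNr addrC linearP addrC.
rewrite /Psi_sub !lin !scalerBr !scalerA mulrC !opprB -!addrA; congr (_ + _).
by rewrite addrCA [RHS]addrCA; congr (_ + _); apply: addrC.
Qed.

Lemma Psi_subsC c rs x : Psi_subs rs (Psi_sub c x) = Psi_sub c (Psi_subs rs x).
Proof. by elim: rs => // c' rs IH; rewrite !Psi_subs_cons IH Psi_subC. Qed.

Lemma Psi_subs_mid r1 c r2 x :
  Psi_subs (r1 ++ c :: r2) x = Psi_sub c (Psi_subs (r1 ++ r2) x).
Proof. by rewrite !Psi_subs_cat Psi_subs_cons Psi_subsC. Qed.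

Hypothesis coco : commutative (@GRing.mul H) \/ cocommutative C.

(** Induction on refinement, bounded by E having at most n parts. One factor Psi - beta_E turns the
    convolution along E into convolutions along strict refinements, and the remaining factors
    annihilate these. The factors act after the convolution in the commutative case and before it in
    the cocommutative case. *)
Lemma Psi_subs_convProjs E rs : all (predC1 0%N) E -> sumn E = n ->
  (forall E', all (predC1 0%N) E' -> sumn E' = n -> beta_seq E <= beta_seq E' ->
     beta_seq E' \in rs) ->
  (forall x, commutative (@GRing.mul H) -> Psi_subs rs (PD E x) = 0) /\
  (forall x, cocommutative C -> PD E (Psi_subs rs x) = 0).
Proof.
have [k kE] := ubnP (n - size E)%N; elim: k => // k IH in E kE rs *.
move=> E0 sE hrs; have bE := hrs E E0 sE (lexx _).
case/splitPr: bE hrs => r1 r2 hrs.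
have next D M : M \in mats (wcomp_seq D) E -> ~~ all single M -> 0 < alpha D ->
    (forall x, commutative (@GRing.mul H) ->
       Psi_subs (r1 ++ r2) (PD (nz (flatten M)) x) = 0) /\
    (forall x, cocommutative C -> PD (nz (flatten M)) (Psi_subs (r1 ++ r2) x) = 0).
  move=> MD nM aD; have lt := beta_seq_refine_lt E0 aD MD nM.
  have [_ eE _] := mem_mats MD.
  have nz0 : all (predC1 0%N) (nz (flatten M)) by apply: filter_all.
  have sM : sumn (nz (flatten M)) = n.
    by rewrite sumn_nz sumn_flatten eE.
  apply: IH => //.
    have lt1 : (size E < size (nz (flatten M)))%N.
      by rewrite -[in size E]eE size_map; apply: size_nz_flatten; rewrite ?eE.
    have := size_le_sumn nz0; rewrite sM; lia.
  move=> E' E'0 sE' le; have := hrs E' E'0 sE' (le_trans (ltW lt) le).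
  (* The values needed for the refinement exceed beta_E strictly, so they survive the removal of one
     copy of beta_E. *)
  rewrite !mem_cat inE orbCA (gt_eqF (lt_le_trans lt le)) //.
have main (z : seq nat -> H) :
    (forall D M, M \in mats (wcomp_seq D) E -> ~~ all single M -> 0 < alpha D ->
      z (nz (flatten M)) = 0) ->
    \sum_D alpha D *: (\sum_(M <- mats (wcomp_seq D) E | ~~ all single M)
     z (nz (flatten M))) = 0.
  move=> hz; apply: big1 => D _; have := alpha_ge0 D; rewrite le0r.
  case/orP=> [/eqP->|aD]; first by rewrite scale0r.
  rewrite big_seq_cond big1 ?scaler0 // => M /andP[MD nM].
  exact: hz MD nM aD.
split=> x hH; rewrite Psi_subs_mid.
  rewrite -Psi_subsC /Psi_sub PsiE.
  under eq_bigr => D _ do rewrite (convProjs_comm hG hC hH).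
  rewrite sum_mats_triangular //.
  rewrite -[Psi_subs _]/(to_linear (Psi_subs_linear _) : _ -> _) linear_sum.
  under eq_bigr => D _ do rewrite linearZ linear_sum.
  apply: (main (fun E' => Psi_subs (r1 ++ r2) (PD E' x))) => D M MD nM aD.
  by have [h _] := next D M MD nM aD; apply: h.
rewrite /Psi_sub linearB linearZ /= PsiE linear_sum.
under eq_bigr => D _ do rewrite linearZ /= (convProjs_cocomm hG hC hH).
rewrite sum_mats_triangular //.
apply: (main (fun E' => PD E' (Psi_subs (r1 ++ r2) x))) => D M MD nM aD.
by have [_ h] := next D M MD nM aD; apply: h.
Qed.

Lemma convProjs1 m x : PD [:: m] x = Proj G m x.
Proof.
rewrite convProjs_cons -[in RHS](counitrE C x) sweedler_linear_comp.
by apply: eq_sweedler => u v; rewrite linearZ /= -scalerAr mulr1.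
Qed.

Lemma Psi_hom x : homogeneous G n x -> homogeneous G n (Psi x).
Proof.
move=> hx; rewrite PsiE; apply: hom_sum => D _; apply: homZ.
by rewrite -{1}(sumn_wcomp_seq D); apply: hom_convProjs.
Qed.

Lemma Psi_subs_hom rs x : homogeneous G n x -> homogeneous G n (Psi_subs rs x).
Proof.
move=> hx; elim: rs => // c rs IH; rewrite Psi_subs_cons /Psi_sub -scaleNr addrC.
by apply: homP => //; apply: Psi_hom.
Qed.

Definition beta_parts : seq F :=
  undup [seq beta_part alpha lam | lam <- enum {: intpart n}].

(** The convolution along [[:: n]] is the projection to degree n, hence the identity on H_n, and
    every partition of n refines it. *)
Lemma Psi_subs_eq0 x : (0 < n)%N -> homogeneous G n x -> Psi_subs beta_parts x = 0.
Proof.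
move=> n0 hx.
have := @Psi_subs_convProjs [:: n] beta_parts.
rewrite /= lt0n in n0 *; rewrite n0 addn0 => /(_ isT erefl) [].
  move=> E E0 sE _; have [lam /beta_seq_perm <-] := intpart_exists E0 sE.
  by rewrite mem_undup beta_seq_part map_f // mem_enum.
move=> h1 h2; case: coco => hH.
  by rewrite -(h1 x hH) convProjs1 (Proj_hom n hx) eqxx.
by rewrite -(h2 x hH) convProjs1 (Proj_hom n (Psi_subs_hom _ hx)) eqxx.
Qed.

Lemma Psi_n_diagonalizable (e : (\dim {: G n}).-tuple (G n)) : (0 < n)%N ->
  basis_of {: G n} e -> diagonalizable (passmx.mxof e e (Psi_n C G alpha)).
Proof.
move=> n0 he; apply: (@diagonalizable_of_roots _ _ _ beta_parts).
  exact: undup_uniq.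
move=> u; pose x := grade_in G n (passmx.vecof e u).
have hx : homogeneous G n x by apply: hom_in.
suff h rs : foldr (fun c v => v *m (passmx.mxof e e (Psi_n C G alpha) - c%:M)) u rs
    = passmx.rVof e (grade_pr G n (Psi_subs rs x)).
  rewrite h (Psi_subs_eq0 n0 hx) linear0. exact: linear0.
elim: rs => [|c rs IH]; first by rewrite /= grade_inK passmx.vecofK.
rewrite /= IH -[Psi_sub c _]/(Psi_subs (c :: rs) x) Psi_subs_cons /Psi_sub.
rewrite mulmxBr mul_mx_scalar (linearB (grade_pr G n)) [RHS]linearB /=.
rewrite [grade_pr G n (c *: _)]linearZ [rVof e (c *: _)]linearZ /=.
congr (_ - _); rewrite mul_mxof rVofK // lfunE /=.
by rewrite -!ProjE (Psi_subs_hom _ hx).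
Qed.

End Diagonalizable.

(** * Powers of the augmentation ideal *)

Section TensorAlgebra.
Variables (F : fieldType) (A : algType F).
Implicit Types s t : tensor A A.

Lemma tmul_bilin (x y : A) :
  bilin (fun x' y' => (x * x') \ox (y * y')).
Proof.
by split=> [v|u] c p q /=; rewrite mulrDr -scalerAr;
  rewrite ((tens_bilin _ _).1, (tens_bilin _ _).2).
Qed.

Lemma tmulPr s c t t' : tmul s (c *: t + t') = c *: tmul s t + tmul s t'.
Proof.
rewrite -tlift_fctZ -tlift_fctD; apply: eq_tlift => x y.
by rewrite tliftP //; apply: tmul_bilin.
Qed.

Lemma tmulPl c s s' t : tmul (c *: s + s') t = c *: tmul s t + tmul s' t.
Proof.
apply: tliftP; split=> [y|x] c' p q /=; rewrite -tlift_fctZ -tlift_fctD;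
  apply: eq_tlift => u v.
  by rewrite mulrDl -scalerAl (tens_bilin _ _).1.
by rewrite mulrDl -scalerAl (tens_bilin _ _).2.
Qed.

Lemma tmul_tens (x y x' y' : A) :
  tmul (x \ox y) (x' \ox y') = (x * x') \ox (y * y').
Proof.
rewrite /tmul tlift_tens; last first.
  split=> [v|u] c p q /=; rewrite -tlift_fctZ -tlift_fctD; apply: eq_tlift => u' v'.
    by rewrite mulrDl -scalerAl (tens_bilin _ _).1.
  by rewrite mulrDl -scalerAl (tens_bilin _ _).2.
by rewrite tlift_tens //; apply: tmul_bilin.
Qed.

Lemma tmulDr s t t' : tmul s (t + t') = tmul s t + tmul s t'.
Proof. by have := tmulPr s 1 t t'; rewrite !scale1r. Qed.
Lemma tmulDl s s' t : tmul (s + s') t = tmul s t + tmul s' t.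
Proof. by have := tmulPl 1 s s' t; rewrite !scale1r. Qed.
Lemma tmul0r s : tmul s 0 = 0.
Proof. by apply: (addrI (tmul s 0)); rewrite -tmulDr !addr0. Qed.
Lemma tmul0l t : tmul 0 t = 0.
Proof. by apply: (addrI (tmul 0 t)); rewrite -tmulDl !addr0. Qed.
End TensorAlgebra.

Section Filtration.
Variables (F : fieldType) (H : algType F) (C : hopf_structure H) (G : grading H).
Hypotheses (hG : graded_hopf C G) (hC : connected G).
Notation P := (Proj G).
Notation hom := (homogeneous G).
Notation Delta := (comult C).

(* [augpow n k] is the degree-[n] part of the [k]-th power of the *)
(* augmentation ideal. *)
Inductive augpow : nat -> nat -> H -> Prop :=
| augpow_hom n x : hom n x -> augpow n 0 x
| augpow_mulr i j k x y : (0 < i)%N -> hom i x -> augpow j k y ->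
    augpow (i + j) k.+1 (x * y)
| augpow0 n k : augpow n k 0
| augpowP n k c x y : augpow n k x -> augpow n k y -> augpow n k (c *: x + y).

Lemma hom_augpow n k x : augpow n k x -> hom n x.
Proof.
elim=> {n k x} // [i j k x y _ hx _ hy|n k|n k c x y _ hx _ hy].
- exact: homM hG _ _ _ _ hx hy.
- exact: hom0.
- exact: homP.
Qed.

Lemma augpowZ n k c x : augpow n k x -> augpow n k (c *: x).
Proof. by move=> hx; rewrite -[_ *: _]addr0; apply: augpowP => //; apply: augpow0. Qed.
Lemma augpowD n k x y : augpow n k x -> augpow n k y -> augpow n k (x + y).
Proof. by move=> hx hy; rewrite -[x]scale1r; apply: augpowP. Qed.
Lemma augpowN n k x : augpow n k x -> augpow n k (- x).
Proof. by rewrite -scaleN1r; apply: augpowZ. Qed.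
Lemma augpowB n k x y : augpow n k x -> augpow n k y -> augpow n k (x - y).
Proof. by move=> hx hy; apply: augpowD => //; apply: augpowN. Qed.
Lemma augpow_sum n k (I : Type) (r : seq I) (Q : pred I) (f : I -> H) :
  (forall i, Q i -> augpow n k (f i)) -> augpow n k (\sum_(i <- r | Q i) f i).
Proof. by move=> h; elim/big_ind: _ => //; [apply: augpow0|apply: augpowD]. Qed.

Lemma augpowW n k x : augpow n k.+1 x -> augpow n k x.
Proof.
have [k' ek] : exists k', k' = k.+1 by exists k.+1.
rewrite -ek => hx; elim: hx k ek => {n k' x}.
- by [].
- move=> i j k x y i0 hx hy IH [|k'] [] ek.
    by apply: augpow_hom; apply: (homM hG) hx (hom_augpow hy).
  by apply: augpow_mulr => //; apply: IH.
- by move=> n k k' _; apply: augpow0.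
- by move=> n k c x y _ IHx _ IHy k' ek; apply: augpowP; [apply: IHx|apply: IHy].
Qed.

Lemma augpow_le n k l x : (l <= k)%N -> augpow n k x -> augpow n l x.
Proof.
move/subnK <-; elim: (k - l)%N => // d IH; rewrite addSn => /augpowW.
exact: IH.
Qed.

Lemma augpowM i j k l x y : augpow i k x -> augpow j l y ->
  augpow (i + j) (k + l) (x * y).
Proof.
move=> hx; elim: hx j l y => {i k x}.
- move=> [|i] x hx j l y hy.
    by have [c ->] := hom0P hG hC hx; rewrite -scalerAl mul1r; apply: augpowZ.
  by apply/augpowW/augpow_mulr.
- move=> i j k x y i0 hx _ IH j' l z hz.
  by rewrite -mulrA -addnA addSn; apply: augpow_mulr => //; apply: IH.
- by move=> n k j l y _; rewrite mul0r; apply: augpow0.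
- move=> n k c x y _ IHx _ IHy j l z hz; rewrite mulrDl -scalerAl.
  by apply: augpowP; [apply: IHx|apply: IHy].
Qed.

(** Every factor from the augmentation ideal has degree at least one. In a fixed degree the
    filtration therefore reaches zero, which starts the downward inductions on weight. *)
Lemma augpow_gt n k x : (n < k)%N -> augpow n k x -> x = 0.
Proof.
move=> nk hx; elim: hx nk => {n k x} //.
  move=> i j k x y i0 _ _ IH h; rewrite IH ?mulr0 //; lia.
by move=> n k c x y _ IHx _ IHy nk; rewrite IHx // IHy // scaler0 addr0.
Qed.

Lemma hom_augpow1 n x : (0 < n)%N -> hom n x -> augpow n 1 x.
Proof.
move=> n0 hx; rewrite -[x]mulr1 -[n]addn0; apply: augpow_mulr => //.
by apply: augpow_hom; apply: hom1 hG.
Qed.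

(** The degree-n part of the tensor product filtration: the sum of I^r tensor I^s over r + s at
    least k. *)
Inductive taugpow : nat -> nat -> tensor H H -> Prop :=
| taugpow_tens i j r s k u v : augpow i r u -> augpow j s v -> (k <= r + s)%N ->
    taugpow (i + j) k (u \ox v)
| taugpow0 n k : taugpow n k 0
| taugpowP n k c t t' : taugpow n k t -> taugpow n k t' -> taugpow n k (c *: t + t').

Lemma taugpowZ n k c t : taugpow n k t -> taugpow n k (c *: t).
Proof. by move=> ht; rewrite -[_ *: _]addr0; apply: taugpowP => //; apply: taugpow0. Qed.
Lemma taugpowD n k t t' : taugpow n k t -> taugpow n k t' -> taugpow n k (t + t').
Proof. by move=> ht ht'; rewrite -[t]scale1r; apply: taugpowP. Qed.
Lemma taugpowN n k t : taugpow n k t -> taugpow n k (- t).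
Proof. by rewrite -scaleN1r; apply: taugpowZ. Qed.
Lemma taugpowB n k t t' : taugpow n k t -> taugpow n k t' -> taugpow n k (t - t').
Proof. by move=> ht ht'; apply: taugpowD => //; apply: taugpowN. Qed.
Lemma taugpow_sum n k (I : Type) (r : seq I) (Q : pred I) (f : I -> tensor H H) :
  (forall i, Q i -> taugpow n k (f i)) -> taugpow n k (\sum_(i <- r | Q i) f i).
Proof. by move=> h; elim/big_ind: _ => //; [apply: taugpow0|apply: taugpowD]. Qed.

Lemma taugpowM n m k l s t : taugpow n k s -> taugpow m l t ->
  taugpow (n + m) (k + l) (tmul s t).
Proof.
move=> hs; elim: hs m l t => {n k s}; last 2 first.
- by move=> n k m l t _; rewrite tmul0l; apply: taugpow0.
- move=> n k c s s' _ h _ h' m l t ht; rewrite tmulPl.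
  by apply: taugpowP; [apply: h|apply: h'].
move=> i j r s k u v hu hv krs m l t ht; elim: ht => {m l t}; last 2 first.
- by move=> m l; rewrite tmul0r; apply: taugpow0.
- by move=> m l c t t' _ h _ h'; rewrite tmulPr; apply: taugpowP.
move=> i' j' r' s' l u' v' hu' hv' lrs; rewrite tmul_tens addnACA.
apply: (taugpow_tens (augpowM hu hu') (augpowM hv hv')).
by rewrite addnACA leq_add.
Qed.

(** From s't' - st = s(t' - t) + (s' - s)t': leading terms may be multiplied separately. *)
Lemma tmul_approx n m k l s s' t t' :
  taugpow n k s -> taugpow n k.+1 (s' - s) ->
  taugpow m l t' -> taugpow m l.+1 (t' - t) ->
  taugpow (n + m) (k + l).+1 (tmul s' t' - tmul s t).
Proof.
move=> hs hs' ht' ht.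
have -> : tmul s' t' - tmul s t = tmul s (t' - t) + tmul (s' - s) t'.
  apply/eqP; rewrite subr_eq addrAC -tmulDr subrK -tmulDl addrC.
  by rewrite subrK.
by apply: taugpowD; [rewrite -addnS|rewrite -addSn]; apply: taugpowM.
Qed.

Lemma comultE n x : hom n x -> Delta x =
  \sum_(i < n.+1) sweedler C (fun u v => P i u \ox P (n - i) v) x.
Proof.
move=> hx; rewrite -(sweedler_hom hG _ hx); last exact: tens_bilin.
by rewrite /sweedler tlift_tens_id.
Qed.

Lemma taugpow_sweedler n k i j x : (i + j = n)%N -> (k <= (0 < i) + (0 < j))%N ->
  taugpow n k (sweedler C (fun u v => P i u \ox P j v) x).
Proof.
move=> <- hk; apply: taugpow_sum => p _.
have h d u : augpow d (0 < d) (P d u).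
  by case: d => [|d]; [apply: augpow_hom|apply: hom_augpow1]; rewrite //; apply: hom_Proj.
exact: taugpow_tens (h i _) (h j _) hk.
Qed.

(** In each bihomogeneous component of the coproduct of a positive-degree element, one tensor factor
    has positive degree and so lies in I; multiplicativity carries this to products. *)
Lemma comult_augpow n k x : augpow n k x -> taugpow n k (Delta x).
Proof.
elim=> {n k x}.
- move=> n x hx; rewrite (comultE hx); apply: taugpow_sum => i _.
  by apply: taugpow_sweedler => //; rewrite subnKC // -ltnS.
- move=> i j k x y i0 hx _ IH; rewrite comultM -add1n; apply: taugpowM => //.
  rewrite (comultE hx); apply: taugpow_sum => i' _.
  have ii := ltn_ord i'; apply: taugpow_sweedler; first by rewrite subnKC.
  lia.
- by move=> n k; rewrite linear0; apply: taugpow0.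
- by move=> n k c x y _ h _ h'; rewrite linearP; apply: taugpowP.
Qed.

Lemma augpow_sweedler n k (f : H -> H -> H) t : bilin f -> taugpow n k t ->
  (forall i j r s u v, augpow i r u -> augpow j s v -> (i + j = n)%N ->
     (k <= r + s)%N -> augpow n k (f u v)) ->
  augpow n k (tlift f t).
Proof.
move=> hf ht; elim: ht => {n k t}.
- by move=> i j r s k u v hu hv krs h; rewrite tlift_tens //; apply: h hu hv _ krs.
- by move=> n k _; rewrite tlift0 //; apply: augpow0.
- by move=> n k c t t' _ h _ h' hh; rewrite tliftP //; apply: augpowP; [apply: h|apply: h'].
Qed.

Lemma Proj_augpow d n k x : augpow n k x -> augpow n k (P d x).
Proof.
move=> hx; rewrite (Proj_hom d (hom_augpow hx)).
by case: eqP => // _; apply: augpow0.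
Qed.

Lemma convProjs_augpow D n k x : augpow n k x -> augpow n k (convProjs C G D x).
Proof.
elim: D n k x => [|d D IH] n k x hx.
  rewrite convProjs_nil -(Proj0E hG hC); exact: Proj_augpow.
rewrite convProjs_cons; apply: augpow_sweedler (comult_augpow hx) _.
  exact: conv_linr.
move=> i j r s u v hu hv <- krs; apply: (augpow_le krs); apply: augpowM.
  exact: Proj_augpow.
exact: IH.
Qed.

(* Primitive in the associated graded Hopf algebra of the powers of the *)
(* augmentation ideal. *)
Definition prim (n k : nat) (x : H) : Prop :=
  [/\ (0 < n)%N, augpow n k x & taugpow n k.+1 (Delta x - (x \ox 1 + 1 \ox x))].

Lemma augpow1 : augpow 0 0 1.
Proof. by apply: augpow_hom; apply: hom1 hG. Qed.

Lemma tensPl c x y z : (c *: x + y) \ox z = c *: (x \ox z) + y \ox z :> tensor H H.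
Proof. exact: (tens_bilin _ _).1. Qed.
Lemma tensPr c x y z : z \ox (c *: x + y) = c *: (z \ox x) + z \ox y :> tensor H H.
Proof. exact: (tens_bilin _ _).2. Qed.

Definition tprim (x : H) : tensor H H := x \ox 1 + 1 \ox x.

Lemma tprim_linear : linear tprim.
Proof. by move=> c x y; rewrite /tprim tensPl tensPr scalerDr addrACA. Qed.

Lemma taugpow_tprim n k x : augpow n k x -> taugpow n k (tprim x).
Proof.
move=> hx; apply: taugpowD.
  by rewrite -[n]addn0; apply: taugpow_tens hx augpow1 _; rewrite addn0.
by rewrite -[n]add0n; apply: taugpow_tens augpow1 hx _.
Qed.

Lemma primP n k c x y : prim n k x -> prim n k y -> prim n k (c *: x + y).
Proof.
move=> [n0 hx dx] [_ hy dy]; split=> //; first exact: augpowP.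
rewrite linearP -!/(tprim _) tprim_linear opprD addrACA -scalerBr.
exact: taugpowP.
Qed.

Lemma augpow_prim n k x : (0 < n)%N -> augpow n k.+1 x -> prim n k x.
Proof.
move=> n0 hx; split=> //; first exact: augpowW.
apply: taugpowB; first exact: comult_augpow.
exact: taugpow_tprim.
Qed.

Lemma prim0 n k : (0 < n)%N -> prim n k 0.
Proof. by move=> n0; apply: augpow_prim => //; apply: augpow0. Qed.

(** The terms of the coproduct other than those of [tprim] have both factors of positive degree, so
    they have weight at least 2. *)
Lemma hom_prim n x : (0 < n)%N -> hom n x -> prim n 1 x.
Proof.
case: n => // n _ hx; split=> //; first exact: hom_augpow1.
rewrite (comultE hx) big_ord_recl big_ord_recr /= subn0 subnn.
have eqr : sweedler C (fun u v => P 0 u \ox P n.+1 v) x = 1 \ox x.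
  have hl : linear (fun v => 1 \ox P n.+1 v : tensor H H).
    by move=> c y z; rewrite linearP tensPr.
  rewrite -[in RHS]hx -[RHS]/(to_linear hl x) -[in RHS](counitlE C x).
  rewrite sweedler_linear_comp; apply: eq_sweedler => u v /=.
  rewrite (Proj0E hG hC) linearZ /=.
  by rewrite (bilinZl _ _ _ (tens_bilin _ _)) (bilinZr _ _ _ (tens_bilin _ _)).
have eql : sweedler C (fun u v => P n.+1 u \ox P 0 v) x = x \ox 1.
  have hl : linear (fun v => P n.+1 v \ox 1 : tensor H H).
    by move=> c y z; rewrite linearP tensPl.
  rewrite -[in RHS]hx -[RHS]/(to_linear hl x) -[in RHS](counitrE C x).
  rewrite sweedler_linear_comp; apply: eq_sweedler => u v /=.
  rewrite (Proj0E hG hC) linearZ /=.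
  by rewrite (bilinZl _ _ _ (tens_bilin _ _)) (bilinZr _ _ _ (tens_bilin _ _)).
rewrite eqr eql [x \ox 1 + _]addrC opprD addrACA subrr add0r addrK.
apply: taugpow_sum => i _; have ii := ltn_ord i.
apply: taugpow_sweedler; rewrite /bump /=; lia.
Qed.

Lemma tmul_tprim x y :
  tmul (tprim x) (tprim y) = tprim (x * y) + (x \ox y + y \ox x).
Proof.
rewrite /tprim tmulDl !tmulDr !tmul_tens !mulr1 !mul1r -!addrA; congr (_ + _).
by rewrite addrA addrC.
Qed.

(** The cross terms of the two products are the same tensor, the sum of x tensor y and y tensor x,
    so they cancel in the commutator. *)
Lemma prim_comm i j k l x y : prim i k x -> prim j l y ->
  prim (i + j) (k + l) (x * y - y * x).
Proof.
move=> [i0 hx dx] [j0 hy dy]; split; first by rewrite ltn_addl.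
  apply: augpowB; first exact: augpowM.
  by rewrite addnC [(k + l)%N]addnC; apply: augpowM.
have m1 := tmul_approx (taugpow_tprim hx) dx (comult_augpow hy) dy.
have m2 := tmul_approx (taugpow_tprim hy) dy (comult_augpow hx) dx.
rewrite addnC [(l + k)%N]addnC in m2.
have := taugpowB m1 m2; congr (taugpow _ _ _).
rewrite [in RHS]linearB !comultM -/(tprim (x * y - y * x)) !tmul_tprim.
rewrite -[tprim (_ - _)]/(to_linear tprim_linear _) [in RHS]linearB /=.
rewrite [y \ox x + _]addrC.
have gen (V : zmodType) (X Y p q c : V) : X - (p + c) - (Y - (q + c)) = X - Y - (p - q).
  rewrite [- (Y - _)]opprD opprK addrACA; congr (_ + _).
  by rewrite opprD addrACA addNr addr0 [RHS]opprD opprK.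
exact: gen.
Qed.

End Filtration.

(** * Words in lifted primitives *)

Section WordSplits.
Variable T : eqType.

(** All ways to send each letter left or right with the order kept: the terms of the coproduct of a
    product of primitives. *)
Fixpoint wsplits (w : seq T) : seq (seq T * seq T) :=
  if w is t :: w' then
    [seq (t :: p.1, p.2) | p <- wsplits w'] ++ [seq (p.1, t :: p.2) | p <- wsplits w']
  else [:: ([::], [::])].

Lemma perm_wsplits w p : p \in wsplits w -> perm_eq (p.1 ++ p.2) w.
Proof.
elim: w p => [|t w IH] p /=; first by rewrite inE => /eqP->.
rewrite mem_cat => /orP[] /mapP[q /IH h ->] /=; first by rewrite perm_cons.
by rewrite perm_catC /= perm_cons perm_catC.
Qed.

Lemma big_wsplits_cons (V : Type) (idx : V) (op : Monoid.law idx) t w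
    (Q : pred (seq T * seq T)) (f : seq T * seq T -> V) :
  \big[op/idx]_(p <- wsplits (t :: w) | Q p) f p =
  op (\big[op/idx]_(p <- wsplits w | Q (t :: p.1, p.2)) f (t :: p.1, p.2))
     (\big[op/idx]_(p <- wsplits w | Q (p.1, t :: p.2)) f (p.1, t :: p.2)).
Proof. by rewrite /= big_cat !big_map. Qed.

(** The left subword collects the letters that go into the first block. *)
Lemma distrib_wsplits (dg : T -> nat) d D w :
  distrib (d :: D) (map dg w) =
  (\sum_(p <- wsplits w | sumn (map dg p.1) == d) distrib D (map dg p.2))%N.
Proof.
elim: w d D => [|t w IH] d D.
  by rewrite /= big_mkcond big_seq1 /= eq_sym; case: eqP.
rewrite big_wsplits_cons [LHS]/= big_picks_cons; congr (_ + _)%N.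
  case: leqP => ed.
    rewrite IH; apply: eq_bigl => p /=; lia.
  by rewrite big1 // => p /=; lia.
under eq_bigr => D' _ do rewrite IH.
by rewrite exchange_big.
Qed.

End WordSplits.

Section Letters.
Variables (F : fieldType) (H : algType F) (C : hopf_structure H) (G : grading H).
Hypotheses (hG : graded_hopf C G) (hC : connected G).
Notation P := (Proj G).
Notation Delta := (comult C).
Notation augpow := (augpow G).
Notation taugpow := (taugpow G).
Notation prim := (prim C G).

(** Letters lifting primitives of the associated graded algebra, with their degrees and weights.
    They have to span only up to degree N, so that a finite alphabet suffices. *)
Variables (N : nat) (T : finType) (y : T -> H) (dg wt : T -> nat).
Hypothesis y_prim : forall t, prim (dg t) (wt t) (y t).
Hypothesis y_span : forall i k x, (i <= N)%N -> prim i k x -> exists c : T -> F,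
  augpow i k.+1 (x - \sum_(t | (dg t == i) && (wt t == k)) c t *: y t).

Definition wval (w : seq T) : H := \prod_(t <- w) y t.
Definition wdeg (w : seq T) : nat := sumn (map dg w).
Definition wwt (w : seq T) : nat := sumn (map wt w).

Lemma wval_cat w w' : wval (w ++ w') = wval w * wval w'.
Proof. exact: big_cat. Qed.
Lemma wval_cons t w : wval (t :: w) = y t * wval w.
Proof. exact: big_cons. Qed.
Lemma wdeg_cat w w' : wdeg (w ++ w') = (wdeg w + wdeg w')%N.
Proof. by rewrite /wdeg map_cat sumn_cat. Qed.
Lemma wwt_cat w w' : wwt (w ++ w') = (wwt w + wwt w')%N.
Proof. by rewrite /wwt map_cat sumn_cat. Qed.
Lemma wdeg_perm w w' : perm_eq w w' -> wdeg w = wdeg w'.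
Proof. by move=> h; apply: perm_sumn; apply: perm_map. Qed.
Lemma wwt_perm w w' : perm_eq w w' -> wwt w = wwt w'.
Proof. by move=> h; apply: perm_sumn; apply: perm_map. Qed.

Lemma dg_gt0 t : (0 < dg t)%N. Proof. by have [] := y_prim t. Qed.

Lemma y_augpow t : augpow (dg t) (wt t) (y t). Proof. by have [] := y_prim t. Qed.

Lemma wval_augpow w : augpow (wdeg w) (wwt w) (wval w).
Proof.
elim: w => [|t w IH]; first by rewrite /wval big_nil; apply: augpow1 hG.
by rewrite wval_cons; apply: (augpowM hG hC) => //; apply: y_augpow.
Qed.

Lemma size_wdeg w : (size w <= wdeg w)%N.
Proof.
elim: w => //= t w IH; rewrite /wdeg /= -add1n.
by apply: leq_add => //; apply: dg_gt0.
Qed.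

(* Modulo the next power of the augmentation ideal, the span of words with *)
(* less than [l] letters. *)
Inductive lfil (m k l : nat) : H -> Prop :=
| lfil_word w : wdeg w = m -> wwt w = k -> (size w < l)%N -> lfil m k l (wval w)
| lfil_high x : augpow m k.+1 x -> lfil m k l x
| lfilP c x x' : lfil m k l x -> lfil m k l x' -> lfil m k l (c *: x + x').

Lemma lfil0 m k l : lfil m k l 0. Proof. by apply: lfil_high; apply: augpow0. Qed.
Lemma lfilZ m k l c x : lfil m k l x -> lfil m k l (c *: x).
Proof. by move=> h; rewrite -[_ *: _]addr0; apply: lfilP => //; apply: lfil0. Qed.
Lemma lfilD m k l x x' : lfil m k l x -> lfil m k l x' -> lfil m k l (x + x').
Proof. by move=> h h'; rewrite -[x]scale1r; apply: lfilP. Qed.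
Lemma lfil_sum m k l (I : Type) (r : seq I) (Q : pred I) (f : I -> H) :
  (forall i, Q i -> lfil m k l (f i)) -> lfil m k l (\sum_(i <- r | Q i) f i).
Proof. by move=> h; elim/big_ind: _ => //; [apply: lfil0|apply: lfilD]. Qed.

Lemma lfilW m k l l' x : (l <= l')%N -> lfil m k l x -> lfil m k l' x.
Proof.
move=> ll; elim=> {x}.
- by move=> w e1 e2 sw; apply: lfil_word => //; apply: leq_trans ll.
- by move=> x h; apply: lfil_high.
- by move=> c x x' _ h _ h'; apply: lfilP.
Qed.

Lemma lfil_eq m k l m' k' l' x : m = m' -> k = k' -> l = l' ->
  lfil m k l x -> lfil m' k' l' x.
Proof. by move=> -> -> ->. Qed.

Lemma lfil_augpow m k l x : lfil m k l x -> augpow m k x.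
Proof.
elim=> {x}.
- by move=> w <- <- _; apply: wval_augpow.
- by move=> x; apply: (augpowW hG).
- by move=> c x x' _ h _ h'; apply: augpowP.
Qed.

(** The bounds on the number of letters are strict: fewer than l and fewer than l' letters make
    fewer than l + l' - 1 together. *)
Lemma lfilM m k l m' k' l' x x' : lfil m k l x -> lfil m' k' l' x' ->
  lfil (m + m') (k + k') (l + l').-1 (x * x').
Proof.
move=> hx; elim: hx x' => {x}.
- move=> w dw ww sw x' hx'; elim: hx' => {x'}.
  + move=> w' dw' ww' sw'; rewrite -wval_cat; apply: lfil_word.
    * by rewrite wdeg_cat dw dw'.
    * by rewrite wwt_cat ww ww'.
    * rewrite size_cat; lia.
  + move=> x' hx'; apply: lfil_high; rewrite -addnS; apply: (augpowM hG hC) => //.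
    by rewrite -dw -ww; apply: wval_augpow.
  + by move=> c x1 x2 _ h1 _ h2; rewrite mulrDr -scalerAr; apply: lfilP.
- move=> x hx x' /lfil_augpow hx'; apply: lfil_high; rewrite -addSn.
  exact: (augpowM hG hC).
- move=> c x1 x2 _ h1 _ h2 x' hx'; rewrite mulrDl -scalerAl.
  by apply: lfilP; [apply: h1|apply: h2].
Qed.

Lemma lfil_wordM w m k l x : lfil m k l x ->
  lfil (wdeg w + m) (wwt w + k) (size w + l) (wval w * x).
Proof.
move=> hx; have := @lfilM (wdeg w) (wwt w) (size w).+1 m k l (wval w) x.
by rewrite addSn /=; apply => //; apply: lfil_word.
Qed.

Lemma lfilM_word w m k l x : lfil m k l x ->
  lfil (m + wdeg w) (k + wwt w) (l + size w) (x * wval w).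
Proof.
move=> hx; have := @lfilM m k l (wdeg w) (wwt w) (size w).+1 x (wval w).
by rewrite addnS /=; apply => //; apply: lfil_word.
Qed.

Lemma prim_lfil i k x : (i <= N)%N -> prim i k x -> lfil i k 2 x.
Proof.
move=> iN /(y_span iN)[c hc].
rewrite -[x](subrK (\sum_(t | (dg t == i) && (wt t == k)) c t *: y t)).
apply: lfilD; first exact: lfil_high.
apply: lfil_sum => t /andP[/eqP dt /eqP wtt]; apply: lfilZ.
have -> : y t = wval [:: t] by rewrite /wval big_seq1.
by apply: lfil_word; rewrite // /wdeg /wwt /= addn0.
Qed.

(** Straightening: each exchange of t with a letter u leaves a commutator, which is primitive and so
    is a combination of single letters up to higher weight. One letter is lost. *)
Lemma lfil_catCA s1 s2 t : (wdeg (t :: s1 ++ s2) <= N)%N ->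
  lfil (wdeg (t :: s1 ++ s2)) (wwt (t :: s1 ++ s2)) (size (t :: s1 ++ s2))
    (wval (s1 ++ t :: s2) - wval (t :: s1 ++ s2)).
Proof.
elim: s1 => [|u s1 IH] dN; first by rewrite subrr; apply: lfil0.
have -> : wval ((u :: s1) ++ t :: s2) - wval (t :: (u :: s1) ++ s2) =
    wval [:: u] * (wval (s1 ++ t :: s2) - wval (t :: s1 ++ s2)) +
    (y u * y t - y t * y u) * wval (s1 ++ s2).
  rewrite /wval big_seq1 -!/(wval _) /= !wval_cons mulrBr mulrBl !mulrA.
  by rewrite addrA subrK.
apply: lfilD.
  rewrite /= in dN.
  have := @lfil_wordM [:: u] _ _ _ _ (IH _).
  rewrite /wdeg /wwt /= !addn0 addnCA [(wt u + _)%N]addnCA => h; apply: h.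
  by move: dN; rewrite /wdeg /= ; lia.
have hc : lfil (dg u + dg t) (wt u + wt t) 2 (y u * y t - y t * y u).
  apply: prim_lfil; last exact: (prim_comm hG hC).
  by move: dN; rewrite /wdeg /=; lia.
have := lfilM_word (s1 ++ s2) hc; rewrite /wdeg /wwt.
by apply: lfil_eq => /=; lia.
Qed.

Lemma lfil_perm w w' : perm_eq w w' -> (wdeg w <= N)%N ->
  lfil (wdeg w) (wwt w) (size w) (wval w - wval w').
Proof.
elim: w w' => [|t w IH] w' ww' dN.
  by move: ww'; rewrite perm_sym => /perm_nilP ->; rewrite subrr; apply: lfil0.
have tw' : t \in w' by rewrite -(perm_mem ww') mem_head.
case/splitPr: tw' ww' => s1 s2 ww'.
have pw : perm_eq w (s1 ++ s2).
  by rewrite -(perm_cons t) (permPl ww') perm_catC /= perm_cons perm_catC.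
have pw' : perm_eq (t :: w) (t :: s1 ++ s2) by rewrite perm_cons.
rewrite -(subrK (wval (t :: s1 ++ s2)) (wval (t :: w))) -addrA.
apply: lfilD; last first.
  rewrite -opprB -scaleN1r; apply: lfilZ.
  rewrite (wdeg_perm pw') (wwt_perm pw') (perm_size pw'); apply: lfil_catCA.
  by rewrite -(wdeg_perm pw').
rewrite !wval_cons -mulrBr.
have := @lfil_wordM [:: t] _ _ _ _ (IH _ pw _).
rewrite /wval big_seq1 /wdeg /wwt /= !addn0 add1n; apply.
by move: dN; rewrite /wdeg /=; lia.
Qed.

(** Multiplying the coproducts x tensor 1 + 1 tensor x of the letters and expanding places every
    letter on the left or on the right; the errors have higher weight. *)
Lemma big_wsplits_comult w : taugpow (wdeg w) (wwt w).+1
  (Delta (wval w) - \sum_(p <- wsplits w) wval p.1 \ox wval p.2).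
Proof.
elim: w => [|t w IH].
  by rewrite big_seq1 /wval big_nil comult1 subrr; apply: taugpow0.
rewrite wval_cons comultM big_wsplits_cons /=.
set S := \sum_(p <- wsplits w) _ in IH.
have -> : \sum_(p <- wsplits w) wval (t :: p.1) \ox wval p.2 +
    \sum_(p <- wsplits w) wval p.1 \ox wval (t :: p.2) = tmul (tprim (y t)) S.
  rewrite /S; elim: (wsplits w) => [|p r IHr]; first by rewrite !big_nil tmul0r addr0.
  rewrite !big_cons tmulDr -IHr addrACA; congr (_ + _).
  by rewrite /tprim tmulDl !tmul_tens !mul1r !wval_cons.
have [_ hy dy] := y_prim t.
apply: (tmul_approx hG hC) dy _ IH; first exact: taugpow_tprim hG _ _ _ hy.
by apply: (comult_augpow hG hC); apply: wval_augpow.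
Qed.

(** Projecting the left factor to degree d keeps the splittings whose left subword has degree d, and
    induction on D treats the right subword. Sorting the two subwords back into w costs only terms
    with fewer letters or higher weight. *)
Lemma convProjs_word D w : (wdeg w <= N)%N ->
  lfil (wdeg w) (wwt w) (size w)
    (convProjs C G D (wval w) - (distrib D (map dg w))%:R *: wval w).
Proof.
elim: D w => [|d D IH] w dN.
  rewrite convProjs_nil.
  case: w dN => [|t w] dN.
    by rewrite /wval big_nil counit1 subrr; apply: lfil0.
  have := hom_augpow hG (wval_augpow (t :: w)) => /(counit_hom hG) ->.
    by rewrite scale0r /= big_nil scale0r subrr; apply: lfil0.
  by rewrite -lt0n; apply: (leq_trans _ (size_wdeg _)).
rewrite convProjs_cons.
set S := \sum_(p <- wsplits w) wval p.1 \ox wval p.2.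
have hb := conv_linr (Proj G d) (convProjs C G D).
have -> : sweedler C (fun u v => Proj G d u * convProjs C G D v) (wval w) =
    tlift (fun u v => Proj G d u * convProjs C G D v) (Delta (wval w) - S) +
    \sum_(p <- wsplits w) P d (wval p.1) * convProjs C G D (wval p.2).
  rewrite (tliftB hb) /sweedler [tlift _ S]tlift_sum //.
  under eq_bigr => p _ do rewrite tlift_tens //.
  by rewrite subrK.
rewrite -addrA; apply: lfilD.
  apply: lfil_high; apply: augpow_sweedler (big_wsplits_comult w) _ => //.
  move=> i j r s u v hu hv <- rs; apply: (augpow_le hG rs).
  apply: (augpowM hG hC); first exact: (Proj_augpow hG).
  exact: convProjs_augpow.
rewrite distrib_wsplits natr_sum scaler_suml [X in _ - X]big_mkcond -sumrB.
rewrite big_seq; apply: lfil_sum => p /perm_wsplits pw.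
have := hom_augpow hG (wval_augpow p.1) => /Proj_hom ->.
rewrite eq_sym -/(wdeg p.1); case: eqP => _; last by rewrite mul0r subr0; apply: lfil0.
rewrite -(wdeg_perm pw) -(wwt_perm pw) -(perm_size pw) wdeg_cat wwt_cat size_cat.
set c := (_)%:R.
have -> : wval p.1 * convProjs C G D (wval p.2) - c *: wval w =
  wval p.1 * (convProjs C G D (wval p.2) - c *: wval p.2) +
  c *: (wval (p.1 ++ p.2) - wval w).
  by rewrite wval_cat mulrBr scalerBr -scalerAr addrA subrK.
have dp : (wdeg p.1 + wdeg p.2 <= N)%N by rewrite -wdeg_cat (wdeg_perm pw).
apply: lfilD.
  by apply: lfil_wordM; apply: IH; apply: leq_trans dp; apply: leq_addl.
apply: lfilZ; rewrite -size_cat -wdeg_cat -wwt_cat; apply: lfil_perm => //.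
by rewrite wdeg_cat.
Qed.

(** * Spanning by sorted words *)

Section SortedWords.
Variable leT : rel T.
Hypotheses (leT_total : total leT) (leT_tr : transitive leT) (leT_anti : antisymmetric leT).
Variable words : nat -> seq (seq T).
Hypothesis mem_words : forall m w, (m <= N)%N ->
  (w \in words m) = sorted leT w && (wdeg w == m).
Hypothesis words_uniq : forall m, uniq (words m).

Definition lspan (Q : pred (seq T)) (m : nat) (x : H) : Prop :=
  exists c : seq T -> F, x = \sum_(w <- words m | Q w) c w *: wval w.

Lemma lspanP Q m c x x' : lspan Q m x -> lspan Q m x' -> lspan Q m (c *: x + x').
Proof.
move=> [f ->] [g ->]; exists (fun w => c * f w + g w).
rewrite scaler_sumr -big_split; apply: eq_bigr => w _ /=.
by rewrite scalerDl scalerA.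
Qed.

Lemma lspan0 Q m : lspan Q m 0.
Proof. by exists (fun=> 0); rewrite big1 // => w _; rewrite scale0r. Qed.

Lemma lspanD Q m x x' : lspan Q m x -> lspan Q m x' -> lspan Q m (x + x').
Proof. by move=> h h'; rewrite -[x]scale1r; apply: lspanP. Qed.

Lemma lspanW (Q Q' : pred (seq T)) m x : (forall w, Q w -> Q' w) ->
  lspan Q m x -> lspan Q' m x.
Proof.
move=> QQ [c ->]; exists (fun w => if Q w then c w else 0).
rewrite big_mkcond [RHS]big_mkcond; apply: eq_bigr => w _.
by case q: (Q w); rewrite ?(QQ _ q) // scale0r if_same.
Qed.

Lemma lspan_word (Q : pred (seq T)) m w : w \in words m -> Q w -> lspan Q m (wval w).
Proof.
move=> wm qw; exists (fun w' => (w' == w)%:R).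
rewrite big_mkcond (bigD1_seq w) //= qw eqxx scale1r big1 ?addr0 // => w' /negPf ->.
by rewrite scale0r if_same.
Qed.

(** The words below one of weight k with l letters, in the order for which Psi is triangular: larger
    weight counts as lower. *)
Definition wlow (k l : nat) : pred (seq T) :=
  fun w => (k < wwt w)%N || (wwt w == k) && (size w < l)%N.

(** Sorting a word changes it by words with fewer letters and by higher weight, whence the induction
    on l. *)
Lemma lspan_lfil m k : (m <= N)%N ->
  (forall x, augpow m k.+1 x -> lspan (fun w => k < wwt w)%N m x) ->
  forall l x, lfil m k l x -> lspan (wlow k l) m x.
Proof.
move=> mN hk; elim=> [|l IH] x; elim=> {x} //.
- move=> x /hk; apply: lspanW => w; rewrite /wlow => -> //.
- by move=> c x x' _ h _ h'; apply: lspanP.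
- move=> w dw ww sw; have ps : perm_eq w (sort leT w) by rewrite perm_sym perm_sort.
  rewrite -(subrK (wval (sort leT w)) (wval w)); apply: lspanD.
    have sw' : (size w <= l)%N by rewrite -ltnS.
    have := lfil_perm ps; rewrite dw ww => /(_ mN) /(lfilW sw') /IH.
    by apply: lspanW => w'; rewrite /wlow => /orP[->//|/andP[-> /= s]];
      rewrite ltnS (ltnW s) orbT.
  apply: lspan_word; first by rewrite mem_words // sort_sorted // -(wdeg_perm ps) dw /=.
  by rewrite /wlow -(wwt_perm ps) ww eqxx -(perm_size ps) sw orbT.
- move=> x /hk; apply: lspanW => w; rewrite /wlow => -> //.
- by move=> c x x' _ h _ h'; apply: lspanP.
Qed.

(** Each of the k factors of positive degree is one letter of weight 1 modulo I^2, so at most k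
    letters are used. *)
Lemma augpow_lfil m k x : (m <= N)%N -> augpow m k x -> lfil m k k.+1 x.
Proof.
move=> mN hx; elim: hx mN => {m k x}.
- move=> [|m] x hx mN.
    have [c ->] := hom0P hG hC hx; apply: lfilZ.
    have -> : 1 = wval [::] by rewrite /wval big_nil.
    exact: lfil_word.
  by apply: lfil_high; apply: (hom_augpow1 hG).
- move=> i j k x z i0 hx hz IH ijN.
  rewrite -[k.+1]add1n; have := @lfilM i 1 2 j k k.+1 x z; apply.
    apply: prim_lfil; first by lia.
    exact: hom_prim.
  by apply: IH; lia.
- by move=> m k _; apply: lfil0.
- by move=> m k c x x' _ h _ h' mN; apply: lfilP; [apply: h|apply: h'].
Qed.

(** Downward induction on the weight k, starting above m, where the filtration is zero. *)
Lemma augpow_lspan m k x : (m <= N)%N -> augpow m k x ->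
  lspan (fun w => k <= wwt w)%N m x.
Proof.
move=> mN; have [d dE] := ubnP (m.+1 - k)%N; elim: d => // d IH in k dE x *.
move=> hx; case: (ltnP m k) => mk.
  by rewrite (augpow_gt mk hx); apply: lspan0.
have := lspan_lfil mN _ (augpow_lfil mN hx).
have h z : augpow m k.+1 z -> lspan (fun w => k < wwt w)%N m z by apply: IH; lia.
move=> /(_ h); apply: lspanW => w /orP[/ltnW //|/andP[/eqP-> //]].
Qed.

Lemma lfil_lspan m k l x : (m <= N)%N -> lfil m k l x -> lspan (wlow k l) m x.
Proof. by move=> mN; apply: lspan_lfil => // z; apply: augpow_lspan. Qed.

End SortedWords.

End Letters.

(** * The ordered monomials form a basis *)

Section Words.
Variables (T : finType) (dg : T -> nat).
Hypothesis dg_gt0 : forall t, (0 < dg t)%N.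

Definition rank_le : rel T := fun t u => (enum_rank t <= enum_rank u)%N.

Lemma rank_le_total : total rank_le.
Proof. by move=> t u; apply: leq_total. Qed.
Lemma rank_le_trans : transitive rank_le.
Proof. by move=> t u v; apply: leq_trans. Qed.
Lemma rank_le_anti : antisymmetric rank_le.
Proof. by move=> t u; rewrite -eqn_leq => /eqP /val_inj /enum_rank_inj. Qed.

Definition word_of (M : T -> nat) : seq T :=
  sort rank_le (flatten [seq nseq (M t) t | t <- enum T]).

Lemma count_word_of M t : count_mem t (word_of M) = M t.
Proof.
rewrite (permP (_ : perm_eq _ (flatten [seq nseq (M t) t | t <- enum T]))) ?perm_sort //.
rewrite count_flatten -map_comp sumnE big_map big_enum /= (bigD1 t) //=.
rewrite count_nseq /= eqxx mul1n big1 ?addn0 // => u /negPf ut.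
by rewrite count_nseq /= ut mul0n.
Qed.

Lemma sorted_word_of M : sorted rank_le (word_of M).
Proof. exact: sort_sorted rank_le_total _. Qed.

Lemma eq_sorted_words w w' : sorted rank_le w -> sorted rank_le w' ->
  perm_eq w w' -> w = w'.
Proof. exact: (sorted_eq rank_le_trans rank_le_anti). Qed.

Lemma wdeg_count w : wdeg dg w = (\sum_t count_mem t w * dg t)%N.
Proof.
elim: w => [|u w IH]; first by rewrite big1.
rewrite /wdeg /= -/(wdeg dg w) IH.
under [RHS]eq_bigr => t _ do rewrite mulnDl.
rewrite big_split /=; congr (_ + _)%N; rewrite (bigD1 u) //= eqxx mul1n big1 ?addn0 // => t ut.
by rewrite eq_sym (negPf ut).
Qed.

(** Letters have positive degree, so multiplicities up to N are enough for words of degree at most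
    N. *)
Definition words (N m : nat) : seq (seq T) :=
  [seq word_of (fun t => M t) | M : {ffun T -> 'I_N.+1} <- index_enum {ffun T -> 'I_N.+1}
     & (\sum_t M t * dg t == m)%N].

Lemma words_uniq N m : uniq (words N m).
Proof.
rewrite map_inj_in_uniq ?filter_uniq ?index_enum_uniq // => M M' _ _ e.
apply/ffunP => t; apply: val_inj.
by rewrite /= -[LHS](count_word_of (fun t => M t)) e count_word_of.
Qed.

Lemma mem_words N m w : (m <= N)%N ->
  (w \in words N m) = sorted rank_le w && (wdeg dg w == m).
Proof.
move=> mN; apply/mapP/andP => [[M]|[sw /eqP dw]].
  rewrite mem_filter => /andP[/eqP dM _] ->; split; first exact: sorted_word_of.
  by rewrite wdeg_count -dM; apply/eqP/eq_bigr => t _; rewrite count_word_of.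
have cw t : (count_mem t w < N.+1)%N.
  rewrite ltnS (leq_trans _ mN) // -dw wdeg_count (bigD1 t) //=.
  by apply: (leq_trans _ (leq_addr _ _)); rewrite leq_pmulr.
exists [ffun t => Ordinal (cw t)].
  rewrite mem_filter mem_index_enum andbT -dw wdeg_count; apply/eqP/eq_bigr => t _.
  by rewrite ffunE.
apply: eq_sorted_words => //; first exact: sorted_word_of.
by apply/allP => t _ /=; rewrite count_word_of ffunE.
Qed.

Lemma big_words N m (V : Type) (idx : V) (op : Monoid.com_law idx) (f : seq T -> V) :
  \big[op/idx]_(w <- words N m) f w =
  \big[op/idx]_(M : {ffun T -> 'I_N.+1} | (\sum_t M t * dg t == m)%N)
     f (word_of (fun t => M t)).
Proof. by rewrite big_map big_filter. Qed.

End Words.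

(** * Linear independence of the sorted words *)

Section FreeMap.
Variables (F : fieldType) (V : vectType F) (I : eqType) (f : I -> V) (r : seq I).
Hypothesis r_uniq : uniq r.

Lemma free_map :
  (forall c : I -> F, \sum_(i <- r) c i *: f i = 0 -> forall i, i \in r -> c i = 0) ->
  free (map f r).
Proof.
move=> h; apply/(@freeP _ _ _ (map_tuple f (in_tuple r))) => c hc j.
pose c' i := \sum_k if tnth (in_tuple r) k == i then c k else 0.
have c'E k : c' (tnth (in_tuple r) k) = c k.
  rewrite /c' (bigD1 k) //= eqxx big1 ?addr0 // => k' /negPf kk.
  by rewrite (inj_eq (tuple_uniqP (in_tuple r) r_uniq)) kk.
rewrite -c'E; apply: h; last exact: mem_tnth.
rewrite big_tnth -[RHS]hc; apply: eq_bigr => k _.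
by rewrite c'E -tnth_nth tnth_map.
Qed.

Lemma free_map_dual i : free (map f r) -> i \in r ->
  exists phi : {linear V -> F^o}, forall j, j \in r -> phi (f j) = (j == i)%:R.
Proof.
move=> fr ir; pose X := map_tuple f (in_tuple r).
have /tnthP[k ek] : i \in in_tuple r by [].
exists (coord X k) => j jr; have /tnthP[l el] : j \in in_tuple r by [].
rewrite el ek -tnth_map -/X (tnth_nth 0) /= (coord_free (X := X)) //.
by rewrite (inj_eq (tuple_uniqP (in_tuple r) r_uniq)) eq_sym.
Qed.
End FreeMap.

Section Free.
Variables (F : fieldType) (H : algType F) (C : hopf_structure H) (G : grading H).
Hypotheses (hG : graded_hopf C G) (hC : connected G).
Hypothesis char0 : forall k : nat, (0 < k)%N -> k%:R != 0 :> F.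
Notation P := (Proj G).
Notation Delta := (comult C).
Notation augpow := (augpow G).
Notation taugpow := (taugpow G).
Notation prim := (prim C G).

Variables (N : nat) (T : finType) (y : T -> H) (dg wt : T -> nat).
Hypothesis y_prim : forall t, prim (dg t) (wt t) (y t).
Hypothesis y_span : forall i k x, (i <= N)%N -> prim i k x -> exists c : T -> F,
  augpow i k.+1 (x - \sum_(t | (dg t == i) && (wt t == k)) c t *: y t).
Hypothesis y_free : forall i k (c : T -> F), (i <= N)%N ->
  augpow i k.+1 (\sum_(t | (dg t == i) && (wt t == k)) c t *: y t) ->
  forall t, dg t = i -> wt t = k -> c t = 0.
Notation words := (words dg N).
Notation wval := (wval y).
Notation wdeg := (wdeg dg).
Notation wwt := (wwt wt).

Let dg0 := dg_gt0 y_prim.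

Definition free_deg (m : nat) : Prop := forall c : seq T -> F,
  \sum_(w <- words m) c w *: wval w = 0 -> forall w, w \in words m -> c w = 0.

Lemma grade_in_wval m w : wdeg w = m -> grade_in G m (grade_pr G m (wval w)) = wval w.
Proof. by move=> dw; have := hom_augpow hG (wval_augpow hG hC y_prim w); rewrite dw. Qed.

(** The coordinate functional of w in the basis of degree m. It vanishes on higher weights because
    these are spanned by sorted words of higher weight. *)
Lemma word_dual m w : (m <= N)%N -> free_deg m -> w \in words m ->
  exists phi : {linear H -> F^o},
    [/\ forall u, u \in words m -> phi (wval u) = (u == w)%:R,
        forall i x, homogeneous G i x -> i != m -> phi x = 0
      & forall k x, (wwt w < k)%N -> augpow m k x -> phi x = 0].
Proof.
move=> mN fm wm.
have degm u : u \in words m -> wdeg u = m.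
  by rewrite mem_words // => /andP[_ /eqP].
have fr : free [seq grade_pr G m (wval u) | u <- words m].
  apply: free_map; first exact: words_uniq.
  move=> c hc; apply: fm; rewrite -[RHS](linear0 (grade_in G m)) -hc linear_sum.
  by rewrite !big_seq; apply: eq_bigr => u /degm um; rewrite linearZ /= grade_in_wval.
have [phi hphi] := free_map_dual (words_uniq _ _ _) fr wm.
exists (phi \o grade_pr G m); split.
- by move=> u um /=; rewrite hphi.
- move=> i x hx im /=; rewrite -hx ProjE grade_pr0 ?linear0 // eq_sym //.
- move=> k x wk /(augpow_lspan hG hC y_prim y_span (@rank_le_total T)
     (@mem_words T dg dg0 N) (words_uniq _ N) mN)[c ->].
  rewrite linear_sum big1_seq // => u /andP[ku um]; rewrite linearZ /= hphi //.
  case: eqP => [uw|_]; last by rewrite scaler0.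
  by move: ku; rewrite uw leqNgt wk.
Qed.

(** If the weights of two factors add up to more than ka + kb, one of them exceeds its bound. *)
Lemma taugpow_pair m K a b ka kb (phi psi : {linear H -> F^o}) t :
  taugpow m K t ->
  (forall i x, homogeneous G i x -> i != a -> phi x = 0) ->
  (forall k x, (ka < k)%N -> augpow a k x -> phi x = 0) ->
  (forall i x, homogeneous G i x -> i != b -> psi x = 0) ->
  (forall k x, (kb < k)%N -> augpow b k x -> psi x = 0) ->
  (ka + kb < K)%N ->
  tlift (fun u v => phi u * psi v : F^o) t = 0.
Proof.
have hb : bilin (fun u v => phi u * psi v : F^o).
  split=> [v|u] c p q /=; rewrite linearP.
    by rewrite mulrDl -mulrA.
  by rewrite mulrDr mulrCA.
move=> ht p1 p2 q1 q2 kK; elim: ht kK => {m K t}.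
- move=> i j r s K u v hu hv Krs kK; rewrite tlift_tens //.
  have [ia|ia] := eqVneq i a; last by rewrite (p1 i) ?mul0r //; apply: (hom_augpow hG hu).
  have [jb|jb] := eqVneq j b; last by rewrite (q1 j) ?mulr0 //; apply: (hom_augpow hG hv).
  case: (ltnP ka r) => kr; first by rewrite (p2 r) ?mul0r // -ia.
  have ks : (kb < s)%N by lia.
  by rewrite (q2 s v ks) ?mulr0 // -jb.
- by move=> m K _; rewrite tlift0.
- by move=> m K c s s' _ h _ h' kK; rewrite tliftP // h // h' // scaler0 addr0.
Qed.

Lemma wsplits_subseq (w : seq T) p : p \in wsplits w -> subseq p.1 w && subseq p.2 w.
Proof.
elim: w p => [|t w IH] p; first by rewrite inE => /eqP->.
rewrite mem_cat => /orP[] /mapP[q /IH /andP[h1 h2] ->] /=; rewrite ?eqxx ?h1 ?h2 ?andbT //=.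
  exact: subseq_trans h2 (subseq_cons _ _).
exact: subseq_trans h1 (subseq_cons _ _).
Qed.

(** Pair the coproduct of the relation with the dual functionals of the first letter t and of the
    rest w. A word splits into t and w only if it is a rearrangement of [t :: w], and among sorted
    words only [t :: w] itself is. *)
Lemma word_free_sub m k (c : seq T -> F) t w : (m <= N)%N ->
  (forall m', (m' < m)%N -> free_deg m') ->
  augpow m k.+1 (\sum_(u <- words m | wwt u == k) c u *: wval u) ->
  t :: w \in words m -> wwt (t :: w) = k -> w != [::] -> c (t :: w) = 0.
Proof.
move=> mN fm hk tw wk w0.
have [stw dtw] : sorted (@rank_le T) (t :: w) /\ wdeg (t :: w) = m.
  by move: tw; rewrite mem_words // => /andP[? /eqP].
have dE : (dg t + wdeg w = m)%N by [].
have wE : (wt t + wwt w = k)%N by [].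
have dw : (0 < wdeg w)%N.
  by apply: leq_trans (size_wdeg y_prim w); rewrite lt0n size_eq0.
have dt := dg0 t.
have sw : sorted (@rank_le T) w
  by apply: subseq_sorted stw; [apply: rank_le_trans|apply: subseq_cons].
have mt : [:: t] \in words (dg t).
  by rewrite mem_words /wdeg /= ?addn0 ?eqxx //; lia.
have mw : w \in words (wdeg w) by rewrite mem_words ?sw ?eqxx //; lia.
have lt1 : (dg t < m)%N by lia.
have lt2 : (wdeg w < m)%N by lia.
have [phi [p0 p1 p2]] := word_dual (leq_trans (ltnW lt1) mN) (fm _ lt1) mt.
have [psi [q0 q1 q2]] := word_dual (leq_trans (ltnW lt2) mN) (fm _ lt2) mw.
pose pf := tlift (fun u v => phi u * psi v : F^o).
have hb : bilin (fun u v => phi u * psi v : F^o).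
  split=> [v|u] c' p q /=; rewrite linearP.
    by rewrite mulrDl -mulrA.
  by rewrite mulrDr mulrCA.
have dualE a u v (f : {linear H -> F^o}) : (a <= N)%N -> v \in words a ->
    (forall u, u \in words a -> f (wval u) = (u == v)%:R) ->
    (forall i x, homogeneous G i x -> i != a -> f x = 0) ->
    sorted (@rank_le T) u -> f (wval u) = (u == v)%:R.
  move=> aN va f0 f1 su; have [du|du] := eqVneq (wdeg u) a.
    by apply: f0; rewrite mem_words // su du eqxx.
  rewrite (f1 _ _ (hom_augpow hG (wval_augpow hG hC y_prim u)) du).
  case: eqP => // uv; move: va; rewrite mem_words // -uv (negPf du) andbF.
  by [].
pose cnt u : F := \sum_(p <- wsplits u) (p == ([:: t], w))%:R.
have pfE u : u \in words m -> wwt u = k -> pf (Delta (wval u)) = cnt u.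
  rewrite mem_words // => /andP[su /eqP du] wu.
  have hlow := big_wsplits_comult hG hC y_prim u.
  rewrite -(subrK (\sum_(p <- wsplits u) wval p.1 \ox wval p.2) (Delta _)).
  rewrite /pf tliftD // (taugpow_pair hlow p1 p2 q1 q2) ?add0r; last first.
    by rewrite wu /wwt /= addn0 -wE.
  rewrite tlift_sum // /cnt !big_seq; apply: eq_bigr => p pu.
  rewrite tlift_tens //; have /andP[s1 s2] := wsplits_subseq pu.
  rewrite (dualE _ _ _ phi _ mt p0 p1); [|lia|];
    last exact: subseq_sorted (@rank_le_trans T) _ _ s1 su.
  rewrite (dualE _ _ _ psi _ mw q0 q1); [|lia|];
    last exact: subseq_sorted (@rank_le_trans T) _ _ s2 su.
  by rewrite -natrM mulnb; case: p {pu s1 s2}.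
have : pf (Delta (\sum_(u <- words m | wwt u == k) c u *: wval u)) = 0.
  apply: (taugpow_pair (comult_augpow hG hC hk) p1 p2 q1 q2).
  by rewrite /wwt /= addn0 -wE.
rewrite linear_sum /pf tlift_sum // -/pf big_mkcond.
rewrite (bigD1_seq (t :: w)) ?words_uniq //= wk eqxx big1_seq ?addr0.
  rewrite linearZ /pf tliftZ // -/pf pfE // => /eqP.
  rewrite [_ == 0]mulf_eq0 => /orP[/eqP //|]; rewrite /cnt -natr_sum.
  have mem0 (v : seq T) : ([::], v) \in wsplits v.
    elim: v => [|x v IHv]; first by rewrite inE.
    by rewrite /= mem_cat; apply/orP; right; apply/mapP; exists ([::], v).
  have mem1 : ([:: t], w) \in wsplits (t :: w).
    by rewrite /= mem_cat; apply/orP; left; apply/mapP; exists ([::], w).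
  (* The coefficient is multiplied by the number of such splittings, which is positive and hence
     invertible in characteristic zero. *)
  rewrite (negPf (char0 _)) //.
  by rewrite (big_rem _ mem1) /= eqxx.
move=> u /andP[ut um]; case: eqP => // uk; rewrite linearZ /pf tliftZ // -/pf pfE //.
rewrite /cnt big1_seq ?scaler0 // => p /andP[_ pu]; case: eqP => // pE.
case/eqP: ut; have := perm_wsplits pu; rewrite pE /= => pp.
have [su _] : sorted (@rank_le T) u /\ wdeg u = m.
  by move: um; rewrite mem_words // => /andP[? /eqP].
by apply: eq_sorted_words; rewrite // perm_sym.
Qed.

(** Induction on the degree and, within a degree, on the weight. Words with at least two letters
    fall to [word_free_sub], single letters to their independence modulo the next power of I. *)
Lemma words_free m : (m <= N)%N -> free_deg m.
Proof.
have [d dE] := ubnP m; elim: d => // d IH in m dE * => mN c hc.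
have fm m' : (m' < m)%N -> free_deg m' by move=> h; apply: IH; lia.
suff h k w : w \in words m -> wwt w = k -> c w = 0 by move=> w wm; apply: h wm erefl.
have [e eE] := ubnP k; elim: e => // e IHk in k eE w *.
move=> wm wk.
(* Coefficients of smaller weight already vanish, so the weight-k part of the relation is minus its
   part of higher weight. *)
have hk : augpow m k.+1 (\sum_(u <- words m | wwt u == k) c u *: wval u).
  have : \sum_(u <- words m | wwt u == k) c u *: wval u =
      - \sum_(u <- words m | (k < wwt u)%N) c u *: wval u.
    apply/eqP; rewrite -addr_eq0 -[X in _ == X]hc; apply/eqP.
    rewrite big_mkcond [X in _ + X]big_mkcond -big_split /= big_seq [RHS]big_seq.
    apply: eq_bigr => u um; case: (ltngtP k (wwt u)) => ku; rewrite ?add0r ?addr0 //.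
    by rewrite (IHk (wwt u)) ?scale0r //; lia.
  move=> ->; apply: augpowN; rewrite big_seq_cond; apply: augpow_sum => u /andP[um ku].
  apply: augpowZ; apply: (augpow_le hG ku).
  have := wval_augpow hG hC y_prim u.
  by move: um; rewrite mem_words // => /andP[_ /eqP->].
case: w wm wk => [|t w] wm wk.
  have m0 : m = 0%N by move: wm; rewrite mem_words // => /andP[_ /eqP <-].
  have : perm_eq (words m) [:: [::]].
    apply: uniq_perm; rewrite ?words_uniq // => u; rewrite mem_words // inE m0.
    apply/andP/eqP => [[_ /eqP u0]|-> //].
    have := size_wdeg y_prim u; rewrite u0 leqn0 size_eq0 => /eqP //.
  move=> pw; move: hc; rewrite (perm_big _ pw) big_seq1 /wval big_nil => /eqP.
  by rewrite scaler_eq0 oner_eq0 orbF => /eqP.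
have [w0|w0] := eqVneq w [::]; last exact: word_free_sub fm hk wm wk w0.
rewrite w0 in wm wk *.
have dt : dg t = m.
  by move: wm; rewrite mem_words // => /andP[_ /eqP <-]; rewrite /wdeg /= addn0.
have wtt : wt t = k by move: wk; rewrite /wwt /= addn0.
apply: (y_free (i := m) (k := k) (c := fun t => c [:: t])) => //.
have := hk; congr (augpow _ _ _).
rewrite (bigID (fun u => size u == 1%N)) /= [X in _ + X]big1_seq ?addr0; last first.
  move=> u /andP[/andP[/eqP uk us] um].
  case: u uk us um => [|t' [|t'' u]] uk // _ um; last first.
    by rewrite (word_free_sub mN fm hk um uk) // scale0r.
  move: um; rewrite mem_words // => /andP[_ /eqP m0].
  by have := dg0 t; rewrite dt -m0.
have pw : perm_eq [seq u <- words m | (wwt u == k) && (size u == 1%N)]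
    [seq [:: t] | t <- enum T & (dg t == m) && (wt t == k)].
  apply: uniq_perm.
  - by rewrite filter_uniq // words_uniq.
  - rewrite map_inj_uniq; last by move=> t1 t2 [].
    by apply: filter_uniq; apply: enum_uniq.
  move=> u; rewrite mem_filter mem_words //; apply/idP/mapP.
    case: u => [|t' [|? ?]] /=; rewrite ?andbF //.
    rewrite /wwt /wdeg /= !addn0 !andbT => /andP[h1 h2].
    by exists t'; rewrite // mem_filter h1 h2 mem_enum.
  case=> t'; rewrite mem_filter => /andP[/andP[h1 h2] _] ->.
  by rewrite /wwt /wdeg /= !addn0 h1 h2.
rewrite -big_filter (perm_big _ pw) big_map big_filter big_enum_cond /=.
by apply: eq_bigr => t' _; rewrite /wval big_seq1.
Qed.

Lemma words_basis m : (m <= N)%N ->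
  basis_of {: G m} [seq grade_pr G m (wval w) | w <- words m].
Proof.
move=> mN.
have degm u : u \in words m -> wdeg u = m.
  by rewrite mem_words // => /andP[_ /eqP].
apply/andP; split; last first.
  apply: free_map; first exact: words_uniq.
  move=> c hc; apply: words_free => //.
  rewrite -[RHS](linear0 (grade_in G m)) -hc linear_sum.
  by rewrite !big_seq; apply: eq_bigr => u /degm um; rewrite linearZ /= grade_in_wval.
rewrite eqEsubv subvf /=; apply/subvP => v _.
have hv : augpow m 0 (grade_in G m v) by apply: augpow_hom; apply: hom_in.
have [c hc] := augpow_lspan hG hC y_prim y_span (@rank_le_total T)
     (@mem_words T dg dg0 N) (words_uniq _ N) mN hv.
rewrite -[v]grade_inK hc linear_sum big_seq_cond; apply: memv_suml => w /andP[wm _].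
by rewrite linearZ; apply: memvZ; apply: memv_span; apply: map_f.
Qed.

End Free.

(** * Triangular endomorphisms *)

Section CharPoly.
Import passmx.
Variables (F : fieldType) (V : vectType F).

Lemma char_poly_basis (e e' : (\dim {:V}).-tuple V) (f : 'End(V)) :
  basis_of {:V} e -> basis_of {:V} e' ->
  char_poly (mxof e e f) = char_poly (mxof e' e' f).
Proof.
move=> he he'; set A := mxof e' e' f.
pose Q := mxof e e' \1%VF; pose R := mxof e' e \1%VF.
have QR : Q *m R = 1%:M.
  by rewrite -mxof_comp // comp_lfun1l mxof1 // (basis_free he).
have -> : mxof e e f = Q *m A *m R.
  by rewrite -!mxof_comp // comp_lfun1r comp_lfun1l.
have -> : char_poly (Q *m A *m R) =
    \det (map_mx (@polyC F) Q *m char_poly_mx A *m map_mx (@polyC F) R).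
  congr (\det _); rewrite /char_poly_mx mulmxBr mulmxBl -!map_mxM.
  by rewrite mul_mx_scalar -scalemxAl -map_mxM QR map_mx1 scalemx1.
by rewrite !det_mulmx mulrAC -det_mulmx -map_mxM QR map_mx1 det1 mul1r.
Qed.

(** Sorting the basis by key makes the matrix triangular; the keys in the remainder are strictly
    smaller, so the diagonal consists of the [mu i]. *)
Lemma char_poly_triangular (I : eqType) (r : seq I) (v : I -> V) (key : I -> nat)
    (mu : I -> F) (f : 'End(V)) (e : (\dim {:V}).-tuple V) :
  basis_of {:V} e -> basis_of {:V} (map v r) -> uniq r ->
  (forall i, i \in r -> exists c : I -> F,
     f (v i) = mu i *: v i + \sum_(j <- r | (key j < key i)%N) c j *: v j) ->
  char_poly (mxof e e f) = \prod_(i <- r) ('X - (mu i)%:P).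
Proof.
move=> he hr ur hf.
pose leK i j := (key i <= key j)%N.
pose s := sort leK r.
have ps : perm_eq s r by rewrite perm_sort.
have us : uniq s by rewrite (perm_uniq ps).
have hs : basis_of {:V} (map v s) by rewrite (perm_basis _ (perm_map v ps)).
have sz : size s == \dim {:V}.
  by rewrite -(size_map v) eq_sym; apply/eqP/(vector.size_basis (X := in_tuple (map v s))).
pose st := Tuple sz; pose e' := map_tuple v st.
have he' : basis_of {:V} e' by [].
have fe' : free e' by apply: basis_free he'.
have uniq_t := tuple_uniqP st us.
have e'E (k : 'I_(\dim {:V})) : e'`_k = v (tnth st k) by rewrite -tnth_nth tnth_map.
have fE (k : 'I_(\dim {:V})) : exists c : I -> F, f (v (tnth st k)) =
    mu (tnth st k) *: v (tnth st k) +
    \sum_(l | (key (tnth st l) < key (tnth st k))%N) c (tnth st l) *: e'`_l.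
  have kr : tnth st k \in r by rewrite -(perm_mem ps); apply: mem_tnth.
  have [c ->] := hf _ kr; exists c; congr (_ + _).
  rewrite -(perm_big _ ps) /= -[s]/(tval st) big_tuple.
  by apply: eq_bigr => l _; rewrite e'E.
have coordE (k l : 'I_(\dim {:V})) : mxof e' e' f k l = coord e' l (f e'`_k).
  by rewrite mxE /= vecof_delta mxE.
rewrite (char_poly_basis _ he he') -(perm_big _ ps) /= char_poly_trig; last first.
  apply/is_trig_mxP => k l kl; rewrite coordE e'E; have [c ->] := fE k.
  rewrite linearD linearZ linear_sum /= -e'E coord_free //.
  have [lk lk'] : (l == k = false) /\ (k == l = false).
    by rewrite -!val_eqE /= (ltn_eqF kl) (gtn_eqF kl).
  rewrite ?lk ?lk'.
  rewrite mulr0 add0r big1 // => l' ll; rewrite linearZ /= coord_free //.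
  case: eqP => [e1|_]; last by rewrite mulr0.
  have : leK (tnth st k) (tnth st l).
    have [x0 _] : exists x0 : I, True by exists (tnth st k).
    rewrite !(tnth_nth x0) /=.
    apply: (sorted_leq_nth (leT := leK)) => //.
    - by move=> i1 i2 i3; apply: leq_trans.
    - by move=> i1; apply: leqnn.
    - by apply: sort_sorted => i1 i2; apply: leq_total.
    - by rewrite inE (eqP sz); apply: ltn_ord.
    - by rewrite inE (eqP sz); apply: ltn_ord.
    - exact: ltnW.
  by rewrite /leK leqNgt -e1 ll.
rewrite -[s]/(tval st) big_tuple; apply: eq_bigr => k _.
congr ('X - _%:P); rewrite coordE e'E; have [c ->] := fE k.
rewrite linearD linearZ linear_sum /= -e'E coord_free // eqxx mulr1.
rewrite big1 ?addr0 // => l kl; rewrite linearZ /= coord_free //.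
by case: eqP kl => [->|_ _]; rewrite ?ltnn // mulr0.
Qed.
End CharPoly.

(** * Choice of the letters *)

Section VspaceOf.
Variables (F : fieldType) (V : vectType F) (Q : V -> Prop).
Hypotheses (Q0 : Q 0) (QP : forall c u v, Q u -> Q v -> Q (c *: u + v)).

(** A subspace inside Q that misses a vector of Q can be enlarged by its line; the dimension of V
    bounds the number of enlargements. *)
Lemma vspace_of_pred : exists U : {vspace V}, forall v, v \in U <-> Q v.
Proof.
suff [U [UQ QU]] : exists U : {vspace V},
    (forall v, v \in U -> Q v) /\ (forall v, Q v -> v \in U).
  by exists U => v; split; [apply: UQ|apply: QU].
have : exists U : {vspace V}, forall v, v \in U -> Q v.
  by exists 0%VS => v; rewrite memv0 => /eqP->.
case=> U; have [d dE] := ubnP (\dim {:V} - \dim U)%N; elim: d => // d IH in U dE *.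
move=> UQ; have [h|] := pselect (forall v, Q v -> v \in U); first by exists U.
case/existsNP => v /not_implyP[Qv /negP vU].
have v0 : v != 0 by apply: contraNneq vU => ->; apply: mem0v.
apply: (IH (U + <[v]>)%VS).
  have : (\dim U < \dim (U + <[v]>))%N.
    rewrite (ltn_leqif (dimv_leqif_eq (addvSl _ _))).
    by apply: contraNneq vU => ->; apply: (subvP (addvSr _ _)); apply: memv_line.
  have := dimvS (subvf (U + <[v]>)%VS); lia.
move=> w /memv_addP[u uU [_ /vlineP[c ->] ->]].
by rewrite addrC; apply: QP => //; apply: UQ.
Qed.
End VspaceOf.

Section Generators.
Variables (F : fieldType) (H : algType F) (C : hopf_structure H) (G : grading H).
Hypotheses (hG : graded_hopf C G) (hC : connected G).
Notation augpow := (augpow G).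
Notation prim := (prim C G).

Lemma augpow_vspace i k :
  {U : {vspace G i} | forall v, v \in U <-> augpow i k (grade_in G i v)}.
Proof.
apply/cid/vspace_of_pred => [|c u v hu hv]; first by rewrite linear0; apply: augpow0.
by rewrite linearP; apply: augpowP.
Qed.

Lemma prim_vspace i k :
  {U : {vspace G i.+1} | forall v, v \in U <-> prim i.+1 k (grade_in G i.+1 v)}.
Proof.
apply/cid/vspace_of_pred => [|c u v hu hv]; first by rewrite linear0; apply: prim0.
by rewrite linearP; apply: primP.
Qed.

(** A complement of I^(k+1) among the primitives of weight k, in degree i + 1: representatives of
    the primitives of the associated graded algebra. *)
Definition gens i k : {vspace G i.+1} :=
  (sval (prim_vspace i k) :\: sval (augpow_vspace i.+1 k.+1))%VS.

Lemma gens_prim i k v : v \in gens i k -> prim i.+1 k (grade_in G i.+1 v).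
Proof.
move=> vg; apply/(svalP (prim_vspace i k) v).
exact: (subvP (diffvSl _ _)) vg.
Qed.

Lemma gens_free i k v : v \in gens i k -> augpow i.+1 k.+1 (grade_in G i.+1 v) -> v = 0.
Proof.
move=> vg /(svalP (augpow_vspace i.+1 k.+1) v) va; apply/eqP.
rewrite -memv0 -(capv_diff (sval (prim_vspace i k)) (sval (augpow_vspace i.+1 k.+1))).
by rewrite memv_cap vg.
Qed.

Lemma gens_span i k x : prim i.+1 k x -> exists2 v, v \in gens i k &
  augpow i.+1 k.+1 (x - grade_in G i.+1 v).
Proof.
move=> hx; have [_ /(hom_augpow hG) hom_x _] := hx.
have xE : grade_in G i.+1 (grade_pr G i.+1 x) = x by rewrite -[RHS]hom_x ProjE.
have : grade_pr G i.+1 x \in sval (prim_vspace i k).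
  by apply/(svalP (prim_vspace i k)); rewrite xE.
rewrite -(addv_diff_cap (sval (prim_vspace i k)) (sval (augpow_vspace i.+1 k.+1))) =>
  /memv_addP[v vg [u ug e]].
exists v => //; rewrite -xE e linearD addrC addKr.
apply/(svalP (augpow_vspace i.+1 k.+1)).
by move: ug; rewrite memv_cap => /andP[].
Qed.

Lemma dim_gens_gt i k : (i < k)%N -> \dim (gens i k.+1) = 0%N.
Proof.
move=> ik; apply/eqP; rewrite dimv_eq0 -subv0; apply/subvP => v vg; rewrite memv0.
have [_ /(augpow_gt (n := i.+1)) h _] := gens_prim vg.
by rewrite -[v]grade_inK h ?linear0 // ltnS.
Qed.

(** The number of letters of degree i. The weights run from 1 to i, since weight never exceeds
    degree; the predecessor undoes the shift in [gens]. *)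
Definition ngens (i : nat) : nat := (\sum_(k < i) \dim (gens i.-1 k.+1))%N.

Section Bounded.
Variable N : nat.

(** The pair p stands for degree [p.1.+1] and weight [p.2.+1]. *)
Definition gen_index (p : 'I_N * 'I_N) : finType := 'I_(\dim (gens p.1 p.2.+1)).
Definition letter : finType := {p : 'I_N * 'I_N & gen_index p}.
Definition ldeg (t : letter) : nat := (tag t).1.+1.
Definition lwt (t : letter) : nat := (tag t).2.+1.
Definition lval (t : letter) : H :=
  grade_in G _ (vbasis (gens (tag t).1 (tag t).2.+1))`_(tagged t).

Lemma big_letter (V : Type) (idx : V) (op : Monoid.com_law idx)
    (Q : pred ('I_N * 'I_N)) (f : letter -> V) :
  \big[op/idx]_(t | Q (tag t)) f t =
  \big[op/idx]_(p | Q p)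
    \big[op/idx]_(j < \dim (gens p.1 p.2.+1)) f (Tagged gen_index (j : gen_index p)).
Proof.
rewrite (@sig_big_dep V idx op _ gen_index Q (fun _ => xpredT)
  (fun p j => f (Tagged gen_index j))).
by apply: eq_big => [t|[p j] _] //=; rewrite andbT.
Qed.

Lemma lval_prim t : prim (ldeg t) (lwt t) (lval t).
Proof.
apply: gens_prim; apply: vbasis_mem; apply: mem_nth.
by rewrite size_tuple.
Qed.

Lemma big_letter_deg_wt (i k : 'I_N) (c : letter -> F) :
  \sum_(t | (ldeg t == i.+1) && (lwt t == k.+1)) c t *: lval t =
  grade_in G i.+1 (\sum_(j < \dim (gens i k.+1))
     c (Tagged gen_index (j : gen_index (i, k)))
       *: (vbasis (gens i k.+1))`_j).
Proof.
rewrite (big_letter _ (fun p => (p.1.+1 == i.+1) && (p.2.+1 == k.+1))).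
rewrite (big_pred1 (i, k)) => [|[i' k'] /=]; last by rewrite !eqSS xpair_eqE !val_eqE.
by rewrite linear_sum; apply: eq_bigr => j _; rewrite linearZ.
Qed.

Lemma lval_span i k x : (i <= N)%N -> prim i k x -> exists c : letter -> F,
  augpow i k.+1 (x - \sum_(t | (ldeg t == i) && (lwt t == k)) c t *: lval t).
Proof.
case: i => [|i] iN hx; first by case: hx.
have [_ ax _] := hx.
have zero : augpow i.+1 k.+1 x -> exists c : letter -> F,
  augpow i.+1 k.+1 (x - \sum_(t | (ldeg t == i.+1) && (lwt t == k)) c t *: lval t).
  move=> h; exists (fun=> 0); rewrite big1 ?subr0 // => t _; exact: scale0r.
(* No letters are needed in weight 0, as positive degree already means lying in I, nor in weights
   above N, where x is zero. *)
case: k => [|k] in hx ax zero *.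
  by apply: zero; apply: (hom_augpow1 hG) => //; apply: (hom_augpow hG ax).
case: (ltnP k N) => kN; last first.
  by apply: zero; rewrite (augpow_gt _ ax) //; [apply: augpow0|lia].
have [v vg hv] := gens_span hx.
(* Passing through H moves v into the grade named by the tag of t; on the letters that enter the sum
   this round trip is the identity. *)
exists (fun t : letter => coord (vbasis (gens (tag t).1 (tag t).2.+1)) (tagged t)
  (grade_pr G _ (grade_in G i.+1 v))).
rewrite (big_letter_deg_wt (Ordinal iN) (Ordinal kN)) /= grade_inK.
by rewrite -coord_vbasis.
Qed.

Lemma lval_free i k (c : letter -> F) : (i <= N)%N ->
  augpow i k.+1 (\sum_(t | (ldeg t == i) && (lwt t == k)) c t *: lval t) ->
  forall t, ldeg t = i -> lwt t = k -> c t = 0.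
Proof.
move=> _ h [[i' k'] j] /= ei ek; rewrite /ldeg /= in ei; rewrite /lwt /= in ek.
rewrite -ei -ek big_letter_deg_wt in h.
have /gens_free/(_ h) : \sum_(j < \dim (gens i' k'.+1))
     c (Tagged gen_index (j : gen_index (i', k')))
       *: (vbasis (gens i' k'.+1))`_j \in gens i' k'.+1.
  apply: memv_suml => j' _; apply: memvZ; apply: vbasis_mem; apply: mem_nth.
  by rewrite size_tuple.
have /freeP hf := basis_free (vbasisP (gens i' k'.+1)).
by move/hf/(_ j).
Qed.

Lemma card_ldeg i : (0 < i <= N)%N -> #|[pred t | ldeg t == i]| = ngens i.
Proof.
case: i => // i /= iN.
rewrite -sum1_card (big_letter _ (fun p => p.1.+1 == i.+1)) /=.
transitivity (\sum_(k < N) \dim (gens i k.+1))%N.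
  under eq_bigl => p do rewrite -[p.1.+1 == _]andbT.
  rewrite -(pair_big_dep (fun p : 'I_N => p.+1 == i.+1) (fun _ _ : 'I_N => true)
    (fun p1 p2 : 'I_N => \sum_(j < \dim (gens p1 p2.+1)) 1)%N) /=.
  rewrite (big_pred1 (Ordinal iN)) => [|p]; last first.
    by apply/eqP/eqP => [[e]|-> //]; apply: val_inj.
  by apply: eq_bigr => k _; rewrite sum1_card card_ord.
rewrite /ngens /= [RHS](big_ord_widen N (fun k => \dim (gens i k.+1))) //.
rewrite [RHS]big_mkcond; apply: eq_bigr => k _; case: ltnP => // ik.
by rewrite dim_gens_gt.
Qed.

End Bounded.
End Generators.

(** * Counting ordered monomials *)

Section ExpansionUnique.

(* [p] is [1 + c X^m] modulo [X^(m+1)]. *)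
Definition lead1 (m : nat) (p : {poly int}) (c : int) : Prop :=
  forall j, (j <= m)%N -> p`_j = if j == 0%N then 1 else if j == m then c else 0.

Lemma coefM_lead1 m j (p q : {poly int}) c : (0 < j <= m)%N -> lead1 m q c ->
  (p * q)`_j = p`_0 * q`_j + p`_j.
Proof.
case: j => // j jm hq; rewrite coefM big_ord_recl big_ord_recr /= subn0 subnn.
rewrite big1 ?add0r; last first.
  move=> i _; have ij := ltn_ord i; rewrite hq /bump /=; last by lia.
  rewrite ifN; last by lia.
  by rewrite ifN ?mulr0 //; lia.
by rewrite /bump /= add1n (hq 0%N) // eqxx mulr1.
Qed.

Lemma lead1M m p q c d : lead1 m p c -> lead1 m q d -> lead1 m (p * q) (c + d).
Proof.
move=> hp hq [|j] jm; first by rewrite coef0M hp // hq // mulr1.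
rewrite (coefM_lead1 _ _ hq) ?jm // hp // hp // hq // eqxx mul1r /=.
by case: eqP => _; rewrite ?addr0 // addrC.
Qed.

Lemma lead1X m p c k : lead1 m p c -> lead1 m (p ^+ k) (c * k%:Z).
Proof.
move=> hp; elim: k => [|k IH].
  by move=> j jm; rewrite expr0 mulr0 coef1 if_same; case: eqP.
by rewrite exprS intS mulrDr mulr1; apply: lead1M.
Qed.

Lemma lead1_geom_pow m b : (0 < m)%N -> lead1 m (geom_pow m ('X^m) b) b.
Proof.
move=> m0; case: b => k /=.
  rewrite -[Posz k]mul1r; apply: lead1X => j jm; rewrite coef_sum.
  under eq_bigr => i _ do rewrite -exprM coefXn.
  have [->|j0] := eqVneq j 0%N.
    rewrite big_ord_recl muln0 eqxx big1 ?addr0 // => i _.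
    by rewrite eq_sym gtn_eqF // muln_gt0 m0.
  have [->|jm'] := eqVneq j m.
    case: m m0 {jm} => // m _; rewrite 2!big_ord_recl muln0 muln1 eqxx /=.
    rewrite big1 ?add0r ?addr0 // => i _; case: eqP => //; rewrite /bump /=; lia.
  rewrite big1 // => i _; case: eqP => // e; case: i e => -[|[|i]] /= _ ; nia.
have -> : Negz k = -1 * k.+1%:Z by rewrite NegzE mulN1r.
apply: lead1X => j jm; rewrite coefB coef1 coefXn.
case: eqP => [->|_]; last by rewrite sub0r; case: eqP.
by rewrite eq_sym gtn_eqF // subr0.
Qed.

Lemma coef0_geom_pow N m b : (0 < m)%N -> (geom_pow N ('X^m : {poly int}) b)`_0 = 1.
Proof.
move=> m0; rewrite -horner_coef0; case: b => k; rewrite /= horner_exp.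
  rewrite horner_sum big_ord_recl big1 ?addr0 => [|i _].
    by rewrite expr0 hornerC expr1n.
  by rewrite !horner_exp hornerX expr0n (gtn_eqF m0) expr0n.
by rewrite hornerD hornerN hornerXn hornerC expr0n (gtn_eqF m0) subr0 expr1n.
Qed.

(** Up to t^i the i-th factor is 1 + b_i t^i. Once the earlier exponents agree, the coefficient of
    t^i determines b_i. *)
Lemma product_expansion_unique dims b b' :
  product_expansion dims b -> product_expansion dims b' ->
  forall i, (0 < i)%N -> b i = b' i.
Proof.
move=> h h' i; have [d dE] := ubnP i; elim: d => // d IH in i dE *.
case: i dE => // i dE _; have := h i.+1; rewrite (h' i.+1).
rewrite !(big_nat_recr i.+1) //=.
have -> : \prod_(1 <= j < i.+1) geom_pow i.+1 ('X^j : {poly int}) (b' j) =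
    \prod_(1 <= j < i.+1) geom_pow i.+1 ('X^j : {poly int}) (b j).
  by apply: eq_big_nat => j /andP[j0 ji]; rewrite (IH j) //; lia.
set Q := \prod_(1 <= j < i.+1) _.
have Q0 : Q`_0 = 1.
  rewrite /Q big_seq coef0_prod big1 // => j; rewrite mem_index_iota => /andP[j0 _].
  exact: coef0_geom_pow.
have key c : (Q * geom_pow i.+1 ('X^(i.+1) : {poly int}) c)`_i.+1 = c + Q`_i.+1.
  have hl := @lead1_geom_pow i.+1 c isT.
  rewrite (@coefM_lead1 i.+1 _ _ _ c) ?leqnn //.
  by rewrite Q0 mul1r hl //= eqxx.
by rewrite !key => /addIr.
Qed.
End ExpansionUnique.

Section Count.
Variables (F : fieldType) (H : algType F) (C : hopf_structure H) (G : grading H).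
Hypotheses (hG : graded_hopf C G) (hC : connected G).
Notation ngens := (ngens hG hC).
Notation letter := (letter hG hC).
Notation ldeg := (@ldeg _ _ _ _ hG hC _).

(** One geometric series per letter; expanding chooses a multiplicity for each letter, that is, a
    sorted word. *)
Lemma prod_letters (R : comNzRingType) N K (x : 'I_N -> R) :
  \prod_(i < N) (\sum_(k < K) x i ^+ k) ^+ ngens i.+1 =
  \sum_(M : {ffun letter N -> 'I_K}) \prod_t x (tag t).1 ^+ M t.
Proof.
rewrite -(bigA_distr_bigA (fun (t : letter N) (k : 'I_K) => x (tag t).1 ^+ k)).
rewrite (partition_big (fun t : letter N => (tag t).1) xpredT) //=.
apply: eq_bigr => i _.
transitivity (\prod_(t : letter N | (tag t).1 == i) \sum_(k < K) x i ^+ k); last first.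
  by apply: eq_bigr => t /eqP ->.
rewrite prodr_const; congr (_ ^+ _).
rewrite -(card_ldeg hG hC (N := N)) /=; last exact: ltn_ord.
by apply: eq_card => t; rewrite !inE /ldeg eqSS.
Qed.

Notation wordof M := (word_of (fun t : letter _ => M t)).

Hypothesis char0 : forall k : nat, (0 < k)%N -> k%:R != 0 :> F.

Lemma pbw_product_expansion :
  product_expansion (fun m => \dim {: G m}) (fun i => Posz (ngens i)).
Proof.
move=> m; have := words_basis hG hC char0 (@lval_prim _ _ _ _ hG hC m)
  (@lval_span _ _ _ _ hG hC m) (@lval_free _ _ _ _ hG hC m) (leqnn m).
move=> hb; have -> := @vector.size_basis _ _ _ _ (in_tuple _) hb.
rewrite size_map -sum1_size big_words big_add1 /= big_mkord.
rewrite (prod_letters m.+1 (fun i : 'I_m => 'X^(i.+1) : {poly int})) coef_sum.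
rewrite -natz natr_sum [LHS]big_mkcond; apply: eq_bigr => M _.
have -> : \prod_(t : letter m) ('X^((tag t).1.+1) : {poly int}) ^+ M t =
    'X^(\sum_t M t * ldeg t).
  rewrite (big_morph (fun k => 'X^k : {poly int}) (exprD 'X) (expr0 'X)).
  by apply: eq_bigr => t _; rewrite -exprM mulnC.
by rewrite coefXn eq_sym; case: eqP.
Qed.

Lemma count_ldeg N (w : seq (letter N)) d :
  count_mem d (map ldeg w) = (\sum_(t | ldeg t == d) count_mem t w)%N.
Proof.
elim: w => [|u w IH]; first by rewrite big1.
rewrite /= IH big_split /=; congr (_ + _)%N.
rewrite big_mkcond (bigD1 u) //= eqxx big1 ?addn0 => [|t /negPf tu]; first by case: eqP.
by rewrite [u == t]eq_sym tu if_same.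
Qed.

(** The monomial of a word records how often each degree occurs among its letters, so it is x_lambda
    exactly when these degrees are lambda up to order. *)
Lemma part_mult_pbw n (lam : intpart n) :
  part_mult (fun i => Posz (ngens i)) lam =
  Posz #|[pred M : {ffun letter n -> 'I_n.+1} | perm_eq (map ldeg (wordof M)) lam]|.
Proof.
rewrite /part_mult /geom_pow (prod_letters n.+1 (fun i : 'I_n => 'X_i : {mpoly int[n]})).
rewrite raddf_sum -[RHS]natz -sum1_card natr_sum [RHS]big_mkcond.
apply: eq_bigr => M _; rewrite !inE.
under eq_bigr => t _ do rewrite mpolyXn.
rewrite -(big_morph (fun m => 'X_[m] : {mpoly int[n]}) (mpolyXD _)
  (mpolyX0 _ _)) /= mcoeffX.
suff -> : (\sum_(t : letter n) U_((tag t).1) *+ M t)%MM == part_monom lam =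
    perm_eq (map ldeg (wordof M)) lam.
  by case: perm_eq.
have [lam0 lam_n] := intpartP lam.
have monE (i : 'I_n) : (\sum_(t : letter n) U_((tag t).1) *+ M t)%MM i =
    count_mem i.+1 (map ldeg (wordof M)).
  rewrite mnm_sumE count_ldeg [RHS]big_mkcond; apply: eq_bigr => t _.
  rewrite mulmnE mnm1E count_word_of /ldeg eqSS val_eqE.
  by case: eqP => _; rewrite ?mul1n ?mul0n.
apply/eqP/idP => [/mnmP e|/permP e].
  apply/allP => d _ /=; case: d => [|d].
    rewrite !(count_memPn _) //; first by apply/negP => /(allP lam0).
    by apply/negP => /mapP[t _].
  case: (ltnP d n) => dn.
    by have := e (Ordinal dn); rewrite monE mnmE => ->.
  rewrite !(count_memPn _) //.
    apply/negP => dl; have : (sumn lam >= d.+1)%N.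
      by rewrite sumnE (big_rem _ dl) leq_addr.
    by rewrite lam_n; lia.
  apply/negP => /mapP[t _ e1]; have := ltn_ord (tag t).1.
  by move: e1; rewrite /ldeg => -[<-]; rewrite ltnNge dn.
by apply/mnmP => i; rewrite monE mnmE -e.
Qed.

End Count.

(** * The characteristic polynomial *)

Section Spectrum.
Import passmx.
Variables (F : realFieldType) (H : algType F) (C : hopf_structure H) (G : grading H).
Hypotheses (hG : graded_hopf C G) (hC : connected G).
Variables (a n : nat) (alpha : wcomp a n -> F).
Variable B : (\dim {: G n}).-tuple (G n).
Hypothesis hB : basis_of {: G n} B.

Notation ngens := (ngens hG hC).
Notation letter := (letter hG hC n).
Notation ldeg := (@ldeg _ _ _ _ hG hC n).
Notation lval := (@lval _ _ _ _ hG hC n).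
Notation lwt := (@lwt _ _ _ _ hG hC n).
Notation words := (words ldeg n n).
Notation Psi := (Psi C G alpha).
Notation beta := (beta_seq alpha).

Lemma natr_neq0 k : (0 < k)%N -> k%:R != 0 :> F.
Proof. by move=> k0; rewrite pnatr_eq0 -lt0n. Qed.

Lemma lwt_le_ldeg (t : letter) : (lwt t <= ldeg t)%N.
Proof.
rewrite leqNgt; apply/negP; case: t => [[i k] j] lt.
have ik : (i < k)%N := lt.
have : (0 < \dim (gens hG hC i k.+1))%N by exact: leq_ltn_trans (leq0n j) (ltn_ord j).
by rewrite dim_gens_gt.
Qed.

Lemma wwt_le_wdeg (w : seq letter) : (wwt lwt w <= wdeg ldeg w)%N.
Proof.
elim: w => // t w IH; rewrite /wwt /wdeg /=.
by apply: leq_add => //; apply: lwt_le_ldeg.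
Qed.

Lemma Psi_word (w : seq letter) : wdeg ldeg w = n ->
  lfil G lval ldeg lwt n (wwt lwt w) (size w)
    (Psi (wval lval w) - beta (map ldeg w) *: wval lval w).
Proof.
move=> dw; rewrite PsiE /beta_seq scaler_suml -sumrB; apply: lfil_sum => D _.
rewrite -scalerA -scalerBr; apply: lfilZ.
have := @convProjs_word _ _ _ _ hG hC n _ _ _ _ (@lval_prim _ _ _ _ hG hC n)
  (@lval_span _ _ _ _ hG hC n) (wcomp_seq D) w.
by rewrite dw; apply.
Qed.

(** The order of [wlow] as one number: larger weight first, then fewer letters. Words of degree n
    have weight and length at most n, so base n + 1 separates the two digits. *)
Definition wkey (w : seq letter) : nat := ((n - wwt lwt w) * n.+1 + size w)%N.

Lemma Psi_n_word c (w : seq letter) : w \in words -> exists d : seq letter -> F,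
  (c *: Psi_n C G alpha) (grade_pr G n (wval lval w)) =
  (c * beta (map ldeg w)) *: grade_pr G n (wval lval w) +
  \sum_(u <- words | (wkey u < wkey w)%N) d u *: grade_pr G n (wval lval u).
Proof.
have dg0 := dg_gt0 (@lval_prim _ _ _ _ hG hC n).
have mem_w u : u \in words -> wdeg ldeg u = n by rewrite mem_words // => /andP[_ /eqP].
move=> wn; have dw := mem_w _ wn.
have := lfil_lspan hG hC (@lval_prim _ _ _ _ hG hC n) (@lval_span _ _ _ _ hG hC n)
  (@rank_le_total _) (@mem_words _ _ dg0 n) (words_uniq _ n) (leqnn n) (Psi_word dw).
case=> d hd; exists (fun u => if wlow lwt (wwt lwt w) (size w) u then c * d u else 0).
rewrite !lfunE /= lfunE /=.
rewrite (grade_in_wval hG hC (@lval_prim _ _ _ _ hG hC n) dw).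
rewrite -[Psi_fun _ _ _ _](subrK (beta (map ldeg w) *: wval lval w)) hd linearD.
rewrite scalerDr addrC.
congr (_ + _); first by rewrite linearZ scalerA.
rewrite linear_sum scaler_sumr big_mkcond [RHS]big_mkcond.
rewrite big_seq [RHS]big_seq; apply: eq_bigr => u um.
have du := mem_w _ um; have wu := wwt_le_wdeg u; have ww := wwt_le_wdeg w.
have su := size_wdeg (@lval_prim _ _ _ _ hG hC n) u; rewrite du in su.
rewrite /wlow; case: ifP => [|_]; last by rewrite scale0r if_same.
move=> low; rewrite linearZ scalerA ifT //.
rewrite /wkey; rewrite du in wu; rewrite dw in ww.
by case/orP: low => [lt|/andP[/eqP-> ?]]; nia.
Qed.

Lemma char_poly_Psi c :
  char_poly (mxof B B (c *: Psi_n C G alpha)) =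
  \prod_(w <- words) ('X - (c * beta (map ldeg w))%:P).
Proof.
apply: (char_poly_triangular (v := fun w => grade_pr G n (wval lval w))
  (key := wkey)) => //.
- apply: (words_basis hG hC natr_neq0 (@lval_prim _ _ _ _ hG hC n)
    (@lval_span _ _ _ _ hG hC n) (@lval_free _ _ _ _ hG hC n) (leqnn n)).
- exact: words_uniq.
- by move=> w wn; apply: Psi_n_word.
Qed.

(** Words are grouped by the unique partition of n formed by their letter degrees; the size of a
    group is the multiplicity. *)
Lemma prod_words_intpart (R : comNzRingType) (h : seq nat -> R) :
  (forall E E', perm_eq E E' -> h E = h E') ->
  \prod_(w <- words) h (map ldeg w) =
  \prod_(lam : intpart n)
    h lam ^+ `|part_mult (fun i => Posz (ngens i)) lam|%N.
Proof.
move=> hp; rewrite big_words.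
have dg0 := dg_gt0 (@lval_prim _ _ _ _ hG hC n).
transitivity (\prod_(M : {ffun letter -> 'I_n.+1} | (\sum_t M t * ldeg t == n)%N)
   \prod_(lam : intpart n | perm_eq (map ldeg (word_of (fun t => M t))) lam) h lam).
  apply: eq_bigr => M /eqP dM; set E := map _ _.
  have E0 : all (predC1 0%N) E.
    by apply/allP => _ /mapP[t _ ->].
  have sE : sumn E = n.
    rewrite -[sumn E]/(wdeg ldeg _) wdeg_count -[RHS]dM.
    by apply: eq_bigr => t _; rewrite count_word_of.
  have [lam pl] := intpart_exists E0 sE.
  rewrite (bigD1 lam) /=; last by rewrite perm_sym.
  rewrite big1 ?mulr1 => [|mu /andP[pmu]]; first by apply: hp; rewrite perm_sym.
  by case/eqP; apply: perm_intpart_eq; rewrite -(permPl pmu) perm_sym.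
rewrite (exchange_big_dep xpredT) //=; apply: eq_bigr => lam _.
rewrite part_mult_pbw prodr_const; congr (_ ^+ _).
apply: eq_card => M; rewrite !inE unfold_in andbC.
case pl: perm_eq => //=; apply/eqP.
have [_ ln] := intpartP lam; rewrite -[RHS]ln -(perm_sumn pl).
rewrite -[sumn _]/(wdeg ldeg _) wdeg_count.
by apply: eq_bigr => t _; rewrite count_word_of.
Qed.

End Spectrum.

Lemma leigenvalue_root_char (F : fieldType) (V : vectType F)
    (e : (\dim {:V}).-tuple V) (f : 'End(V)) (x : F) : basis_of {:V} e ->
  passmx.leigenvalue f x = root (char_poly (passmx.mxof e e f)) x.
Proof.
move=> he; rewrite -eigenvalue_root_char /passmx.leigenvalue.
by rewrite (passmx.leigenspaceE he) passmx.vsof_eq0.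
Qed.

Theorem theorem4p2 (F : realFieldType) (H : algType F)
    (C : hopf_structure H) (G : grading H)
    (B : forall n, (\dim {: G n}).-tuple (G n))
    (a n : nat) (alpha : wcomp a n -> F) (b : nat -> int) :
  graded_hopf C G -> connected G -> state_space_basis C B ->
  (2 <= a)%N -> nonneg_weights alpha ->
  product_expansion (fun m => \dim {: G m}) b ->
  let PsiB := passmx.mxof (B n) (B n) (Psi_n C G alpha) in
  [/\ forall lam : intpart n, 0 <= part_mult b lam,
      forall x : F,
        passmx.leigenvalue ((beta_n alpha)^-1 *: Psi_n C G alpha) x <->
        exists2 lam : intpart n, 0 < part_mult b lam &
          x = beta_part alpha lam / beta_n alpha,
      char_poly ((beta_n alpha)^-1 *: PsiB) =
        \prod_(lam : intpart n)
          ('X - (beta_part alpha lam / beta_n alpha)%:P) ^+ `|part_mult b lam|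
    & commutative (@GRing.mul H) \/ cocommutative C -> diagonalizable PsiB].
Proof.
move=> hG hC [hB _ _ _] a2 hw hb PsiB.
have [alpha0 [D [Dn _]]] := hw.
have a0 : (0 < a)%N by apply: leq_trans a2.
(* The composition with positive weight has a part that is at most n but different from n. *)
have n0 : (0 < n)%N.
  apply: leq_ltn_trans (leq0n (D (Ordinal a0))) _.
  rewrite ltn_neqAle Dn /= -ltnS; exact: ltn_ord.
have b_ngens i : (0 < i)%N -> b i = ngens hG hC i.
  exact: product_expansion_unique hb (pbw_product_expansion hG hC (@natr_neq0 F)) _.
have mult_ngens (lam : intpart n) :
    part_mult b lam = part_mult (fun i => Posz (ngens hG hC i)) lam.
  rewrite /part_mult; congr (_ @_ _); apply: eq_bigr => i _.
  by rewrite b_ngens.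
have mult_ge0 (lam : intpart n) : 0 <= part_mult b lam.
  by rewrite mult_ngens part_mult_pbw.
set c := (beta_n alpha)^-1; set f := c *: Psi_n C G alpha.
have charE : char_poly (passmx.mxof (B n) (B n) f) = \prod_(lam : intpart n)
    ('X - (beta_part alpha lam / beta_n alpha)%:P) ^+ `|part_mult b lam|.
  rewrite (char_poly_Psi hG hC alpha (hB n)).
  rewrite (@prod_words_intpart F H C G hG hC n _ (fun E => 'X - (c * beta_seq alpha E)%:P)).
    by apply: eq_bigr => lam _; rewrite mult_ngens beta_seq_part mulrC.
  by move=> E E' pE; rewrite (beta_seq_perm _ pE).
split=> //.
- move=> x; rewrite (leigenvalue_root_char f x (hB n)) charE.
  (* A factor contributes a root exactly when its exponent is nonzero, that is, when the
     multiplicity is positive. *)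
  rewrite /root horner_prod prodf_seq_eq0; split.
    case/hasP => lam _ /=; rewrite horner_exp expf_eq0 hornerXsubC subr_eq0.
    by case/andP=> m0 /eqP->; exists lam => //; rewrite lt0r mult_ge0 andbT -absz_eq0 -lt0n.
  case=> lam m0 ->; apply/hasP; exists lam; first exact: mem_index_enum.
  rewrite /= horner_exp expf_eq0 hornerXsubC subrr eqxx andbT lt0n absz_eq0.
  by rewrite gt_eqF.
- rewrite -charE /f; congr char_poly.
  have := passmx.mxof_linear (B n) (B n) c (Psi_n C G alpha) 0.
  rewrite -[passmx.mxof _ _ 0]/(to_linear (passmx.mxof_linear (B n) (B n)) 0).
  by rewrite linear0 !addr0.
- by move=> hcc; apply: Psi_n_diagonalizable.
Qed.
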